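(* Let $x\in\mathbb R^n$, $x\neq 0$, and let $a_1,\dots,a_m$ be i.i.d. standard Gaussian random vectors in $\mathbb R^n$. Consider $$f(u)=\frac1m\sum_{k=1}^m\frac{\big((a_k\cdot u)^2-(a_k\cdot x)^2\big)^2}{(a_k\cdot x)^2},\qquad u\in\mathbb R^n .$$ There exist positive absolute constants $c$, $C$ such that if $m\ge Cn$, then with probability at least $1-e^{-cm}$ the loss function $f=f(u)$ has no spurious local minimizers: the only global minimizers are $\pm x$, and $f$ is strongly convex in a neighborhood of $\pm x$. The point $u=0$ is a local maximum point with strictly negative-definite Hessian. All other critical points are strict saddles, i.e., each saddle point has a neighborhood where $f$ has negative directional curvature.
   Context: Standard Gaussian means $a_k\sim\mathcal N(0,I_n)$. Almost surely $a_k\cdot x\ne0$ for all $k$, so $f$ is almost surely well defined and smooth. ''No spurious local minimizers'' means every local minimizer of $f$ is a global minimizer. ''Negative directional curvature in a neighborhood'' of a point means that at the points $u$ of that neighborhood there is a direction $\xi\in\mathbb R^n$, $\|\xi\|_2=1$, with $\sum_{i,j}\xi_i\xi_j(\partial_{ij}f)(u)<0$. Absolute constants do not depend on $n$, $m$ or $x$. *)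

(* Defs.v *)
From HB Require Import structures.
From mathcomp Require Import all_boot all_order all_algebra.
From mathcomp Require Import all_classical all_reals all_analysis.

Set Implicit Arguments.
Unset Strict Implicit.
Unset Printing Implicit Defensive.
Import Order.TTheory GRing.Theory Num.Theory.
Import numFieldNormedType.Exports.

Local Open Scope classical_set_scope.
Local Open Scope ring_scope.

(* R^n is 'rV[R]_n; its library norm `|u| is the sup norm, hence norm2 for the
   Euclidean one.  Both norms induce the topology used by nbhs. *)
Definition dotp (R : realType) (n : nat) (u v : 'rV[R]_n) : R :=
  \sum_(i < n) u 0 i * v 0 i.

Definition norm2 (R : realType) (n : nat) (u : 'rV[R]_n) : R :=
  Num.sqrt (dotp u u).

Definition partial (R : realType) (n : nat) (i : 'I_n) (f : 'rV[R]_n -> R)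
    (u : 'rV[R]_n) : R :=
  'D_(delta_mx 0 i) f u.

Definition hessian (R : realType) (n : nat) (f : 'rV[R]_n -> R)
    (u : 'rV[R]_n) : 'M[R]_n :=
  \matrix_(i, j) partial i (partial j f) u.

Definition curvature (R : realType) (n : nat) (f : 'rV[R]_n -> R)
    (u xi : 'rV[R]_n) : R :=
  \sum_(i < n) \sum_(j < n) xi 0 i * xi 0 j * hessian f u i j.

Definition hessian_negative_definite (R : realType) (n : nat)
    (f : 'rV[R]_n -> R) (u : 'rV[R]_n) : Prop :=
  forall xi : 'rV[R]_n, xi != 0 -> curvature f u xi < 0.

Definition global_minimizer (R : realType) (n : nat) (f : 'rV[R]_n -> R)
    (u : 'rV[R]_n) : Prop :=
  forall v, f u <= f v.

Definition local_minimizer (R : realType) (n : nat) (f : 'rV[R]_n -> R)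
    (u : 'rV[R]_n) : Prop :=
  \forall v \near u, f u <= f v.

Definition local_maximizer (R : realType) (n : nat) (f : 'rV[R]_n -> R)
    (u : 'rV[R]_n) : Prop :=
  \forall v \near u, f v <= f u.

Definition critical_point (R : realType) (n : nat) (f : 'rV[R]_n -> R)
    (u : 'rV[R]_n) : Prop :=
  forall i : 'I_n, partial i f u = 0.

Definition saddle_point (R : realType) (n : nat) (f : 'rV[R]_n -> R)
    (u : 'rV[R]_n) : Prop :=
  [/\ critical_point f u, ~ local_minimizer f u & ~ local_maximizer f u].

Definition strict_saddle (R : realType) (n : nat) (f : 'rV[R]_n -> R)
    (u : 'rV[R]_n) : Prop :=
  saddle_point f u /\
  \forall v \near u, exists2 xi : 'rV[R]_n, norm2 xi = 1 & curvature f v xi < 0.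

Definition strongly_convex_on (R : realType) (n : nat) (D : set 'rV[R]_n)
    (f : 'rV[R]_n -> R) : Prop :=
  exists2 mu : R, 0 < mu &
  forall u v : 'rV[R]_n, D u -> D v -> forall t : R, 0 <= t <= 1 ->
    f (t *: u + (1 - t) *: v) <=
    t * f u + (1 - t) * f v - mu / 2 * t * (1 - t) * norm2 (u - v) ^+ 2.

Definition strongly_convex_near (R : realType) (n : nat) (f : 'rV[R]_n -> R)
    (z : 'rV[R]_n) : Prop :=
  exists D : set 'rV[R]_n,
    [/\ nbhs z D, @convex_set R 'rV[R]_n D & strongly_convex_on D f].

Definition no_spurious_local_minimizers (R : realType) (n : nat)
    (f : 'rV[R]_n -> R) : Prop :=
  forall u, local_minimizer f u -> global_minimizer f u.

(* R^n with its Borel sigma-algebra. *)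
Definition borel_rV (R : realType) (n : nat) :=
  g_sigma_algebraType (@open 'rV[R]_n).

Definition mutually_independent (d d' : measure_display) (T : measurableType d)
    (T' : measurableType d') (R : realType) (P : probability T R)
    (I : finType) (X : I -> T -> T') : Prop :=
  forall (J : {set I}) (B : I -> set T'),
    (forall i, measurable (B i)) ->
    P (\bigcap_(i in [set i | i \in J]) (X i @^-1` B i)) =
    (\prod_(i in J) P (X i @^-1` B i))%E.

(* N(0, I_n), as the law of n independent N(0, 1) coordinates. *)
Definition standard_gaussian (d : measure_display) (T : measurableType d)
    (R : realType) (P : probability T R) (n : nat)
    (X : T -> 'rV[R]_n) : Prop :=
  mutually_independent P (fun (i : 'I_n) (w : T) => X w 0 i) /\
  forall (i : 'I_n) (B : set R), measurable B ->
    P ((fun w => X w 0 i) @^-1` B) = normal_prob 0 1 B.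

Definition iid_standard_gaussian (d : measure_display) (T : measurableType d)
    (R : realType) (P : probability T R) (n m : nat)
    (a : 'I_m -> {RV P >-> borel_rV R n}) : Prop :=
  mutually_independent P (fun k : 'I_m => a k : T -> borel_rV R n) /\
  forall k : 'I_m, standard_gaussian P (a k : T -> 'rV[R]_n).

Definition loss (R : realType) (n m : nat) (a : 'I_m -> 'rV[R]_n)
    (x u : 'rV[R]_n) : R :=
  m%:R^-1 *
  \sum_(k < m) (dotp (a k) u ^+ 2 - dotp (a k) x ^+ 2) ^+ 2 / dotp (a k) x ^+ 2.

(* As x / 0 = 0, loss is the intended function only under this condition, which
   holds almost surely. *)
Definition loss_well_defined (R : realType) (n m : nat)
    (a : 'I_m -> 'rV[R]_n) (x : 'rV[R]_n) : Prop :=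
  forall k : 'I_m, dotp (a k) x != 0.

(* Main.v *)
Require Import Defs.
From HB Require Import structures.
From mathcomp Require Import all_boot all_order all_algebra.
From mathcomp Require Import all_classical all_reals all_analysis.
From mathcomp Require Import measurable_realfun ring lra.

Set Implicit Arguments.
Unset Strict Implicit.
Unset Printing Implicit Defensive.
Import Order.TTheory GRing.Theory Num.Theory.
Import numFieldNormedType.Exports.

Local Open Scope classical_set_scope.
Local Open Scope ring_scope.

(** Write [s_k = a_k . x] and [y_k = a_k . u], let [avg] be the mean over the
samples and [mean_sqr a u = avg y^2].  By homogeneity one may take [|x| = 1].
The summands [y^4 / s^2] of the loss have infinite expectation as soon as [u]
is not parallel to [x], so neither the loss nor its Hessian concentrates
uniformly.  The proof uses only the few consequences of the derivatives in
which the small denominators either cancel or act in the right direction.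

The second derivative of the loss at [u] along [x] is
[4 (3 mean_sqr a u - mean_sqr a x)], free of denominators ([bend_signal]).
Hence where [mean_sqr a u] is below a third of [mean_sqr a x] the signal
direction has negative curvature, and all that has to be shown is that a
critical point with [mean_sqr a u >= mean_sqr a x / 3] is [x] or [-x].
Stationarity along [u] and along [x] says
  (i) avg y^4/s^2 = avg y^2        (ii) avg y^3/s = avg y s,
and these two scalar equations suffice ([critical_eq_signal]).  By the
arithmetic-geometric inequality (i) bounds [u].  Write [u = u1 x + t] with [t]
orthogonal to [x].  Then (i) also bounds [avg (a . t)^4 / s^2]; because the
expectation of this quantity is infinite, its empirical value is at least
[M |t|^4] with [M] as large as desired, once [m >= C n] ([whp_orthogonal]).
So [t] is small, (ii) becomes [u1^3 = u1] up to a small error, the assumption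
on [mean_sqr a u] excludes [u1] close to [0], and [u] is close to [x] or [-x].
Close to [x], put [r = y - s] and [rho = r / s]; subtracting (ii) from (i)
gives [avg r^2 (2 + 3 rho + rho^2) = 0].  The terms with [|rho| <= 1/3] are at
least [r^2]; the others occur only at samples where [s] is tiny compared with
[a . (u - x) / |u - x|], and these carry a small part of the energy of any
direction.  Hence [r = 0] throughout and [u = x] ([critical_near_signal]).

Both facts on the samples are stated with
[hinge L s y = max(0, |y| - L |s|)].  For large [L] the average of
[hinge L s y ^ 2] is uniformly small over unit directions, whereas [L ^ 2]
times it is uniformly large over unit directions orthogonal to [x].  In
expectation this is [hinge_mean_small] and [hinge_mean_large]; they need only
the laws of single linear forms, [N(0, |u|^2)] by [linear_form_law].  The
square of the hinge is at most [y^2] and the hinge is Lipschitz in [y], so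
Chernoff's bound ([chernoff_hinge]) and a net of cardinality exponential in
[n] ([net_exists]) make the estimates uniform with probability
[1 - e^(-c m)].

The remaining claims are direct.  Near [x] each summand is strongly convex as
a function of [y_k] ([sqr_defect_strongly_convex]) and [mean_sqr] is a positive
definite form.  If [|y_k| <= |s_k|] for all [k], no summand exceeds its value
at [0], where the Hessian is the negative of a positive multiple of
[mean_sqr]. *)

(** * The Euclidean inner product *)

Section dotp_norm2.
Variables (R : realType) (n : nat).
Implicit Types (u v w : 'rV[R]_n) (c : R).

Lemma dotpC u v : dotp u v = dotp v u.
Proof. by apply: eq_bigr => i _; rewrite mulrC. Qed.

Lemma dotpDr u v w : dotp u (v + w) = dotp u v + dotp u w.
Proof. by rewrite -big_split; apply: eq_bigr => i _; rewrite mxE mulrDr. Qed.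

Lemma dotpZr c u v : dotp u (c *: v) = c * dotp u v.
Proof. by rewrite mulr_sumr; apply: eq_bigr => i _; rewrite mxE mulrCA. Qed.

Lemma dotpNr u v : dotp u (- v) = - dotp u v.
Proof. by rewrite -scaleN1r dotpZr mulN1r. Qed.

Lemma dotpBr u v w : dotp u (v - w) = dotp u v - dotp u w.
Proof. by rewrite dotpDr dotpNr. Qed.

Lemma dotp0r u : dotp u 0 = 0.
Proof. by rewrite -(scale0r u) dotpZr mul0r. Qed.

Lemma dotpDl u v w : dotp (v + w) u = dotp v u + dotp w u.
Proof. by rewrite !(dotpC _ u) dotpDr. Qed.

Lemma dotpZl c u v : dotp (c *: v) u = c * dotp v u.
Proof. by rewrite !(dotpC _ u) dotpZr. Qed.

Lemma dotpBl u v w : dotp (v - w) u = dotp v u - dotp w u.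
Proof. by rewrite !(dotpC _ u) dotpBr. Qed.

Lemma dotp_ge0 u : 0 <= dotp u u.
Proof. by apply: sumr_ge0 => i _; rewrite -expr2 sqr_ge0. Qed.

Lemma sqr_norm2 u : norm2 u ^+ 2 = dotp u u.
Proof. by rewrite sqr_sqrtr// dotp_ge0. Qed.

Lemma norm2_ge0 u : 0 <= norm2 u.
Proof. exact: sqrtr_ge0. Qed.

Lemma dotp_eq0 u : (dotp u u == 0) = (u == 0).
Proof.
apply/eqP/eqP => [|->]; last by rewrite dotp0r.
move=> /eqP; rewrite psumr_eq0; last by move=> i _; rewrite -expr2 sqr_ge0.
move=> /allP h; apply/rowP => i; rewrite mxE.
by have := h i (mem_index_enum _); rewrite /= mulf_eq0 orbb => /eqP.
Qed.

Lemma norm2_eq0 u : (norm2 u == 0) = (u == 0).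
Proof. by rewrite -dotp_eq0 -sqr_norm2 sqrf_eq0. Qed.

Lemma norm2Z c u : norm2 (c *: u) = `|c| * norm2 u.
Proof.
by rewrite /norm2 dotpZr dotpZl mulrA -expr2 sqrtrM ?sqr_ge0// sqrtr_sqr.
Qed.

Lemma norm2_gt0 u : u != 0 -> 0 < norm2 u.
Proof. by move=> u0; rewrite lt_neqAle eq_sym norm2_eq0 u0 norm2_ge0. Qed.

Lemma norm2_normalize u : u != 0 -> norm2 ((norm2 u)^-1 *: u) = 1.
Proof.
move=> u0; rewrite norm2Z ger0_norm ?invr_ge0 ?norm2_ge0//.
by rewrite mulVf// norm2_eq0.
Qed.

End dotp_norm2.

(** * Integrals compared through indicators *)

Section layer_cake.
Context d d' (T : measurableType d) (T' : measurableType d') (R : realType).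
Variable mu : {sigma_finite_measure set T -> \bar R}.
Variables (G : T -> R) (X : T -> T') (g : T' -> R).
Hypotheses (mG : measurable_fun setT G) (mX : measurable_fun setT X).
Hypotheses (mg : measurable_fun setT g) (G0 : forall w, 0 <= G w).
Hypothesis g0 : forall t, 0 <= g t.

Let level (z : R) : set T' := [set t | (0 <= z) && (z < g t)].

Lemma measurable_level z : measurable (level z).
Proof.
rewrite /level; case: (0 <= z) => /=; last first.
  by rewrite (_ : [set _ | _] = set0)//; apply/seteqP; split.
rewrite -[X in measurable X]setTI; have := @measurable_fun_ltr _ _ _ setT (cst z) g.
by move=> /(_ _ mg measurableT) => m; rewrite -preimage_true; exact: m.
Qed.

(** Expand [g (X w)] as the length of the interval of levels [z] with
[0 <= z < g (X w)] and exchange the two integrals. *)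
Lemma layer_cake :
  (\int[mu]_w (G w * g (X w))%:E =
   \int[lebesgue_measure]_z \int[mu]_w (G w * \1_(level z) (X w))%:E)%E.
Proof.
pose h (p : T * R) : \bar R := (G p.1 * \1_(level p.2) (X p.1))%:E.
have mgX : measurable_fun setT (fun p : T * R => g (X p.1)).
  by apply: measurableT_comp => //; apply: measurableT_comp => //; exact: measurable_fst.
have mh : measurable_fun setT h.
  apply/measurable_EFinP; apply: measurable_funM.
    by apply: measurableT_comp => //; exact: measurable_fst.
  rewrite (_ : (fun _ => _) = \1_([set p : T * R | 0 <= p.2] `&` [set p : T * R | p.2 < g (X p.1)])).
    apply: measurable_indic; apply: measurableI.
    - rewrite -[X in measurable X]setTI; apply: measurable_fun_ler => //; exact: measurable_snd.
    - rewrite -[X in measurable X]setTI; apply: measurable_fun_ltr => //; exact: measurable_snd.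
  apply/funext => p; rewrite !indicE; congr (_%:R); congr nat_of_bool.
  apply/idP/idP; rewrite !inE /level /=.
    by move=> /andP[].
  by move=> [-> ->].
have h0 p : (0 <= h p)%E by rewrite lee_fin mulr_ge0.
have := fubini_tonelli (m1 := mu) (m2 := @lebesgue_measure R) h mh h0.
rewrite /h /= => <-; apply: eq_integral => w _ /=.
under eq_integral do rewrite EFinM.
rewrite ge0_integralZl//; last 2 first.
- apply/measurable_EFinP; rewrite (_ : (fun _ => _) = \1_(`[0, g (X w)[%classic)); first exact: measurable_indic.
  by apply/funext => z; rewrite !indicE; congr (_%:R); congr nat_of_bool; apply/idP/idP; rewrite !inE/= in_itv.
- by rewrite lee_fin.
rewrite EFinM; congr (_ * _)%E.
transitivity (\int[@lebesgue_measure R]_z (\1_(`[0, g (X w)[%classic) z)%:E)%E.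
  rewrite integral_indic ?setIT//=.
  rewrite lebesgue_measure_itv/= lte_fin oppr0 adde0.
  by case: ltP => // h'; congr EFin; apply/eqP; rewrite eq_le h' g0.
apply: eq_integral => z _; rewrite !indicE; congr (_%:R%:E); congr nat_of_bool.
Qed.
End layer_cake.

(** The transfer principle behind every change of variables below: each level
set of [g] is an event, so by the layer cake formula two weighted laws that
agree on events give the same integrals. *)
Lemma eq_integral_of_indic d1 d2 d' (T1 : measurableType d1)
    (T2 : measurableType d2) (T' : measurableType d') (R : realType)
    (mu : {sigma_finite_measure set T1 -> \bar R})
    (nu : {sigma_finite_measure set T2 -> \bar R})
    (G : T1 -> R) (K : T2 -> R) (X : T1 -> T') (Y : T2 -> T') (g : T' -> R) :
  measurable_fun setT G -> measurable_fun setT K ->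
  measurable_fun setT X -> measurable_fun setT Y -> measurable_fun setT g ->
  (forall w, 0 <= G w) -> (forall w, 0 <= K w) -> (forall t, 0 <= g t) ->
  (forall B, measurable B -> \int[mu]_w (G w * \1_B (X w))%:E =
                             \int[nu]_w (K w * \1_B (Y w))%:E)%E ->
  (\int[mu]_w (G w * g (X w))%:E = \int[nu]_w (K w * g (Y w))%:E)%E.
Proof.
move=> mG mK mX mY mg G0 K0 g0 GK; rewrite !layer_cake//.
by apply: eq_integral => z _; apply: GK; exact: measurable_level.
Qed.

(** * Affine changes of variable on the line *)

Lemma image_measure d d' (T1 : measurableType d) (T2 : measurableType d')
    (R : realType) (m : {measure set T1 -> \bar R}) (f : T1 -> T2) :
  measurable_fun setT f ->
  exists nu : {measure set T2 -> \bar R}, forall A, nu A = m (f @^-1` A).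
Proof.
by move=> mf; unshelve eexists (pushforward m f : {measure set T2 -> \bar R}).
Qed.

Lemma preimage_affine_itvoc (R : realType) (m s a b : R) : s != 0 ->
  ((@lebesgue_measure R) ((fun z : R => (m + s * z)%R) @^-1` `]a, b]) =
  (`|s|^-1)%:E * (@lebesgue_measure R) `]a, b])%E.
Proof.
move=> s0; have [sp|sn|/eqP] := ltgtP s 0; last by rewrite (negbTE s0).
  rewrite (_ : _ @^-1` _ = `[(b - m) / s, (a - m) / s[%classic).
    rewrite !lebesgue_measure_itv/= !lte_fin ltr_nM2r ?invr_lt0// ltrD2r.
    case: ifP => _; rewrite ?mule0// -!EFinD -EFinM; congr EFin.
    by rewrite (ltr0_norm sp) invrN; field.
  apply/seteqP; split => z /=; rewrite !in_itv/= => /andP[h1 h2]; apply/andP; split.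
  - by rewrite ler_ndivrMr//; lra.
  - by rewrite ltr_ndivlMr//; lra.
  - by move: h2; rewrite ltr_ndivlMr//; lra.
  - by move: h1; rewrite ler_ndivrMr//; lra.
rewrite (_ : _ @^-1` _ = `](a - m) / s, (b - m) / s]%classic).
  rewrite !lebesgue_measure_itv/= !lte_fin ltr_pM2r ?invr_gt0// ltrD2r.
  case: ifP => _; rewrite ?mule0// -!EFinD -EFinM; congr EFin.
  by rewrite (gtr0_norm sn); field.
apply/seteqP; split => z /=; rewrite !in_itv/= => /andP[h1 h2]; apply/andP; split.
- by rewrite ltr_pdivrMr//; lra.
- by rewrite ler_pdivlMr//; lra.
- by move: h1; rewrite ltr_pdivrMr//; lra.
- by move: h2; rewrite ler_pdivlMr//; lra.
Qed.

Lemma measurable_affine (R : realType) (m s : R) :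
  measurable_fun setT (fun z : R => m + s * z).
Proof. by apply: measurable_funD => //; apply: measurable_funM. Qed.

(** The image of Lebesgue measure by the affine map, scaled by [|s|], has the
right value on half-open intervals; Lebesgue measure is the only one. *)
Lemma lebesgue_measure_affine (R : realType) (m s : R) (A : set R) : s != 0 ->
  measurable A ->
  ((@lebesgue_measure R) ((fun z : R => (m + s * z)%R) @^-1` A) =
  (`|s|^-1)%:E * (@lebesgue_measure R) A)%E.
Proof.
move=> s0 mA.
have [nu nuE] := image_measure (T2 := measurableTypeR R) (@lebesgue_measure R) (measurable_affine m s).
have := @lebesgue_measure_unique R (mscale (NngNum (normr_ge0 s)) nu) _ A mA.
move=> lebE; rewrite lebE /mscale/=; last first.
  move=> _ [[a b] _ <-]; rewrite /mscale/=.
  rewrite [X in (_ * X)%E](_ : _ = nu `]a, b]%classic)// nuE.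
  have := preimage_affine_itvoc m a b s0 => /= E.
  transitivity (`|s|%:E * ((`|s|^-1)%:E * (@lebesgue_measure R) `]a, b]))%E.
    by rewrite muleA -EFinM divff ?mul1e// normr_eq0.
  by congr (_ * _)%E; exact/esym.
rewrite [X in (_ * (_ * X))%E](_ : _ = nu A)// nuE.
by rewrite muleA -EFinM mulVf ?mul1e// normr_eq0.
Qed.

Lemma integral_affine (R : realType) (m s : R) (h : R -> R) : s != 0 ->
  measurable_fun setT h -> (forall z, 0 <= h z) ->
  (\int[@lebesgue_measure R]_z (`|s| * h (m + s * z)%R)%:E =
   \int[@lebesgue_measure R]_z (h z)%:E)%E.
Proof.
move=> s0 mh h0; under [RHS]eq_integral do rewrite -(mul1r (h _)).
apply: (eq_integral_of_indic (K := cst 1) (Y := idfun)) => //.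
- exact: measurable_affine.
- exact: measurable_id.
move=> B mB.
have mB' : measurable ((fun z : R => m + s * z) @^-1` B).
  by rewrite -[X in measurable X]setTI; exact: measurable_affine.
under eq_integral do rewrite EFinM.
rewrite ge0_integralZl_EFin//; last by apply/measurable_EFinP/measurable_indic.
under [RHS]eq_integral do rewrite mul1r.
rewrite !integral_indic//= !setIT.
rewrite lebesgue_measure_affine// muleA -EFinM divff ?mul1e// normr_eq0//.
Qed.

(** * Convolution of normal laws *)

Lemma integral_normal_prob (R : realType) (m s : R) (h : R -> R) :
  measurable_fun setT h -> (forall z, 0 <= h z) ->
  (\int[normal_prob m s]_z (h z)%:E =
   \int[@lebesgue_measure R]_z (normal_pdf m s z * h z)%:E)%E.
Proof.
move=> mh h0; apply/esym; under [RHS]eq_integral do rewrite -(mul1r (h _)).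
apply: (eq_integral_of_indic (K := cst 1) (X := idfun) (Y := idfun)) => //.
- exact: measurable_normal_pdf.
- exact: measurable_id.
- exact: measurable_id.
- by move=> z; exact: normal_pdf_ge0.
move=> B mB.
under [RHS]eq_integral do rewrite mul1r.
rewrite integral_indic//= setIT /normal_prob [RHS]integral_mkcond.
apply: eq_integral => z _; rewrite patchE indicE.
by case: (z \in B); rewrite ?mulr1 ?mulr0.
Qed.

Lemma normal_peakE (R : realType) (s : R) :
  normal_peak s = `|s|^-1 * normal_peak 1.
Proof.
rewrite /normal_peak expr1n mul1r -mulrnAr sqrtrM ?sqr_ge0// sqrtr_sqr.
by rewrite invfM.
Qed.

(** The density of [N(m, s^2)] in the variable standardized by [z |-> m + s z]. *)
Lemma normal_pdf_affine (R : realType) (m s z : R) : s != 0 ->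
  normal_pdf 0 1 z = `|s| * normal_pdf m s (m + s * z).
Proof.
move=> s0.
have E : normal_fun 0 1 z = normal_fun m s (m + s * z).
  rewrite /normal_fun.
  suff -> : - (z - 0) ^+ 2 / (1 ^+ 2 *+ 2) =
    - (m + s * z - m) ^+ 2 / (s ^+ 2 *+ 2) by [].
  have -> : m + s * z - m = s * z by ring.
  rewrite subr0 exprMn expr1n !mulr2n; field.
  by rewrite -mulr2n mulrn_eq0 sqrf_eq0.
rewrite !normal_pdfE ?oner_eq0// -E (normal_peakE s) !mulrA.
by rewrite divff ?normr_eq0// mul1r.
Qed.

Lemma integral_normal_affine (R : realType) (m s : R) (h : R -> R) : s != 0 ->
  measurable_fun setT h -> (forall z, 0 <= h z) ->
  (\int[normal_prob 0 1]_z (h (m + s * z)%R)%:E =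
   \int[normal_prob m s]_z (h z)%:E)%E.
Proof.
move=> s0 mh h0; rewrite !integral_normal_prob//; last first.
  by apply: measurableT_comp => //; exact: measurable_affine.
rewrite -(@integral_affine _ m s (fun z => normal_pdf m s z * h z))//.
- by apply: eq_integral => z _; rewrite (normal_pdf_affine m z s0) mulrA.
- by apply: measurable_funM => //; exact: measurable_normal_pdf.
- by move=> z; rewrite mulr_ge0// normal_pdf_ge0.
Qed.

(** Completion of the square.  For independent standard normal [a] and [b], both
sides are the joint density of [a] and [z = al a + be b]: on the left the
law of [a] then that of [z] given [a], on the right the law of [z] then that
of [a] given [z]. *)
Lemma normal_pdf_swap (R : realType) (al be a z : R) : be != 0 ->
  let r := Num.sqrt (al ^+ 2 + be ^+ 2) in
  normal_pdf 0 1 a * normal_pdf (al * a) be z =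
  normal_pdf 0 r z * normal_pdf (al * z / r ^+ 2) (be / r) a.
Proof.
move=> b0 r; have b2 : 0 < be ^+ 2 by rewrite exprn_even_gt0.
have r2 : r ^+ 2 = al ^+ 2 + be ^+ 2 by rewrite sqr_sqrtr// addr_ge0 ?sqr_ge0.
have rp : 0 < r by rewrite sqrtr_gt0 ltr_wpDl ?sqr_ge0.
have r0 : r != 0 by rewrite gt_eqF.
rewrite !normal_pdfE ?oner_eq0 ?mulf_neq0 ?invr_eq0//.
rewrite (normal_peakE r) (normal_peakE be) (normal_peakE (be / r)).
rewrite normrM normfV (gtr0_norm rp) /normal_fun.
set p := normal_peak 1; set e1 := expR _; set e2 := expR _; set e3 := expR _; set e4 := expR _.
have -> : p * e1 * (`|be|^-1 * p * e2) = p * p * `|be|^-1 * (e1 * e2) by ring.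
have -> : r^-1 * p * e3 * ((`|be| / r)^-1 * p * e4) = p * p * `|be|^-1 * (e3 * e4).
  by field; rewrite normr_eq0 b0 r0.
rewrite -!expRD.
match goal with |- _ * expR ?a = _ * expR ?b => suff -> : a = b by [] end.
rewrite expr_div_n r2 !mulr2n.
field.
by rewrite -!mulr2n !mulrn_eq0 /= !gt_eqF// ltr_wpDl ?sqr_ge0.
Qed.

Lemma measurable_normal_pdf_comp d (T : measurableType d) (R : realType)
    (f g : T -> R) (s : R) : s != 0 ->
  measurable_fun setT f -> measurable_fun setT g ->
  measurable_fun setT (fun w => normal_pdf (f w) s (g w)).
Proof.
move=> s0 mf mg.
rewrite (_ : (fun _ => _) = (fun w => normal_peak s *
      expR (- (g w - f w) ^+ 2 / (s ^+ 2 *+ 2)))); last first.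
  by apply/funext => w; rewrite normal_pdfE.
apply: measurable_funM => //; apply: measurableT_comp => //.
apply: measurable_funM => //; apply: measurable_funN => //.
by apply: measurable_funX; apply: measurable_funB.
Qed.

Lemma integral_probability_cst d (T : measurableType d) (R : realType)
    (P : probability T R) (c : \bar R) : (\int[P]_w c = c)%E.
Proof. by rewrite integral_cst// [X in (_ * X)%E](_ : _ = 1%E) ?mule1//; exact: probability_setT. Qed.

(** Given [a], the variable [al a + be b] is [N(al a, be^2)].  After the exchange
of the integrals, [normal_pdf_swap] leaves the density of
[N(0, al^2 + be^2)] times the integral of a conditional density, which is 1. *)
Lemma normal_convolution (R : realType) (al be : R) (h : R -> R) :
  measurable_fun setT h -> (forall z, 0 <= h z) ->
  (\int[normal_prob 0 1]_a \int[normal_prob 0 1]_b (h (al * a + be * b)%R)%:E =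
   \int[normal_prob 0 1]_g (h (Num.sqrt (al ^+ 2 + be ^+ 2) * g)%R)%:E)%E.
Proof.
move=> mh h0; have [->|b0] := eqVneq be 0.
  under eq_integral do under eq_integral do rewrite mul0r addr0.
  under eq_integral do rewrite (integral_probability_cst (normal_prob 0 1)).
  rewrite expr0n addr0 sqrtr_sqr.
  have [al0|al0] := leP 0 al; first by rewrite ger0_norm.
  rewrite ltr0_norm//.
  have m1 (t : R) : measurable_fun setT (fun a : R => h (t * a)).
    by apply: measurableT_comp => //; apply: measurable_funM.
  have nz : -1 != 0 :> R by rewrite oppr_eq0 oner_eq0.
  have := @integral_normal_affine R 0 (-1) (fun a => h (- al * a)) nz (m1 _) (fun _ => h0 _).
  rewrite [X in _ = X -> _]integral_normal_prob// [in X in _ -> _ = X]integral_normal_prob//.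
  have -> : @normal_pdf R 0 (-1) = normal_pdf 0 1.
    by rewrite !normal_pdfE ?oner_eq0// (normal_peakE (-1)) normrN1 invr1 mul1r /normal_fun sqrrN.
  move=> <-; apply: eq_integral => a _; rewrite add0r mulN1r mulrNN//.
set r := Num.sqrt _.
have rp : 0 < r by rewrite sqrtr_gt0 ltr_wpDl ?sqr_ge0 ?exprn_even_gt0.
have r0 : r != 0 by rewrite gt_eqF.
have maf a : measurable_fun setT (fun b => h (al * a + be * b)).
  by apply: measurableT_comp => //; exact: measurable_affine.
under eq_integral => a _.
  rewrite (@integral_normal_affine R (al * a) be h)// integral_normal_prob//.
  over.
have mpair : measurable_fun setT
    (fun p : R * R => normal_pdf (al * p.1) be p.2 * h p.2).
  apply: measurable_funM; last by apply: measurableT_comp => //; exact: measurable_snd.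
  apply: measurable_normal_pdf_comp => //.
  by apply: measurable_funM => //; exact: measurable_fst.
rewrite (fubini_tonelli (m1 := @normal_prob R 0 1) (m2 := @lebesgue_measure R)
  (fun p : R * R => (normal_pdf (al * p.1) be p.2 * h p.2)%:E)); last 2 first.
- exact/measurable_EFinP.
- by move=> p; rewrite lee_fin mulr_ge0// normal_pdf_ge0.
have -> : (\int[normal_prob 0 1]_g (h (r * g)%R)%:E = \int[normal_prob 0 r]_g (h g)%:E)%E.
  have := integral_normal_affine 0 r0 mh h0; move=> <-.
  by apply: eq_integral => z _; rewrite add0r.
rewrite integral_normal_prob//; apply: eq_integral => z _ /=.
rewrite (integral_normal_prob 0 1 (h := fun a => normal_pdf (al * a) be z * h z)); last 2 first.
- apply: measurable_funM => //; apply: measurable_normal_pdf_comp => //.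
- by move=> a; rewrite mulr_ge0// normal_pdf_ge0.
under eq_integral => a _.
  rewrite mulrA (normal_pdf_swap al a z b0) -/r mulrAC EFinM.
  over.
rewrite ge0_integralZl//; last 3 first.
- by apply/measurable_EFinP; exact: measurable_normal_pdf.
- by move=> a _; rewrite lee_fin normal_pdf_ge0.
- by rewrite lee_fin mulr_ge0// normal_pdf_ge0.
by rewrite integral_normal_pdf mule1.
Qed.

(** * The law of a linear form of a Gaussian vector *)

Lemma measure_eq_rectangles d1 d2 (T1 : measurableType d1)
    (T2 : measurableType d2) (R : realType)
    (m1 m2 : {measure set (T1 * T2) -> \bar R}) : (m1 setT < +oo)%E ->
  (forall A B, measurable A -> measurable B -> m1 (A `*` B) = m2 (A `*` B)) ->
  forall Z, measurable Z -> m1 Z = m2 Z.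
Proof.
move=> fin1 m12 Z mZ.
pose C : set (set (T1 * T2)) :=
  [set Z | exists A B, [/\ measurable A, measurable B & Z = A `*` B]].
apply: (measure_unique C (fun=> setT)) => //.
- rewrite measurable_prod_measurableType; congr (<<s _ >>).
  apply/seteqP; split => [_ [A mA [B mB <-]]|_ [A [B [mA mB ->]]]].
    by exists A, B.
  by exists A => //; exists B.
- move=> _ _ [A [B [mA mB ->]]] [A' [B' [mA' mB' ->]]].
  exists (A `&` A'), (B `&` B'); split; [exact: measurableI|exact: measurableI|].
  by rewrite setXI.
- by move=> _; exists setT, setT; split => //; rewrite setXTT.
- by rewrite bigcup_const.
- by move=> _ [A [B [mA mB ->]]]; exact: m12.
Qed.

(** [normal_prob] is carried by the copy [measurableTypeR R] of the line; taking
its image by the identity gives a probability on [R] itself, on which products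
with the laws of real random variables can be formed. *)
Definition id_measurableTypeR (R : realType) : {mfun measurableTypeR R >-> R} :=
  HB.pack (fun x : measurableTypeR R => x : R)
    (isMeasurableFun.Build _ _ (measurableTypeR R) R (fun x => x)
      (@measurable_id _ _ setT)).

Definition std_normal (R : realType) : probability R R :=
  distribution (@normal_prob R 0 1) (id_measurableTypeR R).

Lemma integral_std_normal (R : realType) (h : R -> \bar R) :
  measurable_fun setT h -> (forall z, 0 <= h z)%E ->
  (\int[std_normal R]_z h z = \int[@normal_prob R 0 1]_z h z)%E.
Proof. by move=> mh h0; rewrite ge0_integral_distribution. Qed.

Lemma std_normal_convolution (R : realType) (al be : R) (h : R -> R) :
  measurable_fun setT h -> (forall z, 0 <= h z) ->
  (\int[std_normal R]_a \int[std_normal R]_b (h (al * a + be * b)%R)%:E =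
   \int[std_normal R]_g (h (Num.sqrt (al ^+ 2 + be ^+ 2) * g)%R)%:E)%E.
Proof.
move=> mh h0.
have mh2 : measurable_fun setT (fun p : R * R => (h (al * p.1 + be * p.2))%:E).
  apply/measurable_EFinP; apply: measurableT_comp => //; apply: measurable_funD.
    by apply: measurable_funM => //; exact: measurable_fst.
  by apply: measurable_funM => //; exact: measurable_snd.
rewrite integral_std_normal; last 2 first.
- by apply: (measurable_fun_fubini_tonelli_F (m2 := std_normal R) (fun p : R * R => (h (al * p.1 + be * p.2))%:E) mh2) => p; rewrite lee_fin.
- by move=> a; apply: integral_ge0 => b _; rewrite lee_fin.
rewrite integral_std_normal; last 2 first.
- by apply/measurable_EFinP; apply: measurableT_comp => //; exact: measurable_funM.
- by move=> a; rewrite lee_fin.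
rewrite -normal_convolution//; apply: eq_integral => a _.
rewrite integral_std_normal//.
apply/measurable_EFinP; apply: measurableT_comp => //.
by apply: measurable_funD => //; exact: measurable_funM.
by move=> z; rewrite lee_fin.
Qed.

Section linear_form_law.
Context d (T : measurableType d) (R : realType) (P : probability T R).
Variables (n : nat) (X : T -> 'rV[R]_n) (u : 'rV[R]_n).
Hypothesis mX : forall i, measurable_fun setT (fun w => X w 0 i).
Hypothesis gX : standard_gaussian P X.

Local Notation N := (std_normal R).
Let NN : {sigma_finite_measure set (R * R)%type -> \bar R} :=
  product_subprobability (N : subprobability _ _, N : subprobability _ _).
Let cyl (J : {set 'I_n}) (B : 'I_n -> set R) : set T :=
  \bigcap_(i in [set i | i \in J]) (fun w => X w 0 i) @^-1` B i.
Let S (K : {set 'I_n}) w := \sum_(i in K) X w 0 i * u 0 i.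
Let sg (K : {set 'I_n}) := Num.sqrt (\sum_(i in K) u 0 i ^+ 2).

Let measurable_cyl J B : (forall i, measurable (B i)) -> measurable (cyl J B).
Proof.
move=> mB; apply: fin_bigcap_measurable => [|i _]; first exact: finite_finset.
by rewrite -[X in measurable X]setTI; exact: mX.
Qed.

Let measurable_S K : measurable_fun setT (S K).
Proof.
rewrite /S; under eq_fun do rewrite -big_enum.
by apply: measurable_sum => i; exact: measurable_funM.
Qed.

Let PX i B : measurable B -> P ((fun w => X w 0 i) @^-1` B) = N B.
Proof. by move=> mB; case: gX => _; apply. Qed.

Let cyl_setU1 (J : {set 'I_n}) (B : 'I_n -> set R) i (A : set R) : i \notin J ->
  cyl (i |: J) (fun j => if j == i then A else B j) =
  cyl J B `&` (fun w => X w 0 i) @^-1` A.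
Proof.
move=> iJ; apply/seteqP; split => w.
  move=> h; split.
    move=> j /= jJ; have := h j; rewrite /= in_setU1 jJ orbT => /(_ isT).
    by case: eqP => // ji; move: iJ; rewrite -ji jJ.
  by have := h i; rewrite /= in_setU1 eqxx => /(_ isT).
move=> [h1 h2] j /=; rewrite in_setU1; case: eqP => [->//|_ /=].
exact: h1.
Qed.

Let P_cyl_setU1 (J : {set 'I_n}) (B : 'I_n -> set R) i (A : set R) : i \notin J -> (forall i, measurable (B i)) ->
  measurable A ->
  P (cyl J B `&` (fun w => X w 0 i) @^-1` A) = (P (cyl J B) * N A)%E.
Proof.
move=> iJ mB mA; rewrite -cyl_setU1//; case: gX => ind _.
rewrite /cyl !ind//; last by move=> j; case: ifP.
rewrite big_setU1//= eqxx PX// muleC; congr (_ * _)%E.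
by apply: eq_bigr => j jJ; case: eqP => // ji; move: iJ; rewrite -ji jJ.
Qed.

(** The partial sum over [K] is distributed as [sg K] times a standard normal
variable and is independent of the coordinates outside [K]; the independence
is tested on cylinders, the only events on which the hypothesis speaks.  The
coordinates are adjoined one at a time: the pair made of the sum over
[K :\ i] and of coordinate [i] has a product law, since it does on rectangles
by the induction hypothesis, and the two Gaussians then merge by
[std_normal_convolution]. *)
Let law (K : {set 'I_n}) (B : 'I_n -> set R) (h : R -> R) :
  (forall i, measurable (B i)) ->
  measurable_fun setT h -> (forall z, 0 <= h z) ->
  (\int[P]_w (\1_(cyl (~: K) B) w * h (S K w))%:E =
   P (cyl (~: K) B) * \int[N]_g (h (sg K * g)%R)%:E)%E.
Proof.
move: {2}#|K| (erefl #|K|) => k; elim: k K B h => [|k IH] K B h.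
  move=> /eqP; rewrite cards_eq0 => /eqP -> mB mh h0.
  rewrite /S /sg big_set0 sqrtr0.
  under eq_integral do rewrite big_set0 mulrC EFinM.
  rewrite ge0_integralZl_EFin//; last by apply/measurable_EFinP/measurable_indic/measurable_cyl.
  rewrite integral_indic// ?setIT; last exact: measurable_cyl.
  under [in RHS]eq_integral do rewrite mul0r.
  by rewrite (integral_probability_cst N) muleC.
move=> cK mB mh h0.
have [i iK] : exists i, i \in K by apply/set0Pn; rewrite -cards_eq0 cK.
pose K' := K :\ i.
have cK' : #|K'| = k by have := cardsD1 i K; rewrite iK cK => -[].
have CK : ~: K' = i |: ~: K by rewrite /K' finset.setCD finset.setUC.
have iCK : i \notin ~: K by rewrite inE negbK.
have SE w : S K w = S K' w + X w 0 i * u 0 i by rewrite /S (big_setD1 i)//= addrC.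
have sgE : sg K = Num.sqrt (sg K' ^+ 2 + u 0 i ^+ 2).
  rewrite /sg sqr_sqrtr; last by apply: sumr_ge0 => j _; rewrite sqr_ge0.
  by rewrite (big_setD1 i)//= addrC.
set D := cyl (~: K) B.
have mD : measurable D by exact: measurable_cyl.
have PDfin : P D \is a fin_num by exact: fin_num_measure.
pose c := fine (P D); have cE : P D = c%:E by rewrite /c fineK.
have c0 : 0 <= c by rewrite fine_ge0.
pose f w := (S K' w, X w 0 i).
pose F (p : R * R) := (sg K' * p.1, p.2).
have mf : measurable_fun setT f by exact: measurable_fun_pair.
have mF : measurable_fun setT F.
  apply: measurable_fun_pair; last exact: measurable_snd.
  by apply: measurable_funM => //; exact: measurable_fst.
have rect (A B0 : set R) : measurable A -> measurable B0 ->
    P (f @^-1` (A `*` B0) `&` D) =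
    (P D * N B0 * N (( *%R (sg K')) @^-1` A))%E.
  move=> mA mB0; pose B' j := if j == i then B0 else B j.
  have mB' j : measurable (B' j) by rewrite /B'; case: ifP.
  have m1A : measurable_fun setT (\1_A : R -> R) by exact: measurable_indic.
  have := IH K' B' (\1_A) cK' mB' m1A (fun z => ler0n _ _).
  rewrite CK /B' cyl_setU1// -/D P_cyl_setU1//.
  set D' := D `&` _.
  have mXi : measurable ((fun w => X w 0 i) @^-1` B0).
    by rewrite -[Y in measurable Y]setTI; exact: mX.
  have mSA : measurable (S K' @^-1` A).
    by rewrite -[Y in measurable Y]setTI; exact: measurable_S.
  have mD' : measurable D' by exact: measurableI.
  under eq_integral => w _.
    rewrite (_ : _ * _ = \1_(D' `&` S K' @^-1` A) w); last by rewrite indicI.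
    over.
  rewrite integral_indic//; last exact: measurableI.
  rewrite setIT => E.
  rewrite (_ : _ `&` D = D' `&` S K' @^-1` A); last first.
    apply/seteqP; split => [w [[hA hB] hD]|w [[hD hB] hA]]; first by split; [split|].
    by split; [split|].
  rewrite E; congr (_ * _)%E.
  rewrite -[in RHS](setIT (_ @^-1` _)) -integral_indic//.
  rewrite -[Y in measurable Y]setTI; exact: measurable_funM.
have [nu1 nu1E] := image_measure (mrestr P mD) mf.
have [nu2 nu2E] := image_measure NN mF.
have mh2 : measurable_fun setT (fun p : R * R => h (p.1 + p.2 * u 0 i)).
  apply: measurableT_comp => //; apply: measurable_funD; first exact: measurable_fst.
  by apply: measurable_funM => //; exact: measurable_snd.
have -> : (\int[P]_w (\1_D w * h (S K w))%:E =
    \int[NN]_p (c * h ((F p).1 + (F p).2 * u 0 i))%:E)%E.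
  under eq_integral do rewrite SE.
  refine (@eq_integral_of_indic _ _ _ _ _ _ _ P NN \1_D (cst c) f F
    (fun p => h (p.1 + p.2 * u 0 i)) _ _ _ _ _ _ _ _ _) => //.
  move=> Z mZ.
  have mfZ : measurable (f @^-1` Z) by rewrite -[Y in measurable Y]setTI; exact: mf.
  have mFZ : measurable (F @^-1` Z) by rewrite -[Y in measurable Y]setTI; exact: mF.
  transitivity (nu1 Z).
    have mfD : measurable (f @^-1` Z `&` D) by exact: measurableI.
    have E := integral_indic P measurableT mfD; rewrite setIT in E.
    rewrite nu1E; apply: etrans E.
    by apply: eq_integral => w _; rewrite indicI mulrC.
  under eq_integral do rewrite EFinM.
  rewrite ge0_integralZl_EFin//; last by apply/measurable_EFinP; apply: measurableT_comp => //; exact: measurable_indic.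
  rewrite (_ : (\int[_]_x _)%E = NN (F @^-1` Z)); last first.
    by have E := integral_indic NN measurableT mFZ; rewrite setIT in E.
  rewrite -nu2E; transitivity (mscale (NngNum c0) nu2 Z); last by [].
  apply: measure_eq_rectangles => //.
    rewrite nu1E; apply: le_lt_trans (ltry 1); apply: probability_le1.
    by rewrite preimage_setT; exact: measurableI.
  move=> A B0 mA mB0; rewrite nu1E [LHS]rect//.
  transitivity (c%:E * nu2 (A `*` B0))%E; last by [].
  rewrite nu2E.
  rewrite (_ : F @^-1` (A `*` B0) = (( *%R (sg K')) @^-1` A) `*` B0)//.
  have mA' : measurable ( *%R (sg K') @^-1` A).
    by rewrite -[Y in measurable Y]setTI; exact: measurable_funM.
  transitivity (c%:E * (N ( *%R (sg K') @^-1` A) * N B0))%E.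
    by rewrite cE -!muleA; congr (_ * _)%E; rewrite muleC.
  by congr (_ * _)%E; exact/esym/product_measure1E.
under eq_integral do rewrite EFinM.
rewrite ge0_integralZl_EFin//; last 2 first.
- by move=> p _; rewrite lee_fin.
- apply/measurable_EFinP; exact: (measurableT_comp mh2 mF).
rewrite cE; congr (_ * _)%E.
rewrite [LHS](fubini_tonelli1 (m1 := N) (m2 := N) (fun p : R * R => (h ((F p).1 + (F p).2 * u 0 i))%:E)); last 2 first.
- apply/measurable_EFinP; exact: (measurableT_comp mh2 mF).
- by move=> p; rewrite lee_fin.
rewrite /fubini_F /=; under eq_integral do under eq_integral do rewrite [_ * u 0 i]mulrC.
by rewrite std_normal_convolution// sgE.
Qed.

Lemma linear_form_law (h : R -> R) :
  measurable_fun setT h -> (forall z, 0 <= h z) ->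
  (\int[P]_w (h (dotp (X w) u))%:E = \int[N]_g (h (norm2 u * g)%R)%:E)%E.
Proof.
move=> mh h0.
have := @law [set: 'I_n]%SET (fun=> setT) h (fun=> measurableT) mh h0.
have -> : cyl (~: [set: 'I_n]%SET) (fun=> setT) = setT.
  by apply/seteqP; split => // w _ i /=.
rewrite probability_setT mul1e /S /sg.
under eq_integral do rewrite indicT mul1r.
rewrite (_ : \sum_(i in [set: 'I_n]%SET) _ = dotp u u); last first.
  by rewrite /dotp; apply: eq_big => [i|i _]; rewrite ?inE// expr2.
move=> <-; apply: eq_integral => w _; congr (h _)%:E.
by apply: eq_bigl => i; rewrite inE.
Qed.

End linear_form_law.

(** * Expectation of a product of independent variables *)

Section independent_product.
Context d d' (T : measurableType d) (T' : measurableType d') (R : realType).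
Variables (P : probability T R) (I : finType) (X : I -> T -> T').
Hypothesis mX : forall i, measurable_fun setT (X i).
Hypothesis ind : mutually_independent P X.

Let measurable_prod_fin (g : I -> T' -> R) (Q : pred I) :
  (forall i, measurable_fun setT (g i)) ->
  measurable_fun setT (fun w => \prod_(i | Q i) g i (X i w)).
Proof.
move=> mg; under eq_fun do rewrite -big_filter.
apply: measurable_prod => i _; exact: measurableT_comp.
Qed.

(** For indicators the claim is the definition of independence.  The induction is
on the number of factors which are not indicators; [eq_integral_of_indic]
replaces one of them by all indicators at once. *)
Let expectation_prod_indicators (J : {set I}) (g : I -> T' -> R) (e : I -> R) :
  (forall i, measurable_fun setT (g i)) -> (forall i t, 0 <= g i t) ->
  (forall i, \int[P]_w (g i (X i w))%:E = (e i)%:E)%E ->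
  (forall i, i \notin J -> exists2 B, measurable B & g i = \1_B) ->
  (\int[P]_w (\prod_i g i (X i w))%:E = (\prod_i e i)%:E)%E.
Proof.
move: {2}#|J| (erefl #|J|) => k; elim: k J g e => [|k IH] J g e.
  move=> /eqP; rewrite cards_eq0 => /eqP -> mg g0 ge gB.
  have {}gB i : exists B, measurable B /\ g i = \1_B.
    by have [|B mB E] := gB i; [rewrite inE|exists B].
  have [B HB] := choice gB.
  have mB i : measurable (B i) by case: (HB i).
  have mXB i : measurable (X i @^-1` B i).
    by rewrite -[Y in measurable Y]setTI; exact: mX.
  pose C := \bigcap_(i in [set i | i \in [set: I]%SET]) X i @^-1` B i.
  have mC : measurable C by apply: fin_bigcap_measurable.
  have gC w : \prod_i g i (X i w) = \1_C w.
    rewrite indicE; have [wC|wC] := boolP (w \in C).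
      rewrite big1// => i _; case: (HB i) => _ ->; rewrite indicE mem_set//.
      by move: wC; rewrite inE => /(_ i); apply; rewrite /= inE.
    have [i wi] : exists i, ~ B i (X i w).
      apply/existsNP => h; move: wC; rewrite notin_setE; apply => i _; exact: h.
    rewrite (bigD1 i)//= (_ : g i _ = 0) ?mul0r//.
    by case: (HB i) => _ ->; rewrite indicE memNset.
  under eq_integral do rewrite gC.
  rewrite integral_indic// setIT [LHS]ind//.
  rewrite -prodEFin; under eq_bigl do rewrite inE.
  apply: eq_bigr => i _; rewrite -ge; case: (HB i) => _ ->.
  have := integral_indic P measurableT (mXB i); rewrite setIT => E.
  by apply: esym; apply: etrans E; apply: eq_integral.
move=> cJ mg g0 ge gB.
have [j jJ] : exists j, j \in J by apply/set0Pn; rewrite -cards_eq0 cJ.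
have e0 i : 0 <= e i.
  by rewrite -lee_fin -ge; apply: integral_ge0 => w _; rewrite lee_fin.
pose c := \prod_(i | i != j) e i.
have c0 : 0 <= c by apply: prodr_ge0.
rewrite (bigD1 j)//= -/c.
under eq_integral do rewrite (bigD1 j)//= mulrC.
transitivity (\int[P]_w (cst c w * g j (X j w))%:E)%E; last first.
  under eq_integral do rewrite EFinM.
  rewrite ge0_integralZl_EFin//.
  - by rewrite ge -EFinM mulrC.
  - by move=> w _; rewrite lee_fin.
  - by apply/measurable_EFinP; exact: measurableT_comp.
apply: eq_integral_of_indic => //.
- exact: measurable_prod_fin.
- by move=> w; apply: prodr_ge0.
move=> B mB.
have mXB : measurable (X j @^-1` B) by rewrite -[Y in measurable Y]setTI; exact: mX.
pose g' i := if i == j then \1_B else g i.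
pose e' i := if i == j then fine (P (X j @^-1` B)) else e i.
have Bj : (\int[P]_w (\1_B (X j w))%:E = (fine (P (X j @^-1` B)))%:E)%E.
  rewrite fineK; last exact: fin_num_measure.
  have := integral_indic P measurableT mXB; rewrite setIT => E.
  by apply: etrans E; apply: eq_integral.
have := IH (J :\ j)%SET g' e'.
rewrite (bigD1 j)//= /e' eqxx (eq_bigr e); last by move=> i /negbTE ->.
move=> IHg; transitivity (fine (P (X j @^-1` B)) * c)%:E%E.
  rewrite -IHg.
  - apply: eq_integral => w _; rewrite [in RHS](bigD1 j)//= /g' eqxx mulrC.
    by congr (_ * _)%:E; apply: eq_bigr => i /negbTE ->.
  - by have := cardsD1 j J; rewrite jJ cJ => -[].
  - by move=> i; rewrite /g'; case: ifP => // _; exact: measurable_indic.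
  - by move=> i t; rewrite /g'; case: ifP.
  - by move=> i; rewrite /g'; case: eqP => [->|].
  - move=> i; rewrite !inE negb_and negbK /g'; case: eqP => [_ _|_ /=]; last exact: gB.
    by exists B.
under eq_integral do rewrite EFinM.
rewrite ge0_integralZl_EFin//.
- by rewrite Bj -EFinM mulrC.
- by apply/measurable_EFinP; apply: measurableT_comp => //; exact: measurable_indic.
Qed.

Lemma expectation_prod_independent (g : I -> T' -> R) (e : I -> R) :
  (forall i, measurable_fun setT (g i)) -> (forall i t, 0 <= g i t) ->
  (forall i, \int[P]_w (g i (X i w))%:E = (e i)%:E)%E ->
  (\int[P]_w (\prod_i g i (X i w))%:E = (\prod_i e i)%:E)%E.
Proof.
move=> mg g0 ge; apply: (@expectation_prod_indicators [set: I]%SET) => // i.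
by rewrite inE.
Qed.

End independent_product.

(** * Nets of the unit ball *)

(** Each coordinate is rounded towards zero on the grid of step
[1 / sqrt (q n)], remembering its sign.  Two points with the same code are then
at squared distance at most [n / (q n) = 1 / q].  A set is covered by choosing
one of its points in each nonempty cell, so the net lies inside the set; this
matters for sets such as the unit vectors orthogonal to [x]. *)
Section net.
Variables (R : realType) (n q : nat).
Hypotheses (n0 : (0 < n)%N) (q0 : (0 < q)%N).
Implicit Types u v : 'rV[R]_n.

Let r : R := Num.sqrt (q * n)%:R.
Let code u : {ffun 'I_n -> bool * 'I_(q * n).+1} :=
  [ffun i => (u 0 i < 0, inord (Num.truncn (`|u 0 i| * r)))].
Let light : {set {ffun 'I_n -> bool * 'I_(q * n).+1}} :=
  [set c : {ffun 'I_n -> bool * 'I_(q * n).+1} | (\sum_i (c i).2 <= q * n)%N]%SET.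

(** Give a code with rounded moduli [k_i] the weight [prod_i 2^(-k_i)].  The total
weight factors over the coordinates and is at most [4^n], while each light code
weighs at least [2^(- q n)]. *)
Let card_light : (#|light| <= (4 * 2 ^ q) ^ n)%N.
Proof.
pose F (p : bool * 'I_(q * n).+1) : R := 2^-1 ^+ p.2.
have F0 p : 0 <= F p by rewrite exprn_ge0.
have sF : \sum_p F p <= 4.
  rewrite -(pair_bigA _ (fun (b : bool) (k : 'I_(q * n).+1) => 2^-1 ^+ k)) /= big_bool /=.
  suff : \sum_(k < (q * n).+1) (2^-1 ^+ k : R) <= 2 by lra.
  suff -> : \sum_(k < (q * n).+1) (2^-1 ^+ k : R) = 2 - 2 * 2^-1 ^+ (q * n).+1.
    by have : 0 <= (2^-1 : R) ^+ (q * n).+1 by [rewrite exprn_ge0]; lra.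
  elim: ((q * n).+1) => [|k IH]; first by rewrite big_ord0 expr0; lra.
  by rewrite big_ord_recr/= IH exprS; lra.
have total : \sum_(c : {ffun 'I_n -> bool * 'I_(q * n).+1}) \prod_i F (c i) <= 4 ^+ n.
  rewrite -(bigA_distr_bigA (fun _ p => F p)) /=.
  rewrite -[X in _ <= _ ^+ X](card_ord n) -prodr_const; apply: ler_prod => i _.
  by rewrite sF andbT sumr_ge0.
rewrite -(ler_nat R) expnMn natrM !natrX -exprM.
rewrite -ler_pdivrMr ?exprn_gt0// -exprVn.
apply: le_trans total.
apply: (@le_trans _ _ (\sum_(c in light) \prod_i F (c i))).
  rewrite mulr_natl -sumr_const; apply: ler_sum => c.
  rewrite inE => hc; rewrite /F prodrXr.
  by apply: ler_wiXn2l => //; lra.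
by rewrite [leRHS](bigID [in light])/= lerDl sumr_ge0// => c _; apply: prodr_ge0.
Qed.

Let r0 : 0 < r. Proof. by rewrite sqrtr_gt0 ltr0n muln_gt0 q0. Qed.

Let r2 : r ^+ 2 = (q * n)%:R. Proof. by rewrite sqr_sqrtr. Qed.

Let sum_sqr u : norm2 u <= 1 -> \sum_i (`|u 0 i| * r) ^+ 2 <= (q * n)%:R.
Proof.
move=> u1; rewrite (eq_bigr (fun i => (q * n)%:R * (u 0 i * u 0 i))).
  rewrite -mulr_sumr ler_piMr// -/(dotp u u) -sqr_norm2.
  by rewrite exprn_ile1// norm2_ge0.
by move=> i _; rewrite exprMn real_normK ?num_real// r2 mulrC expr2.
Qed.

Let truncn_small u (i : 'I_n) : norm2 u <= 1 ->
  leq (Num.truncn (`|u 0 i| * r)) (q * n)%N.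
Proof.
move=> u1; have h0 : 0 <= `|u 0 i| * r by rewrite mulr_ge0// ltW.
rewrite -(ler_nat R); set k := Num.truncn _.
have kr : k%:R <= `|u 0 i| * r by rewrite truncn_le.
have := sum_sqr u1; rewrite (bigD1 i)//=.
have : 0 <= \sum_(j | j != i) (`|u 0 j| * r) ^+ 2 by apply: sumr_ge0 => j _; rewrite sqr_ge0.
have k2 : (k%:R : R) <= k%:R ^+ 2.
  by rewrite -natrX ler_nat; case: (k) => // k'; rewrite leq_pmulr.
have : (k%:R : R) ^+ 2 <= (`|u 0 i| * r) ^+ 2 by rewrite ler_sqr ?nnegrE.
lra.
Qed.

(** As [k <= k^2] for integers, the rounded moduli of a vector of the unit ball sum
to at most [sum_i (|u_i| r)^2 <= q n]. *)
Let code_light u : norm2 u <= 1 -> code u \in light.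
Proof.
move=> u1; rewrite inE -(ler_nat R) natr_sum; apply: le_trans (sum_sqr u1).
apply: ler_sum => i _; rewrite ffunE /= inordK ?ltnS ?truncn_small//.
have h0 : 0 <= `|u 0 i| * r by rewrite mulr_ge0// ltW.
set k := Num.truncn _; have kr : k%:R <= `|u 0 i| * r by rewrite truncn_le.
apply: (@le_trans _ _ (k%:R ^+ 2)); last by rewrite ler_sqr ?nnegrE.
by rewrite -natrX ler_nat; case: (k) => // k'; rewrite leq_pmulr.
Qed.

Let code_close u v : norm2 u <= 1 -> norm2 v <= 1 -> code u = code v -> norm2 (u - v) ^+ 2 <= q%:R^-1.
Proof.
move=> u1 v1 uv.
have q0R : 0 < (q%:R : R) by rewrite ltr0n.
have n0R : 0 < (n%:R : R) by rewrite ltr0n.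
have close i : (u 0 i - v 0 i) ^+ 2 <= (r ^+ 2)^-1.
  have := congr1 (fun c : {ffun 'I_n -> bool * 'I_(q * n).+1} => c i) uv.
  rewrite !ffunE => -[sg /(congr1 val)].
  rewrite /= !inordK ?ltnS ?truncn_small// => tr.
  have hu : 0 <= `|u 0 i| * r by rewrite mulr_ge0// ltW.
  have hv : 0 <= `|v 0 i| * r by rewrite mulr_ge0// ltW.
  have /andP[u_ge u_lt] := truncn_itv hu.
  have /andP[v_ge v_lt] := truncn_itv hv.
  rewrite -tr in v_ge v_lt.
  rewrite -[leLHS]real_normK ?num_real// -exprVn ler_sqr ?nnegrE ?invr_ge0 ?(ltW r0)//.
  rewrite -(ler_pM2r r0) mulVf ?lt0r_neq0//.
  have -> : `|u 0 i - v 0 i| = `|(`|u 0 i| - `|v 0 i|)|.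
    move: sg; have [us|us] := ltP (u 0 i) 0; have [vs|vs] := ltP (v 0 i) 0 => // _.
      by rewrite (ltr0_norm us) (ltr0_norm vs) -opprD normrN.
    by rewrite (ger0_norm us) (ger0_norm vs).
  have nr (z : R) : `|z| * r = `|z * r| by rewrite normrM (gtr0_norm r0).
  rewrite nr ler_norml mulrBl.
  by move: u_lt v_lt; rewrite -natr1 => u_lt v_lt; lra.
rewrite sqr_norm2 /dotp (eq_bigr (fun i => (u 0 i - v 0 i) ^+ 2)); last first.
  by move=> i _; rewrite !mxE -expr2.
apply: (@le_trans _ _ (\sum_(i < n) (r ^+ 2)^-1)); first by apply: ler_sum.
rewrite sumr_const card_ord r2 natrM -mulr_natl le_eqVlt; apply/orP; left; apply/eqP.
by field; rewrite !lt0r_neq0.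
Qed.

Lemma net_exists (S : set 'rV[R]_n) : (forall u, S u -> norm2 u <= 1) ->
  exists N : seq 'rV[R]_n, [/\ (size N <= (4 * 2 ^ q) ^ n)%N,
    forall v, v \in N -> S v &
    forall u, S u -> exists2 v, v \in N & norm2 (u - v) ^+ 2 <= q%:R^-1].
Proof.
move=> S1; pose cell c := [set u | S u /\ code u = c].
pose ne c := `[< exists u, cell c u >].
exists [seq xget 0 (cell c) | c <- enum light & ne c]; split.
- rewrite size_map size_filter; apply: leq_trans (count_size _ _) _.
  by rewrite -cardE; exact: card_light.
- move=> v /mapP[c]; rewrite mem_filter => /andP[/asboolP[u cu] _] ->.
  by have [] := xgetPex 0 (ex_intro _ u cu).
move=> u Su; have cu : cell (code u) u by [].
have [Sv cv] := xgetPex 0 (ex_intro _ u cu).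
exists (xget 0 (cell (code u))).
  apply/mapP; exists (code u) => //; rewrite mem_filter mem_enum code_light ?S1// andbT.
  by apply/asboolP; exists u.
by apply: code_close; [exact: S1|exact: S1|exact/esym].
Qed.

End net.

(** * Expectations and one-dimensional Gaussian estimates *)

Section mean.
Context d (T : measurableType d) (R : realType) (P : probability T R).
Implicit Types f g : T -> R.

Definition mean f : R := (\int[P]_w f w)%R.
Definition has_mean f := P.-integrable setT (EFin \o f).

Lemma has_mean_cst c : has_mean (fun=> c).
Proof. exact: finite_measure_integrable_cst. Qed.

Lemma has_meanD f g : has_mean f -> has_mean g -> has_mean (fun w => f w + g w).
Proof.
move=> sf sg; rewrite /has_mean.
rewrite (_ : EFin \o _ = (EFin \o f) \+ (EFin \o g))%E//.
exact: integrableD.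
Qed.

Lemma has_meanZ c f : has_mean f -> has_mean (fun w => c * f w).
Proof.
move=> sf; rewrite /has_mean.
rewrite (_ : EFin \o _ = (fun w => c%:E * (EFin \o f) w))%E//.
exact: integrableZl.
Qed.

Lemma has_mean_le f g : measurable_fun setT f -> (forall w, `|f w| <= g w) ->
  has_mean g -> has_mean f.
Proof.
move=> mf fg; apply: (le_integrable measurableT); first exact/measurable_EFinP.
by move=> w _ /=; rewrite lee_fin (le_trans (fg w))// ler_norm.
Qed.

Lemma mean_cst c : mean (fun=> c) = c.
Proof. by rewrite /mean /Rintegral (integral_probability_cst P). Qed.

Lemma meanD f g : has_mean f -> has_mean g ->
  mean (fun w => f w + g w) = mean f + mean g.
Proof. by move=> sf sg; exact: RintegralD. Qed.

Lemma meanZ c f : has_mean f -> mean (fun w => c * f w) = c * mean f.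
Proof. by move=> sf; exact: RintegralZl. Qed.

Lemma mean_le f g : has_mean f -> has_mean g -> (forall w, f w <= g w) ->
  mean f <= mean g.
Proof. by move=> sf sg fg; apply: le_Rintegral. Qed.

Lemma mean_ge0 f : (forall w, 0 <= f w) -> 0 <= mean f.
Proof. by move=> f0; apply: Rintegral_ge0. Qed.

Lemma has_mean_ge0 f : measurable_fun setT f -> (forall w, 0 <= f w) ->
  (\int[P]_w (f w)%:E < +oo)%E -> has_mean f.
Proof.
move=> mf f0 foo; apply/integrableP; split; first exact/measurable_EFinP.
rewrite (_ : (\int[P]_w _)%E = (\int[P]_w (f w)%:E)%E)//.
by apply: eq_integral => w _ /=; rewrite ger0_norm.
Qed.

Lemma mean_EFin f : has_mean f -> (\int[P]_w (f w)%:E)%E = (mean f)%:E.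
Proof. by move=> sf; rewrite /mean /Rintegral fineK//; exact: integrable_fin_num. Qed.

Lemma mean_indic A : measurable A -> mean \1_A = fine (P A).
Proof. by move=> mA; rewrite /mean /Rintegral integral_indic// setIT. Qed.

End mean.

Section std_normal_facts.
Variable R : realType.
Local Notation N := (std_normal R).

Lemma integral_std_normal_pdf (h : R -> R) :
  measurable_fun setT h -> (forall z, 0 <= h z) ->
  (\int[N]_z (h z)%:E = \int[@lebesgue_measure R]_z (normal_pdf 0 1 z * h z)%:E)%E.
Proof.
move=> mh h0; rewrite integral_std_normal; last first.
- by move=> z; rewrite lee_fin.
- exact/measurable_EFinP.
exact: integral_normal_prob.
Qed.

(** The weight turns the density of [N(0, 1)] into twice that of [N(0, 4)].  This
one exponential moment dominates every integrand met below. *)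
Lemma std_normal_expR_sqr : (\int[N]_z (expR (3 / 8 * z ^+ 2))%:E = 2%:E)%E.
Proof.
have mh : measurable_fun setT (fun z : R => expR (3 / 8 * z ^+ 2)).
  by apply: measurableT_comp => //; apply: measurable_funM => //; exact: measurable_funX.
rewrite integral_std_normal_pdf//.
have n2 : 2 != 0 :> R by [].
transitivity (\int[@lebesgue_measure R]_z (2%:E * (normal_pdf 0 2 z)%:E))%E.
  apply: eq_integral => z _; rewrite -EFinM; congr EFin.
  rewrite !normal_pdfE ?oner_eq0// (normal_peakE 2) ger0_norm//.
  suff E : normal_fun 0 1 z * expR (3 / 8 * z ^+ 2) = normal_fun 0 2 z.
    by rewrite -E; field.
  rewrite /normal_fun -expRD; suff -> : - (z - 0) ^+ 2 / (1 ^+ 2 *+ 2) + 3 / 8 * z ^+ 2 =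
     - (z - 0) ^+ 2 / (2 ^+ 2 *+ 2) by [].
  by rewrite subr0 expr1n !mulr2n; field.
rewrite ge0_integralZl_EFin//.
- by rewrite integral_normal_pdf mule1.
- by move=> z _; rewrite lee_fin normal_pdf_ge0.
- by apply/measurable_EFinP; exact: measurable_normal_pdf.
Qed.

Lemma normal_peak1_le1 : @normal_peak R 1 <= 1.
Proof.
rewrite /normal_peak invf_le1 ?sqrtr_gt0.
  rewrite -[leLHS]sqrtr1 ler_sqrt.
    by rewrite expr1n mul1r mulr2n; have := pihalf_ge1 R; lra.
  by rewrite expr1n mul1r mulrn_wge0// pi_ge0.
by rewrite expr1n mul1r mulrn_wgt0// pi_gt0.
Qed.

(** The standard normal density is at most 1. *)
Lemma std_normal_small_ball (de : R) : 0 <= de ->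
  (\int[N]_z (\1_(`[- de, de]%classic) z)%:E <= (2 * de)%:E)%E.
Proof.
move=> de0.
have mi : measurable_fun setT (\1_(`[- de, de]%classic) : R -> R).
  by apply: measurable_indic; exact: measurable_itv.
rewrite integral_std_normal_pdf//.
apply: (@le_trans _ _ (\int[@lebesgue_measure R]_z (\1_(`[- de, de]%classic) z)%:E)%E).
  apply: ge0_le_integral => //.
  - by move=> z _; rewrite lee_fin mulr_ge0// normal_pdf_ge0.
  - apply/measurable_EFinP/measurable_funM => //; exact: measurable_normal_pdf.
  - exact/measurable_EFinP.
  move=> z _; rewrite lee_fin ler_piMl//.
  apply: le_trans normal_peak1_le1; apply: normal_pdf_ub; exact: oner_neq0.
rewrite integral_indic//= setIT lebesgue_measure_itv/= lte_fin; case: ifP => _; rewrite lee_fin.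
  by rewrite opprK; lra.
by rewrite mulr_ge0.
Qed.

Lemma has_mean_std_normal_abs : has_mean N (fun z => `|z|).
Proof.
apply: (has_mean_le (P := N) (g := fun z => 2 * expR (3 / 8 * z ^+ 2))) => //.
- move=> z; rewrite normr_id; have := expR_ge1Dx (3 / 8 * z ^+ 2).
  rewrite -real_normK ?num_real//; move: `|z| => y; nra.
apply: has_meanZ; apply: has_mean_ge0.
- by apply: measurableT_comp => //; apply: measurable_funM => //; exact: measurable_funX.
- by move=> z; exact: expR_ge0.
- by rewrite std_normal_expR_sqr ltry.
Qed.

Definition abs_moment : R := mean N (fun z => `|z|).

(** [|z| >= 1/4] off an interval of probability at most 1/2. *)
Lemma abs_moment_gt0 : 0 < abs_moment.
Proof.
have mi : measurable (`[- (4^-1), 4^-1]%classic : set R) by exact: measurable_itv.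
have si : has_mean N (\1_(`[- (4^-1), 4^-1]%classic) : R -> R).
  apply: (has_mean_le (P := N) (g := fun=> 1)); last exact: has_mean_cst.
    exact: measurable_indic.
  by move=> w; rewrite indicE; case: (_ \in _); rewrite ?normr1 ?normr0.
have ball : mean N (\1_(`[- (4^-1), 4^-1]%classic) : R -> R) <= 2^-1.
  rewrite -lee_fin -mean_EFin//; apply: le_trans (std_normal_small_ball _) _; first by lra.
  by rewrite lee_fin; lra.
suff : 4^-1 <= abs_moment + 4^-1 * mean N (\1_(`[- (4^-1), 4^-1]%classic) : R -> R) by lra.
rewrite -meanZ// -meanD//; last 2 first.
- exact: has_mean_std_normal_abs.
- exact: has_meanZ.
rewrite -[leLHS](mean_cst N); apply: mean_le.
- exact: has_mean_cst.
- apply: has_meanD; [exact: has_mean_std_normal_abs|exact: has_meanZ].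
move=> z; rewrite indicE; have [|h] := boolP (z \in _).
  by rewrite mulr1 => _; have := normr_ge0 z; lra.
rewrite mulr0 addr0 leNgt; apply: contra h; rewrite inE /= in_itv /= => h.
by rewrite -ler_norml ltW.
Qed.
End std_normal_facts.

(** * The hinge and the Gaussian vector *)

(** With [s = a . x] and [y = a . u] the hinge is supported by the samples at which
[|y / s| > L], but without division by [s]: it is 1-Lipschitz in [y] and its
square is at most [y^2], so its empirical averages concentrate. *)
Definition hinge (R : realType) (L s y : R) : R := Num.max 0 (`|y| - L * `|s|).

Lemma hinge_ge0 (R : realType) (L s y : R) : 0 <= hinge L s y.
Proof. by rewrite le_max lexx. Qed.

Lemma hinge_le (R : realType) (L s y : R) : 0 <= L -> hinge L s y <= `|y|.
Proof.
by move=> L0; rewrite ge_max normr_ge0 lerBlDr lerDl mulr_ge0.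
Qed.

Lemma sqr_hinge_le (R : realType) (L s y : R) : 0 <= L -> hinge L s y ^+ 2 <= y ^+ 2.
Proof.
move=> L0; rewrite -[leRHS]real_normK ?num_real//.
by rewrite ler_sqr ?nnegrE ?hinge_ge0//; exact: hinge_le.
Qed.

Definition near_zero (R : realType) (de y : R) : R := (`|y| <= de)%R%:R.

Lemma near_zeroE (R : realType) (de y : R) : near_zero de y = \1_(`[- de, de]%classic) y.
Proof.
rewrite /near_zero indicE ler_norml; congr (_%:R); congr nat_of_bool.
by apply/idP/idP; rewrite inE/= in_itv.
Qed.

Section real_inequalities.
Variable R : realType.
Implicit Types y z : R.

(** Taylor's formula of order two; the exponential in the remainder is the price
for an unbounded [z]. *)
Lemma expR_le_quadratic z : expR z <= 1 + z + z ^+ 2 * expR `|z|.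
Proof.
have [z0|z0] := leP 0 z.
  rewrite ger0_norm//; have e0 := expR_gt0 z.
  have : expR z * (1 - z) <= 1.
    rewrite -[leRHS](mulfV (lt0r_neq0 e0)) -expRN ler_wpM2l ?expR_ge0//.
    exact: expR_ge1Dx.
  nra.
rewrite ltr0_norm// -{1}[z]opprK -[X in 1 + X + _]opprK -(sqrrN z).
have : 0 < - z by rewrite oppr_gt0.
move: (- z) => t t0.
have e1 : 1 + t <= expR t := expR_ge1Dx t.
have h : expR (- t) * (1 + t) <= 1.
  have E : expR (- t) * expR t = 1 by rewrite -expRD addNr expR0.
  by rewrite -[leRHS]E ler_wpM2l ?expR_ge0.
have h2 : expR (- t) <= 1 - t + t ^+ 2.
  rewrite -(@ler_pM2r _ (1 + t)) ?addr_gt0//; apply: le_trans h _.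
  have -> : (1 - t + t ^+ 2) * (1 + t) = 1 + t ^+ 3 by ring.
  by rewrite lerDl exprn_ge0// ltW.
have : 0 <= t ^+ 2 * (expR t - 1) by rewrite mulr_ge0 ?sqr_ge0//; lra.
lra.
Qed.

Lemma pow4_le_expR y : y ^+ 4 <= 256 * expR (8^-1 * y ^+ 2).
Proof.
have := expR_ge1Dx (16^-1 * y ^+ 2).
have -> : expR (8^-1 * y ^+ 2) = expR (16^-1 * y ^+ 2) ^+ 2.
  by rewrite -expRM_natl; congr expR; field.
have -> : y ^+ 4 = (y ^+ 2) ^+ 2 by ring.
have := sqr_ge0 y; move: (y ^+ 2) (expR _) => a b; nra.
Qed.

End real_inequalities.

Section gaussian_vector.
Context d (T : measurableType d) (R : realType) (P : probability T R).
Variables (n : nat) (X : T -> 'rV[R]_n).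
Hypothesis mX : forall i, measurable_fun setT (fun w => X w 0 i).
Hypothesis gX : standard_gaussian P X.
Implicit Types u v x : 'rV[R]_n.

Lemma measurable_dotp u : measurable_fun setT (fun w => dotp (X w) u).
Proof. by apply: measurable_sum => i; exact: measurable_funM. Qed.

Lemma has_mean_linear_form u (h : R -> R) : measurable_fun setT h ->
  (forall z, 0 <= h z) -> has_mean (std_normal R) (fun g => h (norm2 u * g)) ->
  has_mean P (fun w => h (dotp (X w) u)) /\
  mean P (fun w => h (dotp (X w) u)) = mean (std_normal R) (fun g => h (norm2 u * g)).
Proof.
move=> mh h0 hh; have E := linear_form_law u mX gX mh h0.
have s : has_mean P (fun w => h (dotp (X w) u)).
  apply: has_mean_ge0 => //.
    by apply: measurableT_comp => //; exact: measurable_dotp.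
  by rewrite E mean_EFin// ltry.
by split => //; apply: EFin_inj; rewrite -!mean_EFin.
Qed.

Lemma mean_expR_sqr u : norm2 u = 1 ->
  has_mean P (fun w => expR (3 / 8 * dotp (X w) u ^+ 2)) /\
  mean P (fun w => expR (3 / 8 * dotp (X w) u ^+ 2)) = 2.
Proof.
move=> u1.
have mh : measurable_fun setT (fun z : R => expR (3 / 8 * z ^+ 2)).
  by apply: measurableT_comp => //; apply: measurable_funM => //; exact: measurable_funX.
have E0 := @std_normal_expR_sqr R.
have sN : has_mean (std_normal R) (fun g => expR (3 / 8 * g ^+ 2)).
  by apply: has_mean_ge0 => [//|z|]; [exact: expR_ge0|rewrite E0 ltry].
have [||s ->] := @has_mean_linear_form u (fun z => expR (3 / 8 * z ^+ 2)) mh.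
- by move=> z; exact: expR_ge0.
- by rewrite u1; under eq_fun do rewrite mul1r.
split => //; rewrite u1; under eq_fun do rewrite mul1r.
by apply: EFin_inj; rewrite -mean_EFin.
Qed.

Lemma has_mean_dominated u (f : T -> R) (C : R) : norm2 u = 1 ->
  measurable_fun setT f ->
  (forall w, `|f w| <= C * expR (3 / 8 * dotp (X w) u ^+ 2)) ->
  has_mean P f.
Proof.
move=> u1 mf fC; apply: (has_mean_le mf fC); apply: has_meanZ.
by case: (mean_expR_sqr u1).
Qed.

Lemma mean_abs_linear_form u :
  has_mean P (fun w => `|dotp (X w) u|) /\
  mean P (fun w => `|dotp (X w) u|) = norm2 u * abs_moment R.
Proof.
have sN := has_meanZ (norm2 u) (@has_mean_std_normal_abs R).
have E : (fun g : R => `|norm2 u * g|) = (fun g => norm2 u * `|g|).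
  by apply/funext => g; rewrite normrM ger0_norm// sqrtr_ge0.
have [|//||s ->] := @has_mean_linear_form u (fun z => `|z|).
- exact: normr_measurable.
- by rewrite E.
by split => //; rewrite E meanZ//; exact: has_mean_std_normal_abs.
Qed.

Lemma has_mean_near_zero u de : has_mean P (fun w => near_zero de (dotp (X w) u)).
Proof.
apply: (has_mean_le (g := fun=> 1)); last exact: has_mean_cst; last first.
  by move=> w; rewrite /near_zero normr_nat lern1 leq_b1.
rewrite (_ : (fun _ => _) = (\1_(`[- de, de]%classic) : R -> R) \o (fun w => dotp (X w) u)).
  apply: measurableT_comp; last exact: measurable_dotp.
  by apply: measurable_indic; exact: measurable_itv.
by apply/funext => w /=; rewrite near_zeroE.
Qed.

Lemma mean_small_ball u de : norm2 u = 1 -> 0 <= de ->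
  mean P (fun w => near_zero de (dotp (X w) u)) <= 2 * de.
Proof.
move=> u1 de0.
pose h : R -> R := \1_(`[- de, de]%classic).
have hE w : near_zero de (dotp (X w) u) = h (dotp (X w) u).
  by rewrite near_zeroE.
have mh : measurable_fun setT h by apply: measurable_indic; exact: measurable_itv.
have h0 z : 0 <= h z by rewrite /h indicE.
have sN : has_mean (std_normal R) h.
  apply: has_mean_ge0 => //.
  by apply: le_lt_trans (std_normal_small_ball de0) _; rewrite ltry.
have [|s E] := @has_mean_linear_form u h mh h0.
  by rewrite u1; under eq_fun do rewrite mul1r.
under eq_fun do rewrite hE.
rewrite E u1; under eq_fun do rewrite mul1r.
by rewrite -lee_fin -mean_EFin//; exact: std_normal_small_ball.
Qed.

End gaussian_vector.

Lemma near_zero1 (R : realType) (de y : R) : `|y| <= de -> near_zero de y = 1.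
Proof. by rewrite /near_zero => ->. Qed.

Lemma near_zero0 (R : realType) (de y : R) : de < `|y| -> near_zero de y = 0.
Proof. by rewrite /near_zero leNgt => ->. Qed.

Lemma near_zero_ge0 (R : realType) (de y : R) : 0 <= near_zero de y.
Proof. exact: ler0n. Qed.

Section population.
Context d (T : measurableType d) (R : realType) (P : probability T R).
Variables (n : nat) (X : T -> 'rV[R]_n).
Hypothesis mX : forall i, measurable_fun setT (fun w => X w 0 i).
Hypothesis gX : standard_gaussian P X.
Implicit Types u v x : 'rV[R]_n.

(** By [expR_le_quadratic] the moment generating function of [W] is at most
[1 + la E W + la^2 E (W^2 e^(la |W|))].  Since [|W|] is at most the square of a
standard normal variable [g], the last expectation is at most a multiple of
[E e^(3 g^2 / 8) = 2]. *)
Lemma mgf_le u (W : T -> R) (la : R) : norm2 u = 1 -> 0 <= la <= 4^-1 ->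
  measurable_fun setT W -> (forall w, `|W w| <= dotp (X w) u ^+ 2) ->
  has_mean P (fun w => expR (la * W w)) /\
  mean P (fun w => expR (la * W w)) <= expR (la * mean P W + 512 * la ^+ 2).
Proof.
move=> u1 /andP[la0 la4] mW Wy.
have [sE mE] := mean_expR_sqr mX gX u1.
have e1 w : expR (la * W w) <= expR (3 / 8 * dotp (X w) u ^+ 2).
  rewrite ler_expR; have := Wy w; rewrite ler_norml => /andP[_ h].
  by have := sqr_ge0 (dotp (X w) u); nra.
have sM : has_mean P (fun w => expR (la * W w)).
  apply: (has_mean_le (g := fun w => expR (3 / 8 * dotp (X w) u ^+ 2))) => //.
    by apply: measurableT_comp => //; apply: measurable_funM.
  by move=> w; rewrite ger0_norm ?expR_ge0.
have sW : has_mean P W.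
  apply: (has_mean_dominated (C := 8 / 3) mX gX u1 mW) => w; apply: le_trans (Wy w) _.
  have := expR_ge1Dx (3 / 8 * dotp (X w) u ^+ 2); lra.
split => //.
have key w : expR (la * W w) <=
    1 + (la * W w + (256 * la ^+ 2) * expR (3 / 8 * dotp (X w) u ^+ 2)).
  apply: le_trans (expR_le_quadratic _) _; rewrite addrA lerD2l.
  have b : (la * W w) ^+ 2 <= la ^+ 2 * (dotp (X w) u) ^+ 4.
    rewrite exprMn ler_wpM2l ?sqr_ge0// -[leLHS]real_normK ?num_real//.
    have -> : dotp (X w) u ^+ 4 = (dotp (X w) u ^+ 2) ^+ 2 by ring.
    by rewrite ler_sqr ?nnegrE ?sqr_ge0.
  have c : expR `|la * W w| <= expR (4^-1 * dotp (X w) u ^+ 2).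
    rewrite ler_expR normrM (ger0_norm la0).
    by apply: ler_pM => //; exact: Wy.
  have -> : 3 / 8 * dotp (X w) u ^+ 2 = 8^-1 * dotp (X w) u ^+ 2 + 4^-1 * dotp (X w) u ^+ 2.
    by field.
  rewrite expRD; have h4 := pow4_le_expR (dotp (X w) u).
  apply: (@le_trans _ _ (la ^+ 2 * dotp (X w) u ^+ 4 * expR (4^-1 * dotp (X w) u ^+ 2))).
    by apply: ler_pM => //; exact: sqr_ge0.
  move: h4; move: (expR _) (expR (4^-1 * _)) (expR_ge0 (4^-1 * dotp (X w) u ^+ 2)) => a b' b0 h4.
  have -> : 256 * la ^+ 2 * (a * b') = la ^+ 2 * (256 * a) * b' by ring.
  apply: ler_wpM2r => //.
  by apply: ler_wpM2l => //; exact: sqr_ge0.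
have sR : has_mean P (fun w => la * W w + (256 * la ^+ 2) * expR (3 / 8 * dotp (X w) u ^+ 2)).
  by apply: has_meanD; apply: has_meanZ.
apply: (@le_trans _ _ (1 + (la * mean P W + 256 * la ^+ 2 * 2))).
  rewrite -mE -!meanZ// -meanD//; last 2 first.
  - exact: has_meanZ.
  - exact: has_meanZ.
  rewrite -[X in X + _](mean_cst P 1) -meanD//; last exact: has_mean_cst.
  apply: mean_le => //; apply: has_meanD => //; exact: has_mean_cst.
apply: le_trans (expR_ge1Dx _) _; rewrite ler_expR; lra.
Qed.

Lemma has_mean_sqr u : norm2 u = 1 -> has_mean P (fun w => dotp (X w) u ^+ 2).
Proof.
move=> u1; apply: (has_mean_dominated (C := 8 / 3) mX gX u1).
  by apply: measurable_funX; exact: measurable_dotp.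
move=> w; rewrite ger0_norm ?sqr_ge0//.
have := expR_ge1Dx (3 / 8 * dotp (X w) u ^+ 2); lra.
Qed.

(** The exact value is 1; a positive constant is enough and follows from the small
ball estimate. *)
Lemma mean_sqr_ge u : norm2 u = 1 -> 32^-1 <= mean P (fun w => dotp (X w) u ^+ 2).
Proof.
move=> u1.
have q0 : 0 <= 4^-1 :> R by rewrite invr_ge0.
have b := mean_small_ball mX gX u1 q0.
have sb := has_mean_near_zero P mX u 4^-1.
have s2 := has_mean_sqr u1.
suff : 16^-1 <= mean P (fun w => dotp (X w) u ^+ 2) +
   16^-1 * mean P (fun w => near_zero 4^-1 (dotp (X w) u)) by lra.
rewrite -meanZ// -meanD//; last exact: has_meanZ.
rewrite -[leLHS](mean_cst P); apply: mean_le; first exact: has_mean_cst.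
  by apply: has_meanD => //; exact: has_meanZ.
move=> w; have [h|h] := leP `|dotp (X w) u| 4^-1.
  by rewrite near_zero1// mulr1 lerDr sqr_ge0.
rewrite near_zero0// mulr0 addr0 -[leRHS]real_normK ?num_real//.
by move: h; move: `|_| => y h; nra.
Qed.

Lemma measurable_hinge L x u :
  measurable_fun setT (fun w => hinge L (dotp (X w) x) (dotp (X w) u)).
Proof.
apply: measurable_maxr => //; apply: measurable_funB.
  by apply: measurableT_comp => //; exact: measurable_dotp.
apply: measurable_funM => //.
by apply: measurableT_comp => //; exact: measurable_dotp.
Qed.

Lemma has_mean_sqr_hinge L x u : 0 <= L -> norm2 u = 1 ->
  has_mean P (fun w => hinge L (dotp (X w) x) (dotp (X w) u) ^+ 2).
Proof.
move=> L0 u1; apply: has_mean_le (has_mean_sqr u1).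
  by apply: measurable_funX; exact: measurable_hinge.
by move=> w; rewrite ger0_norm ?sqr_ge0//; exact: sqr_hinge_le.
Qed.

Lemma mean_pow4_le u : norm2 u = 1 ->
  has_mean P (fun w => dotp (X w) u ^+ 4) /\
  mean P (fun w => dotp (X w) u ^+ 4) <= 512.
Proof.
move=> u1; have [sE mE] := mean_expR_sqr mX gX u1.
have key w : dotp (X w) u ^+ 4 <= 256 * expR (3 / 8 * dotp (X w) u ^+ 2).
  apply: le_trans (pow4_le_expR _) _; rewrite ler_pM2l// ler_expR.
  by have := sqr_ge0 (dotp (X w) u); lra.
have s4 : has_mean P (fun w => dotp (X w) u ^+ 4).
  apply: (has_mean_dominated (C := 256) mX gX u1).
    by apply: measurable_funX; exact: measurable_dotp.
  by move=> w; rewrite ger0_norm// exprn_even_ge0.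
split => //; have -> : 512 = 256 * 2 :> R by ring.
by rewrite -mE -meanZ//; apply: mean_le => //; exact: has_meanZ.
Qed.

End population.

(** * Expectation of the squared hinge *)

(** Where the hinge is positive, either [|y| > K] or [|s| < K / L].  Large values
of [|y|] are charged to the fourth moment, small values of [|s|] to the small
ball estimate, which improves with [L] when [K] is fixed. *)
Lemma hinge_mean_small (R : realType) (eta : R) : 0 < eta ->
  exists2 L : R, 0 < L &
  forall d (T : measurableType d) (P : probability T R) n (X : T -> 'rV[R]_n)
    (x u : 'rV[R]_n),
  (forall i, measurable_fun setT (fun w => X w 0 i)) -> standard_gaussian P X ->
  norm2 x = 1 -> norm2 u = 1 ->
  mean P (fun w => hinge L (dotp (X w) x) (dotp (X w) u) ^+ 2) <= eta.
Proof.
move=> eta0; have [C C0 CE] : exists2 C : R, 0 < C & C = 512.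
  by exists 512; [rewrite ltr0n|exact: erefl].
(* The fourth moment enters as 2 th C <= eta / 2; K = 1 / th makes
   y^2 <= th y^4 for |y| > K, and L makes the small ball term eta / 2. *)
pose th := Num.min 1 (eta / (4 * C)).
have th0 : 0 < th by rewrite lt_min ltr01 divr_gt0// mulr_gt0.
have th1 : th <= 1 by rewrite ge_min lexx.
have the : th * (4 * C) <= eta by rewrite -ler_pdivlMr ?mulr_gt0// ge_min lexx orbT.
pose K := th^-1; have K0 : 0 < K by rewrite invr_gt0.
have KE : K * th = 1 by rewrite mulVf// gt_eqF.
pose L := (th ^+ 2 * eta)^-1.
have L0 : 0 < L by rewrite invr_gt0 mulr_gt0// exprn_gt0.
have LE : L * (th ^+ 2 * eta) = 1 by rewrite mulVf// gt_eqF// mulr_gt0// exprn_gt0.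
exists L => // d T P n X x u mX gX x1 u1.
have [s4 m4] := mean_pow4_le mX gX u1; rewrite -CE in m4.
have KL0 : 0 <= K / L by rewrite divr_ge0 ?ltW.
have sb := has_mean_near_zero P mX x (K / L).
have mb := mean_small_ball mX gX x1 KL0.
have sh := has_mean_sqr_hinge mX gX x (ltW L0) u1.
have q0 : 0 < (4 * th)^-1 by rewrite invr_gt0 mulr_gt0.
have qE : (4 * th)^-1 * (4 * th) = 1 by rewrite mulVf// gt_eqF// mulr_gt0.
apply: (@le_trans _ _ ((2 * th) * C + (4 * th)^-1 * (2 * (K / L)))); last first.
  have -> : (4 * th)^-1 * (2 * (K / L)) = eta / 2.
    rewrite /K /L invrK; field; exact: lt0r_neq0.
  lra.
apply: (@le_trans _ _ (2 * th * mean P (fun w => dotp (X w) u ^+ 4) +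
    (4 * th)^-1 * mean P (fun w => near_zero (K / L) (dotp (X w) x)))); last first.
  apply: lerD; first by rewrite ler_pM2l// mulr_gt0.
  by rewrite ler_pM2l.
rewrite -!meanZ// -meanD//; last 2 first.
- exact: has_meanZ.
- exact: has_meanZ.
apply: mean_le => //; first by apply: has_meanD; apply: has_meanZ.
move=> w; set s := dotp _ x; set y := dotp _ u.
have y4 : y ^+ 4 = (y ^+ 2) ^+ 2 by ring.
have nz := near_zero_ge0 (K / L) s.
have [h|h] := leP `|y| (L * `|s|).
  have -> : hinge L s y = 0.
    by apply/eqP; rewrite eq_le hinge_ge0 ge_max lexx subr_le0 h.
  by rewrite expr0n/=; rewrite addr_ge0// mulr_ge0// ?exprn_even_ge0// ltW// mulr_gt0.
apply: le_trans (sqr_hinge_le s y (ltW L0)) _.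
have [yK|Ky] := leP `|y| K.
  rewrite near_zero1 ?mulr1; last first.
    by rewrite ler_pdivlMr// mulrC (le_trans (ltW h)).
  have := sqr_ge0 (y ^+ 2 - (2 * th)^-1).
  have -> : (2 * th)^-1 = 2 * (4 * th)^-1 by field; exact: lt0r_neq0.
  rewrite y4; have := sqr_ge0 (y ^+ 2); move: (y ^+ 2) ((4 * th)^-1) q0 qE => a q q0 qE; nra.
have a1 : 1 <= th * y ^+ 2.
  have : 1 <= th ^+ 2 * y ^+ 2.
    rewrite -(real_normK (num_real y)) -exprMn expr_ge1 ?mulr_ge0// ?ltW//.
    by rewrite -KE mulrC ltr_pM2l.
  have : th ^+ 2 * y ^+ 2 <= th * y ^+ 2.
    by rewrite ler_wpM2r ?sqr_ge0// expr2 ler_piMr// ltW.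
  lra.
have : 0 <= (4 * th)^-1 * near_zero (K / L) s by rewrite mulr_ge0// ltW.
rewrite y4; have := sqr_ge0 y; move: (y ^+ 2) a1 => a a1 a0; nra.
Qed.

(** Expresses the expected hinge by first absolute moments of linear forms: if [x]
and [u] are orthonormal, [L x + u] and [L x - u] both have norm
[sqrt (L^2 + 1)]. *)
Lemma abs_add_abs_sub (R : realType) (L s y : R) : 0 < L ->
  `|L * s + y| + `|L * s - y| = 2 * L * `|s| + 2 * hinge L s y.
Proof.
move=> L0; rewrite /hinge.
have -> : L * `|s| = `|L * s| by rewrite normrM (gtr0_norm L0).
have -> : 2 * L * `|s| = 2 * `|L * s| by rewrite normrM (gtr0_norm L0) mulrA.
move: (L * s) => z; have [h|h] := leP 0 (`|y| - `|z|); move: h;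
case: (ger0P z) => hz; case: (ger0P y) => hy; case: (ger0P (z + y)) => h1;
  case: (ger0P (z - y)) => h2; lra.
Qed.

Lemma sqrt_gap (R : realType) (L : R) : 1 <= L ->
  1 <= (Num.sqrt (L ^+ 2 + 1) - L) * (3 * L).
Proof.
move=> L1; have L0 : 0 <= L by lra.
have := sqr_sqrtr (addr_ge0 (sqr_ge0 L) ler01).
have := sqrtr_ge0 (L ^+ 2 + 1); move: (Num.sqrt _) => r r0 r2.
have rL : L <= r by rewrite -(@ler_pXn2r _ 2) ?nnegrE// r2 lerDl.
have r1 : r <= L + 1.
  rewrite -(@ler_pXn2r _ 2) ?nnegrE ?addr_ge0// r2.
  have -> : (L + 1) ^+ 2 = L ^+ 2 + 1 + 2 * L by ring.
  by rewrite lerDl mulr_ge0.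
apply: (@le_trans _ _ ((r - L) * (r + L))).
  by rewrite -subr_sqr r2 addrAC subrr add0r.
by apply: ler_wpM2l; lra.
Qed.

(** Quantitative form of [E (y^2 / s^2) = +oo].  By [abs_add_abs_sub] the expected
hinge equals [(sqrt (L^2 + 1) - L) E |g|], of order [1 / L].  The hinge is
supported where [|s| <= K / L] or [|y| > K], an event of probability of order
[K / L + 1 / K^4], that is [1 / K^4] for the choice [L = K^5].  A first moment
of order [1 / L] concentrated on so small an event forces a second moment of
order at least [1 / (K L)], and [L^2 / (K L) = K^4] is arbitrarily large. *)
Lemma hinge_mean_large (R : realType) (M : R) :
  exists L be : R, [/\ 0 < L, 0 < be, M <= L ^+ 2 * be &
  forall d (T : measurableType d) (P : probability T R) n (X : T -> 'rV[R]_n)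
    (x u : 'rV[R]_n),
  (forall i, measurable_fun setT (fun w => X w 0 i)) -> standard_gaussian P X ->
  norm2 x = 1 -> norm2 u = 1 -> dotp x u = 0 ->
  be <= mean P (fun w => hinge L (dotp (X w) x) (dotp (X w) u) ^+ 2)].
Proof.
pose e1 := abs_moment R; have e10 : 0 < e1 by exact: abs_moment_gt0.
have [C C0 CE] : exists2 C : R, 0 < C & C = 512.
  by exists 512; [rewrite ltr0n|exact: erefl].
(* al is chosen so that the error term of Young's inequality, with th = al K,
   is exactly half of the lower bound e1 / (3 L) of the first moment. *)
have [al al0 alE] : exists2 al : R, 0 < al & al * e1 = 3 / 2 * (2 + C).
  exists (3 / 2 * (2 + C) / e1); last by field; exact: lt0r_neq0.
  by rewrite divr_gt0// mulr_gt0// ?divr_gt0// addr_gt0.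
pose K := 1 + `|6 * al * M / e1|.
have K1 : 1 <= K by rewrite lerDl.
have K0 : 0 < K by rewrite (lt_le_trans ltr01).
have KM : 6 * al * M <= e1 * K.
  rewrite -ler_pdivrMl// mulrC; apply: le_trans (ler_norm _) _.
  by rewrite /K lerDr.
pose be := e1 / (6 * al * K ^+ 6).
have be0 : 0 < be by apply: divr_gt0 => //; rewrite !mulr_gt0 ?exprn_gt0.
have L0 : 0 < K ^+ 5 by rewrite exprn_gt0.
exists (K ^+ 5), be; split => //.
  have -> : (K ^+ 5) ^+ 2 * be = e1 * K ^+ 4 / (6 * al).
    by rewrite /be; field; rewrite !lt0r_neq0.
  rewrite ler_pdivlMr ?mulr_gt0// mulrC; apply: le_trans KM _.
  by rewrite ler_pM2l// -[leLHS]expr1 ler_weXn2l.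
move=> d T P n X x u mX gX x1 u1 xu.
set L := K ^+ 5.
have L1 : 1 <= L by rewrite exprn_ege1.
have [s4 m4] := mean_pow4_le mX gX u1; rewrite -CE in m4.
have KL0 : 0 <= K / L by rewrite divr_ge0 ?ltW.
have sb := has_mean_near_zero P mX x (K / L).
have mb := mean_small_ball mX gX x1 KL0.
have sh := has_mean_sqr_hinge mX gX x (ltW L0) u1.
have mh := @measurable_hinge _ _ _ _ X mX L x u.
have [sp mp] := mean_abs_linear_form mX gX (L *: x + u).
have [sm mm] := mean_abs_linear_form mX gX (L *: x - u).
have [sx mx] := mean_abs_linear_form mX gX x.
have [su mu] := mean_abs_linear_form mX gX u.
rewrite x1 mul1r in mx.
have xx : dotp x x = 1 by rewrite -sqr_norm2 x1 expr1n.
have uu : dotp u u = 1 by rewrite -sqr_norm2 u1 expr1n.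
have ux : dotp u x = 0 by rewrite dotpC.
have np : norm2 (L *: x + u) = Num.sqrt (L ^+ 2 + 1).
  by rewrite /norm2 !(dotpDr, dotpDl, dotpZr, dotpZl) xx uu xu ux; congr Num.sqrt; ring.
have nm : norm2 (L *: x - u) = Num.sqrt (L ^+ 2 + 1).
  by rewrite /norm2 !(dotpBr, dotpBl, dotpZr, dotpZl) xx uu xu ux; congr Num.sqrt; ring.
have sh1 : has_mean P (fun w => hinge L (dotp (X w) x) (dotp (X w) u)).
  apply: (has_mean_le mh _ su) => w; rewrite ger0_norm ?hinge_ge0//.
  exact: hinge_le (ltW L0).
pose r := Num.sqrt (L ^+ 2 + 1).
have r2 : r ^+ 2 = L ^+ 2 + 1 by rewrite sqr_sqrtr// addr_ge0 ?sqr_ge0.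
have r0 : 0 <= r by exact: sqrtr_ge0.
have hE : mean P (fun w => hinge L (dotp (X w) x) (dotp (X w) u)) = (r - L) * e1.
  have : mean P (fun w => `|dotp (X w) (L *: x + u)| + `|dotp (X w) (L *: x - u)|) =
     mean P (fun w => 2 * L * `|dotp (X w) x| + 2 * hinge L (dotp (X w) x) (dotp (X w) u)).
    congr mean; apply/funext => w; rewrite dotpDr dotpBr dotpZr.
    by rewrite abs_add_abs_sub.
  rewrite !meanD//; last 2 first.
  - exact: has_meanZ.
  - exact: has_meanZ.
  rewrite !meanZ// mp mm mx np nm -/r -/e1; lra.
have hlow : e1 / (3 * L) <= mean P (fun w => hinge L (dotp (X w) x) (dotp (X w) u)).
  rewrite hE ler_pdivrMr ?mulr_gt0//.
  have h : 1 <= (r - L) * (3 * L) by exact: sqrt_gap.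
  by rewrite mulrAC ler_peMl// ltW.
pose th := al * K; have th0 : 0 < th by rewrite mulr_gt0.
have up : mean P (fun w => hinge L (dotp (X w) x) (dotp (X w) u)) <=
   th * mean P (fun w => hinge L (dotp (X w) x) (dotp (X w) u) ^+ 2) +
   (4 * th)^-1 * (mean P (fun w => near_zero (K / L) (dotp (X w) x)) +
      (K ^+ 4)^-1 * mean P (fun w => dotp (X w) u ^+ 4)).
  rewrite -!meanZ// -!meanD//; last first.
  - exact: has_meanZ.
  rewrite -meanZ; last by apply: has_meanD => //; exact: has_meanZ.
  rewrite -meanD; last 2 first.
  - exact: has_meanZ.
  - by apply: has_meanZ; apply: has_meanD => //; exact: has_meanZ.
  apply: mean_le => //.
    apply: has_meanD; apply: has_meanZ => //.
    by apply: has_meanD => //; exact: has_meanZ.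
  move=> w; set s := dotp _ x; set y := dotp _ u.
  have nz := near_zero_ge0 (K / L) s.
  have q0 : 0 < (4 * th)^-1 by rewrite invr_gt0 mulr_gt0.
  have qE : (4 * th)^-1 * (4 * th) = 1 by rewrite mulVf// gt_eqF// mulr_gt0.
  have t0 : 0 <= (K ^+ 4)^-1 * y ^+ 4.
    by rewrite mulr_ge0 ?invr_ge0 ?exprn_even_ge0.
  have [h|h] := leP `|y| (L * `|s|).
    have -> : hinge L s y = 0.
      by apply/eqP; rewrite eq_le hinge_ge0 ge_max lexx subr_le0 h.
    by rewrite expr0n/= mulr0 add0r mulr_ge0 ?addr_ge0// ltW.
  have one : 1 <= near_zero (K / L) s + (K ^+ 4)^-1 * y ^+ 4.
    have [yK|Ky] := leP `|y| K.
      rewrite near_zero1 ?lerDl// ler_pdivlMr// mulrC.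
      by rewrite (le_trans (ltW h)).
    apply: (@le_trans _ _ ((K ^+ 4)^-1 * y ^+ 4)); last by rewrite lerDr.
    rewrite ler_pdivlMl ?exprn_gt0// mulr1.
    have -> : y ^+ 4 = `|y| ^+ 4 by rewrite -normrX ger0_norm// exprn_even_ge0.
    by apply: lerXn2r; rewrite ?nnegrE ?(ltW K0) ?(ltW Ky).
  have hh := hinge_ge0 L s y; move: (hinge L s y) hh => a a0.
  apply: (@le_trans _ _ (th * a ^+ 2 + (4 * th)^-1)); last first.
    by rewrite lerD2l ler_peMr// (ltW q0).
  (* Young: a <= th a^2 + 1 / (4 th). *)
  have := sqr_ge0 (2 * th * a - 1); move: ((4 * th)^-1) q0 qE => q q0 qE; nra.
have fin : (4 * th)^-1 * (mean P (fun w => near_zero (K / L) (dotp (X w) x)) +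
      (K ^+ 4)^-1 * mean P (fun w => dotp (X w) u ^+ 4)) <= e1 / (6 * L).
  apply: (@le_trans _ _ ((4 * th)^-1 * (2 * (K / L) + (K ^+ 4)^-1 * C))).
    rewrite ler_pM2l ?invr_gt0 ?mulr_gt0//; apply: lerD => //.
    by rewrite ler_pM2l ?invr_gt0 ?exprn_gt0.
  rewrite le_eqVlt; apply/orP; left; apply/eqP.
  have e1E : e1 = 3 / 2 * (2 + C) / al by rewrite -alE; field; exact: lt0r_neq0.
  by rewrite e1E /th /L; field; rewrite !lt0r_neq0.
rewrite -(ler_pM2l th0).
have -> : th * be = e1 / (6 * L).
  by rewrite /th /be /L; field; rewrite !lt0r_neq0.
have : e1 / (3 * L) = e1 / (6 * L) + e1 / (6 * L) by field; rewrite lt0r_neq0.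
lra.
Qed.

(** * Averages over the samples and pointwise inequalities *)

Section average.
Variables (R : realType) (m : nat).
Implicit Types F G : 'I_m -> R.

Definition avg F : R := m%:R^-1 * \sum_(k < m) F k.

Lemma avgD F G : avg (fun k => F k + G k) = avg F + avg G.
Proof. by rewrite /avg big_split mulrDr. Qed.

Lemma avgZ c F : avg (fun k => c * F k) = c * avg F.
Proof. by rewrite /avg -mulr_sumr mulrCA. Qed.

Lemma avgN F : avg (fun k => - F k) = - avg F.
Proof. by rewrite /avg sumrN mulrN. Qed.

Lemma avgB F G : avg (fun k => F k - G k) = avg F - avg G.
Proof. by rewrite avgD avgN. Qed.

Lemma avg_le F G : (forall k, F k <= G k) -> avg F <= avg G.
Proof. by move=> FG; rewrite ler_wpM2l ?invr_ge0//; apply: ler_sum. Qed.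

Lemma avg_ge0 F : (forall k, 0 <= F k) -> 0 <= avg F.
Proof. by move=> F0; rewrite mulr_ge0 ?invr_ge0// sumr_ge0. Qed.

Lemma avg_norm F : `|avg F| <= avg (fun k => `|F k|).
Proof.
rewrite /avg normrM ger0_norm ?invr_ge0// ler_wpM2l ?invr_ge0//.
exact: ler_norm_sum.
Qed.

Lemma eq_avg F G : (forall k, F k = G k) -> avg F = avg G.
Proof. by move=> FG; congr (_ * _); apply: eq_bigr. Qed.

End average.

Section pointwise.
Variable R : realType.
Implicit Types s y t : R.

(** The right-hand side is [r^2 (2 + 3 rho + rho^2)] with [r = nu rh] and
[rho = r / s].  If [|rho| <= 1/3] it is at least [r^2].  Otherwise
[|s| < 3 nu |rh|], so that [L |s|] is less than half of [|rh|] and [r^2] is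
at most [4 nu^2] times the squared hinge; the polynomial is never below
[-1/4]. *)
Lemma gradient_gap_ge (L nu s rh : R) : 0 < L -> 0 < nu -> 6 * L * nu <= 1 -> s != 0 ->
  forall y, y = s + nu * rh ->
  (nu * rh) ^+ 2 - 5 * nu ^+ 2 * hinge L s rh ^+ 2 <=
  y ^+ 4 / s ^+ 2 - y ^+ 2 - (y ^+ 3 / s - y * s).
Proof.
move=> L0 nu0 Lnu s0 y yE; set r := nu * rh; pose rho := r / s.
have rE : r = rho * s by rewrite /rho divfK.
have -> : y ^+ 4 / s ^+ 2 - y ^+ 2 - (y ^+ 3 / s - y * s) = r ^+ 2 * (2 + 3 * rho + rho ^+ 2).
  by rewrite yE -/r rE; field.
have h0 := hinge_ge0 L s rh.
have r2 := sqr_ge0 r.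
have [h|h] := leP `|rho| 3^-1.
  move: h; rewrite ler_norml => /andP[h1 h2].
  have : 0 <= 5 * nu ^+ 2 * hinge L s rh ^+ 2 by rewrite mulr_ge0 ?sqr_ge0// mulr_ge0 ?sqr_ge0.
  have : 0 <= r ^+ 2 * (1 + 3 * rho + rho ^+ 2) by rewrite mulr_ge0//; nra.
  lra.
have hr : `|s| < 3 * (nu * `|rh|).
  have : `|r| = nu * `|rh| by rewrite normrM gtr0_norm.
  move=> <-; rewrite rE normrM; have : 0 < `|s| by rewrite normr_gt0.
  move: (`|s|) (`|rho|) h => a b; nra.
have hl : `|rh| <= 2 * hinge L s rh.
  have : `|rh| - L * `|s| <= hinge L s rh by rewrite le_max lexx orbT.
  have : L * `|s| <= L * (3 * (nu * `|rh|)) by rewrite ler_pM2l// ltW.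
  have : 6 * L * nu * `|rh| <= 1 * `|rh| by apply: ler_wpM2r.
  lra.
have h5 : r ^+ 2 <= 4 * nu ^+ 2 * hinge L s rh ^+ 2.
  have -> : r ^+ 2 = (nu * `|rh|) ^+ 2 by rewrite /r !exprMn real_normK ?num_real.
  have -> : 4 * nu ^+ 2 * hinge L s rh ^+ 2 = (nu * (2 * hinge L s rh)) ^+ 2 by ring.
  by rewrite ler_sqr ?nnegrE ?mulr_ge0 ?(ltW nu0)// ler_pM2l.
have : 0 <= r ^+ 2 * (rho + 3 / 2) ^+ 2 by rewrite mulr_ge0 ?sqr_ge0.
move: (r ^+ 2) r2 h5 => a; nra.
Qed.

Lemma sqr_le_amgm s y : s != 0 -> y ^+ 2 <= 2^-1 * (y ^+ 4 / s ^+ 2 + s ^+ 2).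
Proof.
move=> s0; have := sqr_ge0 (y ^+ 2 / s - s).
have -> : (y ^+ 2 / s - s) ^+ 2 = y ^+ 4 / s ^+ 2 - 2 * y ^+ 2 + s ^+ 2 by field.
lra.
Qed.

Lemma pow4_add_le s y u1 : s != 0 ->
  (y - u1 * s) ^+ 4 / s ^+ 2 <= 8 * (y ^+ 4 / s ^+ 2 + u1 ^+ 4 * s ^+ 2).
Proof.
move=> s0.
have -> : 8 * (y ^+ 4 / s ^+ 2 + u1 ^+ 4 * s ^+ 2) = (8 * (y ^+ 4 + (u1 * s) ^+ 4)) / s ^+ 2.
  by field.
rewrite ler_pM2r ?invr_gt0 ?exprn_even_gt0//; move: (u1 * s) => z.
have : (y - z) ^+ 2 <= 2 * (y ^+ 2 + z ^+ 2) by have := sqr_ge0 (y + z); nra.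
have -> : (y - z) ^+ 4 = ((y - z) ^+ 2) ^+ 2 by ring.
have -> : y ^+ 4 = (y ^+ 2) ^+ 2 by ring.
have -> : z ^+ 4 = (z ^+ 2) ^+ 2 by ring.
have := sqr_ge0 (y - z); move: ((y - z) ^+ 2) (sqr_ge0 y) (sqr_ge0 z).
move: (y ^+ 2) (z ^+ 2) => a b c a0 b0 c0 h.
have : c ^+ 2 <= (2 * (a + b)) ^+ 2 by rewrite ler_sqr ?nnegrE//; lra.
have := sqr_ge0 (a - b); nra.
Qed.

Lemma abs_mul_le_weighted (ta a b : R) : 0 < ta -> `|a * b| <= 2^-1 * (ta * a ^+ 2 + ta^-1 * b ^+ 2).
Proof.
move=> ta0.
have h (e : R) : 0 <= ta^-1 * (ta * a - e * b) ^+ 2.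
  by rewrite mulr_ge0 ?invr_ge0 ?sqr_ge0// ltW.
have := h 1; have := h (- 1).
have E e : ta^-1 * (ta * a - e * b) ^+ 2 = ta * a ^+ 2 - 2 * e * (a * b) + e ^+ 2 * (ta^-1 * b ^+ 2).
  by field; exact: lt0r_neq0.
rewrite !E ler_norml => h1 h2; apply/andP; split; lra.
Qed.

End pointwise.

(** * Deterministic analysis of critical points *)

Definition mean_sqr (R : realType) (n m : nat) (a : 'I_m -> 'rV[R]_n)
    (u : 'rV[R]_n) : R :=
  avg (fun k => dotp (a k) u ^+ 2).

(** Stationarity of the loss at [u] along the two directions [u] and [x]. *)
Definition loss_critical (R : realType) (n m : nat) (a : 'I_m -> 'rV[R]_n)
    (x u : 'rV[R]_n) : Prop :=
  avg (fun k => dotp (a k) u ^+ 4 / dotp (a k) x ^+ 2) = mean_sqr a u /\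
  avg (fun k => dotp (a k) u ^+ 3 / dotp (a k) x) =
  avg (fun k => dotp (a k) u * dotp (a k) x).

(** The last condition says that no direction [v] has more than a fixed small part
of its energy on the samples for which [a . x] is small compared with
[a . v]. *)
Definition well_spread (R : realType) (n m : nat) (a : 'I_m -> 'rV[R]_n)
    (x : 'rV[R]_n) (K kap L : R) : Prop :=
  [/\ forall k, dotp (a k) x != 0,
      forall u, mean_sqr a u <= K * norm2 u ^+ 2,
      forall u, kap * norm2 u ^+ 2 <= mean_sqr a u &
      forall v, norm2 v = 1 ->
        10 * avg (fun k => hinge L (dotp (a k) x) (dotp (a k) v) ^+ 2) <= kap].

(** The difference of the two stationarity equations is the average of the
expression bounded below in [gradient_gap_ge]; if [u] differed from [x], this
average would be positive, the hinge term being dominated by [mean_sqr]. *)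
Lemma critical_near_signal (R : realType) (n m : nat) (a : 'I_m -> 'rV[R]_n)
    (x u : 'rV[R]_n) (K kap L : R) :
  norm2 x = 1 -> 0 < kap -> 0 < L -> well_spread a x K kap L ->
  loss_critical a x u -> 6 * L * norm2 (u - x) <= 1 -> u = x.
Proof.
move=> x1 kap0 L0 [s0 _ lower tail] [c1 c2] near; apply/eqP; rewrite -subr_eq0 -norm2_eq0; apply/negPn/negP => v0.
set nu := norm2 (u - x) in near v0.
have nu0 : 0 < nu by rewrite lt_neqAle eq_sym v0 norm2_ge0.
pose v := nu^-1 *: (u - x).
have v1 : norm2 v = 1.
  by rewrite norm2Z ger0_norm ?invr_ge0 ?(ltW nu0)// mulVf.
have uE : u = x + nu *: v by rewrite scalerA divff// scale1r addrC subrK.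
have : nu ^+ 2 * mean_sqr a v - 5 * nu ^+ 2 *
    avg (fun k => hinge L (dotp (a k) x) (dotp (a k) v) ^+ 2) <= 0.
  rewrite /mean_sqr -!avgZ -avgB.
  have -> : 0 = avg (fun k => dotp (a k) u ^+ 4 / dotp (a k) x ^+ 2 - dotp (a k) u ^+ 2 -
     (dotp (a k) u ^+ 3 / dotp (a k) x - dotp (a k) u * dotp (a k) x)).
    by rewrite 3!avgB c1 c2 !subrr.
  apply: avg_le => k; rewrite -exprMn; apply: gradient_gap_ge => //.
  by rewrite {1}uE dotpDr dotpZr.
have := lower v; rewrite v1 expr1n mulr1.
have := tail _ v1.
have : 0 < nu ^+ 2 by rewrite exprn_gt0.
move: (nu ^+ 2) (mean_sqr a v) (avg _) => p q r p0 rk kq le0.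
have qr : 0 < q - 5 * r by lra.
by have := mulr_gt0 p0 qr; lra.
Qed.

(** [y^2 <= (y^4 / s^2 + s^2) / 2], and the first stationarity equation replaces
[avg y^4 / s^2] by [avg y^2]. *)
Lemma mean_sqr_critical_le (R : realType) (n m : nat) (a : 'I_m -> 'rV[R]_n)
    (x u : 'rV[R]_n) : (forall k, dotp (a k) x != 0) ->
  loss_critical a x u -> mean_sqr a u <= mean_sqr a x.
Proof.
move=> s0 [c1 _].
have : mean_sqr a u <= 2^-1 * (mean_sqr a u + mean_sqr a x).
  rewrite -{2}c1 /mean_sqr -avgD -avgZ; apply: avg_le => k.
  exact: sqr_le_amgm.
lra.
Qed.

(** Decompose [u = u1 x + t] with [t] orthogonal to [x].  The first stationarity
equation bounds [u1] and [avg (a . t)^4 / s^2]; the hypothesis with a large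
[M] makes [|t|] small.  The second equation, expanded in [t], then reads
[(u1^3 - u1) mean_sqr a x = O(|t|)], and [mean_sqr a u >= mean_sqr a x / 3]
with [u1 >= 0] leaves only the root [u1 = 1].  So [u] lies in the
neighbourhood of [x] covered by [critical_near_signal]. *)
Lemma critical_eq_signal (R : realType) (K kap L : R) :
  0 < K -> 0 < kap -> 0 < L -> exists2 M : R, 0 < M &
  forall (n m : nat) (a : 'I_m -> 'rV[R]_n) (x u : 'rV[R]_n),
  norm2 x = 1 -> well_spread a x K kap L ->
  (forall t, dotp x t = 0 ->
    M * norm2 t ^+ 4 <= avg (fun k => dotp (a k) t ^+ 4 / dotp (a k) x ^+ 2)) ->
  loss_critical a x u -> 3^-1 * mean_sqr a x <= mean_sqr a u ->
  0 <= dotp u x -> u = x.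
Proof.
move=> K0 kap0 L0.
(* K1 bounds avg (a . t)^4 / s^2; K2 |t| bounds the error in the equation for
   u1; K3 |t| bounds |u1 - 1|. *)
pose K1 := 8 * (K + (K / kap) ^+ 2 * K).
pose K2 := (3 * (K / kap) + 1) * K + 3 * (1 + K / kap) * K + (K1 + K) / 2.
pose K3 := 3 * K2 / kap.
have Kk0 : 0 < K / kap by rewrite divr_gt0.
have K10 : 0 < K1 by rewrite mulr_gt0// addr_gt0// mulr_gt0// exprn_gt0.
have [ta0 [ta00 ta01 taK taL]] : exists ta0 : R, [/\ 0 < ta0, ta0 <= 1,
    18 * K * ta0 <= kap & (6 * L) ^+ 2 * (K3 ^+ 2 + 1) * ta0 <= 1].
  pose b := (6 * L) ^+ 2 * (K3 ^+ 2 + 1).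
  have b0 : 0 < b.
    by rewrite mulr_gt0 ?exprn_gt0 ?mulr_gt0// ltr_wpDl ?sqr_ge0.
  exists (Num.min 1 (Num.min (kap / (18 * K)) b^-1)); split.
  - by rewrite !lt_min ltr01 invr_gt0 b0 divr_gt0// mulr_gt0.
  - by rewrite ge_min lexx.
  - by rewrite mulrC -ler_pdivlMr ?mulr_gt0// !ge_min lexx !orbT.
  - by rewrite mulrC -ler_pdivlMr// div1r !ge_min lexx !orbT.
(* M is such that M |t|^4 <= K1 forces |t| <= ta0, the smallness required by
   the two last conditions on ta0: the first separates u1 from 0, the second
   puts u in the neighbourhood of critical_near_signal. *)
exists (K1 / ta0 ^+ 4); first by rewrite divr_gt0// exprn_gt0.
set M := K1 / ta0 ^+ 4.
have MK : K1 <= M * ta0 ^+ 4 by rewrite divfK// gt_eqF// exprn_gt0.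
have M0 : 0 < M by rewrite divr_gt0// exprn_gt0.
move: M MK M0 => M MK M0 n m a x u x1 ws ortho cu big; set u1 := dotp u x => u10.
have [s0 upper lower tail] := ws.
have [c1 c2] := cu.
have [t tdef] : exists t, t = u - u1 *: x by exists (u - u1 *: x).
have xx : dotp x x = 1 by rewrite -sqr_norm2 x1 expr1n.
have xt : dotp x t = 0 by rewrite tdef dotpBr dotpZr xx mulr1 (dotpC x) subrr.
have uE : u = u1 *: x + t by rewrite tdef addrC subrK.
set S := mean_sqr a x in big.
have SK : S <= K by have := upper x; rewrite x1 expr1n mulr1.
have kS : kap <= S by have := lower x; rewrite x1 expr1n mulr1.
have A2S : mean_sqr a u <= S := mean_sqr_critical_le s0 cu.
pose ta := norm2 t; have ta_ge0 : 0 <= ta := norm2_ge0 t.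
have normu : norm2 u ^+ 2 = u1 ^+ 2 + ta ^+ 2.
  rewrite /ta !sqr_norm2 {1 2}uE !(dotpDl, dotpDr, dotpZl, dotpZr) xx xt (dotpC t) xt; ring.
have u1K : u1 ^+ 2 <= K / kap.
  rewrite ler_pdivlMr// mulrC; have := lower u; rewrite normu.
  have : 0 <= kap * ta ^+ 2 by rewrite mulr_ge0 ?sqr_ge0// ltW.
  lra.
pose T4 := avg (fun k => dotp (a k) t ^+ 4 / dotp (a k) x ^+ 2).
have tE k : dotp (a k) t = dotp (a k) u - u1 * dotp (a k) x by rewrite tdef dotpBr dotpZr.
have T4K : T4 <= K1.
  apply: (@le_trans _ _ (8 * (mean_sqr a u + u1 ^+ 4 * S))).
    rewrite -c1 /S /mean_sqr -avgZ -avgD -avgZ; apply: avg_le => k.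
    by rewrite tE; exact: pow4_add_le.
  have u4 : u1 ^+ 4 <= (K / kap) ^+ 2.
    have -> : u1 ^+ 4 = (u1 ^+ 2) ^+ 2 by ring.
    by rewrite ler_sqr ?nnegrE ?sqr_ge0// ltW.
  rewrite /K1 ler_pM2l//; apply: lerD; first exact: le_trans SK.
  by apply: ler_pM => //; [exact: exprn_even_ge0|exact: le_trans (ltW kap0) kS].
have tata : ta <= ta0.
  rewrite -(@ler_pXn2r _ 4) ?nnegrE ?(ltW ta00)//.
  rewrite -(ler_pM2l M0); apply: le_trans (ortho _ xt) _.
  exact: le_trans T4K MK.
have ta1 : ta <= 1 by exact: le_trans ta01.
have A2t : mean_sqr a t <= K * ta ^+ 2 := upper t.
have expand : (u1 ^+ 3 - u1) * S + (3 * u1 ^+ 2 - 1) * avg (fun k => dotp (a k) x * dotp (a k) t)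
   + 3 * u1 * mean_sqr a t + avg (fun k => dotp (a k) t ^+ 3 / dotp (a k) x) = 0.
  transitivity (avg (fun k => dotp (a k) u ^+ 3 / dotp (a k) x) -
    avg (fun k => dotp (a k) u * dotp (a k) x)); last by rewrite c2 subrr.
  rewrite -avgB /S /mean_sqr -!avgZ -!avgD; apply: eq_avg => k.
  have -> : dotp (a k) u = u1 * dotp (a k) x + dotp (a k) t by rewrite tE; ring.
  by field.
have upper_u1 : u1 <= 1 + K / kap.
  have : u1 <= 1 + u1 ^+ 2 by have := sqr_ge0 (u1 - 1); have := sqr_ge0 u1; lra.
  lra.
have cross : `|avg (fun k => dotp (a k) x * dotp (a k) t)| <= K * ta.
  have [t0|tn0] := eqVneq ta 0.
    have tz : t = 0 by apply/eqP; rewrite -norm2_eq0 -/ta t0.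
    rewrite t0 mulr0 normr_le0; apply/eqP.
    rewrite (eq_avg (G := fun k => 0 * 0)); first by rewrite avgZ mul0r.
    by move=> k; rewrite tz dotp0r !mulr0.
  have tap : 0 < ta by rewrite lt_neqAle eq_sym tn0.
  apply: le_trans (avg_norm _) _.
  apply: (@le_trans _ _ (2^-1 * (ta * S + ta^-1 * mean_sqr a t))).
    rewrite /S /mean_sqr -!avgZ -avgD -avgZ; apply: avg_le => k; exact: abs_mul_le_weighted.
  have h1 : ta * S <= ta * K by rewrite ler_pM2l.
  have h2 : ta^-1 * mean_sqr a t <= ta * K.
    rewrite ler_pdivrMl// mulrA -expr2 mulrC//.
  lra.
have cubic : `|avg (fun k => dotp (a k) t ^+ 3 / dotp (a k) x)| <= (K1 + K) / 2 * ta.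
  have [t0|tn0] := eqVneq ta 0.
    have tz : t = 0 by apply/eqP; rewrite -norm2_eq0 -/ta t0.
    rewrite t0 mulr0 normr_le0; apply/eqP.
    rewrite (eq_avg (G := fun k => 0 * 0)); first by rewrite avgZ mul0r.
    by move=> k; rewrite tz dotp0r expr0n !mul0r.
  have tap : 0 < ta by rewrite lt_neqAle eq_sym tn0.
  apply: le_trans (avg_norm _) _.
  apply: (@le_trans _ _ (2^-1 * (ta * T4 + ta^-1 * mean_sqr a t))).
    rewrite /T4 /mean_sqr -!avgZ -avgD -avgZ; apply: avg_le => k.
    have -> : dotp (a k) t ^+ 4 / dotp (a k) x ^+ 2 = (dotp (a k) t ^+ 2 / dotp (a k) x) ^+ 2 by field.
    have -> : dotp (a k) t ^+ 3 / dotp (a k) x = dotp (a k) t ^+ 2 / dotp (a k) x * dotp (a k) t by field.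
    exact: abs_mul_le_weighted.
  have h1 : ta * T4 <= ta * K1 by rewrite ler_pM2l.
  have h2 : ta^-1 * mean_sqr a t <= ta * K.
    rewrite ler_pdivrMl// mulrA -expr2 mulrC//.
  lra.
have main : `|u1 ^+ 3 - u1| * kap <= K2 * ta.
  apply: (@le_trans _ _ (`|(u1 ^+ 3 - u1) * S|)).
    rewrite normrM; apply: ler_wpM2l => //; apply: le_trans kS (ler_norm _).
  have -> : (u1 ^+ 3 - u1) * S = - ((3 * u1 ^+ 2 - 1) * avg (fun k => dotp (a k) x * dotp (a k) t)
   + 3 * u1 * mean_sqr a t + avg (fun k => dotp (a k) t ^+ 3 / dotp (a k) x)).
    by apply/eqP; rewrite -subr_eq0 opprK; apply/eqP; rewrite -expand; ring.
  rewrite normrN; apply: le_trans (ler_normD _ _) _.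
  rewrite /K2 [leRHS]mulrDl; apply: lerD => //.
  apply: le_trans (ler_normD _ _) _; rewrite [leRHS]mulrDl; apply: lerD.
    rewrite normrM -mulrA; apply: ler_pM => //.
    rewrite ler_norml; have := sqr_ge0 u1; have := ltW Kk0.
    by move=> ? ?; apply/andP; split; lra.
  have ms0 : 0 <= mean_sqr a t by apply: avg_ge0 => k; exact: sqr_ge0.
  rewrite ger0_norm; last exact: (mulr_ge0 (mulr_ge0 (ler0n _ 3) u10) ms0).
  rewrite -!mulrA; apply: ler_wpM2l => //.
  apply: ler_pM => //.
  apply: le_trans A2t _; rewrite ler_wpM2l ?(ltW K0)// expr2 ler_piMl//.
have ta2 : ta ^+ 2 <= ta0.
  have : ta ^+ 2 <= ta by rewrite expr2 ler_piMl.
  lra.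
have u13 : 3^-1 <= u1.
  rewrite -(@ler_pXn2r _ 2) ?nnegrE//.
  have h : mean_sqr a u <= 2 * u1 ^+ 2 * S + 2 * mean_sqr a t.
    rewrite /S /mean_sqr -!avgZ -avgD; apply: avg_le => k.
    have -> : dotp (a k) u = u1 * dotp (a k) x + dotp (a k) t by rewrite tE; ring.
    by have := sqr_ge0 (u1 * dotp (a k) x - dotp (a k) t); lra.
  have : 2 * mean_sqr a t <= 9^-1 * S.
    have : 18 * K * ta ^+ 2 <= 18 * K * ta0 by rewrite ler_pM2l// mulr_gt0.
    lra.
  move=> h2; have S0 : 0 < S by exact: lt_le_trans kS.
  rewrite -(ler_pM2r S0); lra.
have close : (u1 - 1) ^+ 2 <= K3 ^+ 2 * ta ^+ 2.
  rewrite -exprMn -(real_normK (num_real (u1 - 1))).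
  have k1 := ltW Kk0.
  have K20 : 0 <= K2.
    apply: addr_ge0; last by apply: divr_ge0 => //; apply: addr_ge0; exact: ltW.
    have p1 : 0 <= 3 * (K / kap) + 1 by lra.
    have p2 : 0 <= 3 * (1 + K / kap) by lra.
    exact: (addr_ge0 (mulr_ge0 p1 (ltW K0)) (mulr_ge0 p2 (ltW K0))).
  have K30 : 0 <= K3 by exact: (divr_ge0 (mulr_ge0 (ler0n _ 3) K20) (ltW kap0)).
  rewrite ler_sqr ?nnegrE//; last exact: (mulr_ge0 K30 ta_ge0).
  rewrite /K3 mulrAC ler_pdivlMr//.
  have : `|u1 - 1| <= 3 * `|u1 ^+ 3 - u1|.
    have -> : u1 ^+ 3 - u1 = (u1 - 1) * (u1 * (u1 + 1)) by ring.
    rewrite normrM (ger0_norm (_ : 0 <= u1 * (u1 + 1))); last by rewrite mulr_ge0// addr_ge0.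
    rewrite mulrCA ler_peMr//; nra.
  move=> h; have := ler_wpM2r (ltW kap0) h; lra.
apply: (critical_near_signal x1 kap0 L0 ws cu).
have n2 : norm2 (u - x) ^+ 2 = (u1 - 1) ^+ 2 + ta ^+ 2.
  have -> : u - x = (u1 - 1) *: x + t by rewrite tdef scalerBl scale1r [RHS]addrC addrA subrK.
  rewrite /ta !sqr_norm2 !(dotpDl, dotpDr, dotpZl, dotpZr) xx xt (dotpC t) xt; ring.
have L6 : 0 <= 6 * L by rewrite mulr_ge0// ltW.
have : (6 * L * norm2 (u - x)) ^+ 2 <= 1.
  rewrite exprMn n2; apply: le_trans taL; rewrite -mulrA ler_wpM2l ?sqr_ge0//.
  have : (K3 ^+ 2 + 1) * ta ^+ 2 <= (K3 ^+ 2 + 1) * ta0.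
    by rewrite ler_wpM2l// addr_ge0 ?sqr_ge0.
  lra.
have : 0 <= 6 * L * norm2 (u - x) by rewrite mulr_ge0// norm2_ge0.
move: (6 * L * norm2 _) => z z0 z2; rewrite leNgt; apply/negP => z1; nra.
Qed.

(** * Concentration at one point *)

Lemma union_bound d (T : measurableType d) (R : realType) (P : probability T R)
    (V : eqType) (N : seq V) (B : V -> set T) (b : R) :
  (forall v, v \in N -> measurable (B v) /\ (P (B v) <= b%:E)%E) ->
  exists F, [/\ measurable F, (P F <= ((size N)%:R * b)%:E)%E &
    forall v, v \in N -> B v `<=` F].
Proof.
elim: N => [|v N IH] h.
  by exists set0; split => //; rewrite measure0 mul0r.
have [|F [mF PF BF]] := IH; first by move=> u uN; apply: h; rewrite inE uN orbT.
have [mv Pv] := h v (mem_head _ _).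
exists (B v `|` F); split; first exact: measurableU.
  apply: le_trans (measureU2 _ _ _) _ => //=.
  by rewrite -natr1 mulrDl mul1r addrC EFinD leeD.
move=> u; rewrite inE => /orP[/eqP -> w|uN w Bw]; first by left.
by right; exact: (BF u).
Qed.

Lemma measurable_borel_coord (R : realType) (n : nat) (i : 'I_n) :
  measurable_fun setT (fun t : borel_rV R n => (t : 'rV[R]_n) 0 i).
Proof.
apply: (measurability (RGenOInfty.G (R := R))); first exact: RGenOInfty.measurableE.
move=> _ [_ [a ->] <-]; rewrite setTI; apply: sub_sigma_algebra.
have := @coord_continuous R 1 n 0 i; move=> /continuousP; apply.
exact: interval_open.
Qed.

Section chernoff.
Context d (T : measurableType d) (R : realType) (P : probability T R).
Variables (n m : nat) (a : 'I_m -> {RV P >-> borel_rV R n}).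
Hypothesis ga : iid_standard_gaussian a.
Implicit Types u v x : 'rV[R]_n.

Lemma iid_measurable_coord k i :
  measurable_fun setT (fun w => (a k w : 'rV[R]_n) 0 i).
Proof.
apply: (measurableT_comp (@measurable_borel_coord R n i)).
exact: measurable_funP.
Qed.

(** Exponential Markov inequality: independence factors the moment generating
function of the sum and [mgf_le] bounds each factor.  The two values [1] and
[-1] of [sg] give the upper and the lower tail. *)
Lemma chernoff_hinge (sg L be ep la : R) x u : `|sg| <= 1 -> 0 <= L ->
  (0 < m)%N -> 0 < la <= 4^-1 -> norm2 u = 1 ->
  (forall k, mean P (fun w => sg * hinge L (dotp (a k w) x) (dotp (a k w) u) ^+ 2) <= be) ->
  let bad := [set w | be + ep < avg (fun k => sg * hinge L (dotp (a k w) x) (dotp (a k w) u) ^+ 2)] in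
  measurable bad /\ (P bad <= (expR (- (la * ep - 512 * la ^+ 2) * m%:R))%:E)%E.
Proof.
move=> sg1 L0 m0 /andP[la0 la4] u1 mb bad.
have mR : 0 < (m%:R : R) by rewrite ltr0n.
pose W k w : R := sg * hinge L (dotp (a k w) x) (dotp (a k w) u) ^+ 2.
have mW k : measurable_fun setT (W k).
  apply: measurable_funM => //; apply: measurable_funX; apply: measurable_hinge.
  exact: iid_measurable_coord.
have mavg : measurable_fun setT (fun w => avg (fun k => W k w)).
  by apply: measurable_funM => //; apply: measurable_sum => k.
have mbad : measurable bad.
  rewrite (_ : bad = (fun w => avg (fun k => W k w)) @^-1` `]be + ep, +oo[%classic).
    by rewrite -[X in measurable X]setTI; apply: mavg => //; exact: measurable_itv.
  by apply/seteqP; split => w /=; rewrite in_itv/= andbT.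
split => //.
have Wu k w : `|W k w| <= dotp (a k w) u ^+ 2.
  rewrite normrM [X in _ * X]ger0_norm ?sqr_ge0//.
  apply: (@le_trans _ _ (1 * hinge L (dotp (a k w) x) (dotp (a k w) u) ^+ 2)).
    by rewrite ler_wpM2r ?sqr_ge0.
  by rewrite mul1r; exact: sqr_hinge_le.
have lab : 0 <= la <= 4^-1 by rewrite la4 ltW.
have mgf k : has_mean P (fun w => expR (la * W k w)) /\
    mean P (fun w => expR (la * W k w)) <= expR (la * be + 512 * la ^+ 2).
  have [hm le] := @mgf_le _ _ _ _ _ _ (@iid_measurable_coord k) (ga.2 k) u (W k) la u1 lab (mW k) (Wu k).
  split => //; apply: le_trans le _; rewrite ler_expR lerD2r ler_pM2l//.
  exact: mb.
pose g (k : 'I_m) (t : borel_rV R n) : R :=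
  expR (la * (sg * hinge L (dotp (t : 'rV[R]_n) x) (dotp (t : 'rV[R]_n) u) ^+ 2)).
have mg k : measurable_fun setT (g k).
  apply: measurableT_comp => //; apply: measurable_funM => //.
  apply: measurable_funM => //; apply: measurable_funX.
  apply: (@measurable_hinge _ (borel_rV R n) R n (fun t => t)).
  exact: measurable_borel_coord.
have prodE : (\int[P]_w (\prod_k g k (a k w))%:E =
    (\prod_k mean P (fun w => expR (la * W k w)))%:E)%E.
  apply: (expectation_prod_independent (X := fun k => a k : T -> borel_rV R n)) => //.
  - by case: ga.
  - by move=> k t; exact: expR_ge0.
  - by move=> k; rewrite -mean_EFin//; case: (mgf k).
have le1 : (\int[P]_w (\prod_k g k (a k w))%:E <=
    (expR (m%:R * (la * be + 512 * la ^+ 2)))%:E)%E.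
  rewrite prodE lee_fin expRM_natl -[X in _ <= _ ^+ X](card_ord m) -prodr_const.
  apply: ler_prod => k _; apply/andP; split; last by case: (mgf k).
  by apply: mean_ge0 => w; exact: expR_ge0.
have mprod : measurable_fun setT (fun w => \prod_k g k (a k w)).
  by apply: measurable_prod => k _; apply: (measurableT_comp (mg k)); exact: measurable_funP.
pose e0 := expR (la * (m%:R * (be + ep))).
have e00 : 0 < e0 by exact: expR_gt0.
have markov : (e0%:E * P bad <= \int[P]_w (\prod_k g k (a k w))%:E)%E.
  rewrite -(setIT bad) -integral_indic// -ge0_integralZl_EFin//; last 2 first.
  - by apply/measurable_EFinP; exact: measurable_indic.
  - exact: ltW.
  apply: ge0_le_integral => //.
  - by move=> w _; rewrite -EFinM lee_fin mulr_ge0// ltW.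
  - by apply/measurable_EFinP; apply: measurable_funM => //; exact: measurable_indic.
  - exact/measurable_EFinP.
  move=> w _; rewrite -EFinM lee_fin /g -expR_sum indicE.
  have [|_] := boolP (w \in bad); last by rewrite mulr0 expR_ge0.
  rewrite inE mulr1 => hw; rewrite ler_expR -mulr_sumr ler_pM2l//.
  by rewrite mulrC -ler_pdivlMr// mulrC ltW.
have : (e0%:E * P bad <= (expR (m%:R * (la * be + 512 * la ^+ 2)))%:E)%E.
  exact: le_trans le1.
have PE : P bad = (fine (P bad))%:E by rewrite fineK//; exact: fin_num_measure.
rewrite PE -EFinM !lee_fin -ler_pdivlMl// /e0 -expRN -expRD.
move=> h; apply: le_trans h _; rewrite ler_expR.
by rewrite le_eqVlt; apply/orP; left; apply/eqP; ring.
Qed.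

End chernoff.

(** * Events of overwhelming probability *)

(** [Q] involves all directions [u] at once and is not known to be a measurable
event, hence the measurable exceptional set [F].  The constants are uniform in
the dimension, the number of samples and the probability space. *)
Definition whp (R : realType)
    (Q : forall n m : nat, ('I_m -> 'rV[R]_n) -> 'rV[R]_n -> Prop) : Prop :=
  exists c C : R, [/\ 0 < c, 0 < C &
  forall (n m : nat) (x : 'rV[R]_n) (d : measure_display)
    (T : measurableType d) (P : probability T R)
    (a : 'I_m -> {RV P >-> borel_rV R n}),
  norm2 x = 1 -> iid_standard_gaussian a -> C * n%:R <= m%:R ->
  exists F : set T, [/\ measurable F, (P F <= (expR (- (c * m%:R)))%:E)%E &
    forall w, ~ F w -> Q n m (fun k => a k w) x]].

Lemma dim_gt0 (R : realType) n (x : 'rV[R]_n) : norm2 x = 1 -> (0 < n)%N.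
Proof.
case: n x => // x; rewrite /norm2 /dotp big_ord0 sqrtr0 => /eqP.
by rewrite eq_sym oner_eq0.
Qed.

Lemma samples_ge (R : realType) (n m : nat) (C : R) : (0 < n)%N ->
  C * n%:R <= m%:R -> 0 <= C -> C <= m%:R.
Proof.
move=> n0 Cnm C0; apply: le_trans Cnm.
by rewrite -[leLHS]mulr1 ler_wpM2l// ler1n.
Qed.

Lemma whpW (R : realType)
    (Q1 Q2 : forall n m : nat, ('I_m -> 'rV[R]_n) -> 'rV[R]_n -> Prop) :
  (forall n m a x, norm2 x = 1 -> Q1 n m a x -> Q2 n m a x) -> whp Q1 -> whp Q2.
Proof.
move=> Q12 [c [C [c0 C0 h]]]; exists c, C; split => // n m x d T P a x1 ga Cnm.
have [F [mF PF QF]] := h n m x d T P a x1 ga Cnm; exists F; split => // w Fw.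
by apply: Q12 => //; exact: QF.
Qed.

(** Two exceptional sets of probability at most [e^(-2 c m)] have a union of
probability at most [2 e^(-2 c m) <= e^(-c m)], as soon as [c m >= 1]. *)
Lemma whp_and (R : realType)
    (Q1 Q2 : forall n m : nat, ('I_m -> 'rV[R]_n) -> 'rV[R]_n -> Prop) :
  whp Q1 -> whp Q2 -> whp (fun n m a x => Q1 n m a x /\ Q2 n m a x).
Proof.
move=> [c1 [C1 [c10 C10 h1]]] [c2 [C2 [c20 C20 h2]]].
pose c := Num.min c1 c2 / 2.
have c0 : 0 < c by rewrite divr_gt0// lt_min c10 c20.
have cc1 : 2 * c <= c1 by rewrite mulrC divfK// ge_min lexx.
have cc2 : 2 * c <= c2 by rewrite mulrC divfK// ge_min lexx orbT.
exists c, (C1 + C2 + c^-1); split => //.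
  by rewrite !addr_gt0 ?invr_gt0.
move=> n m x d T P a x1 ga Cnm; have n0 := dim_gt0 x1.
have n0R : 0 <= (n%:R : R) by [].
have b1 : 0 <= C1 * n%:R by rewrite mulr_ge0// ltW.
have b2 : 0 <= C2 * n%:R by rewrite mulr_ge0// ltW.
have b3 : 0 <= c^-1 * n%:R by rewrite mulr_ge0// invr_ge0 ltW.
rewrite !mulrDl in Cnm.
have [|F1 [mF1 PF1 Q1F]] := h1 n m x d T P a x1 ga; first by lra.
have [|F2 [mF2 PF2 Q2F]] := h2 n m x d T P a x1 ga; first by lra.
exists (F1 `|` F2); split; first exact: measurableU.
  apply: le_trans (measureU2 _ mF1 mF2) _ => /=.
  apply: le_trans (leeD PF1 PF2) _; rewrite -EFinD lee_fin.
  have cm : 1 <= c * m%:R.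
    rewrite -ler_pdivrMl// mulr1; apply: (@samples_ge _ n m) => //; first by lra.
    by rewrite invr_ge0 ltW.
  have m0 : 0 <= (m%:R : R) by [].
  have e1 : expR (- (c1 * m%:R)) <= expR (- (c * m%:R)) * expR (- (c * m%:R)).
    rewrite -expRD ler_expR; have := ler_wpM2r m0 cc1; lra.
  have e2 : expR (- (c2 * m%:R)) <= expR (- (c * m%:R)) * expR (- (c * m%:R)).
    rewrite -expRD ler_expR; have := ler_wpM2r m0 cc2; lra.
  have eh : expR (- (c * m%:R)) <= 2^-1.
    rewrite expRN lef_pV2 ?posrE ?expR_gt0//.
    by apply: le_trans (expR_ge1Dx _); lra.
  have e0 := expR_gt0 (- (c * m%:R)); nra.
move=> w Fw; split; [apply: Q1F|apply: Q2F] => Fw'; apply: Fw; [by left|by right].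
Qed.

(** At each point of the net Chernoff's bound fails with probability at most
[e^(- rho m)].  The net has at most [B^n <= e^(B n)] points, and
[B n <= rho m / 2] when [m >= C n] with [C] large.  The predicate [dir]
restricts the directions, the net being chosen among the admissible ones. *)
Lemma whp_net (R : realType) (q : nat) (sg L be ep : R)
    (dir : forall n, 'rV[R]_n -> 'rV[R]_n -> Prop) :
  (0 < q)%N -> `|sg| <= 1 -> 0 <= L -> 0 < ep ->
  (forall d (T : measurableType d) (P : probability T R) n (X : T -> 'rV[R]_n)
    (x u : 'rV[R]_n),
    (forall i, measurable_fun setT (fun w => X w 0 i)) -> standard_gaussian P X ->
    norm2 x = 1 -> norm2 u = 1 -> dir n x u ->
    mean P (fun w => sg * hinge L (dotp (X w) x) (dotp (X w) u) ^+ 2) <= be) ->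
  whp (fun n m a x => forall u, norm2 u = 1 -> dir n x u ->
    exists2 v, norm2 v = 1 /\ norm2 (u - v) ^+ 2 <= q%:R^-1 &
      avg (fun k => sg * hinge L (dotp (a k) x) (dotp (a k) v) ^+ 2) <= be + ep).
Proof.
move=> q0 sg1 L0 ep0 pop.
have [D D0 DE] : exists2 D : R, 0 < D & D = 512 by exists 512; [rewrite ltr0n|exact: erefl].
pose la := Num.min 4^-1 (ep / (2 * D)).
have la0 : 0 < la by rewrite lt_min invr_gt0 ltr0n divr_gt0// mulr_gt0.
have la4 : la <= 4^-1 by rewrite ge_min lexx.
have laD : la * (2 * D) <= ep by rewrite -ler_pdivlMr ?mulr_gt0// ge_min lexx orbT.
pose rho := la * ep - D * la ^+ 2.
have rho0 : 0 < rho.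
  have -> : rho = la * (ep - D * la) by rewrite /rho; ring.
  by rewrite mulr_gt0//; lra.
pose B : R := (4 * 2 ^ q)%:R; have B0 : 0 <= B by [].
exists (rho / 2), (2 * (B + 1) / rho); split.
- by rewrite divr_gt0.
- by rewrite divr_gt0// mulr_gt0// ltr_wpDl.
move=> n m x d T P a x1 ga Cnm; have n0 := dim_gt0 x1.
have m0 : (0 < m)%N.
  have C0 : 0 < 2 * (B + 1) / rho by rewrite divr_gt0// mulr_gt0// ltr_wpDl.
  by rewrite -(ltr_nat R); exact: (lt_le_trans C0 (samples_ge n0 Cnm (ltW C0))).
pose S : set 'rV[R]_n := [set u | norm2 u = 1 /\ dir n x u].
have S1 u : S u -> norm2 u <= 1 by move=> [-> _].
have [N [sN NS Nd]] := net_exists n0 q0 S1.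
pose bad v := [set w | be + ep <
  avg (fun k => sg * hinge L (dotp (a k w) x) (dotp (a k w) v) ^+ 2)].
have la04 : 0 < la <= 4^-1 by rewrite la0.
have badP v : v \in N -> measurable (bad v) /\ (P (bad v) <= (expR (- rho * m%:R))%:E)%E.
  move=> /NS [v1 dv].
  have := @chernoff_hinge _ _ _ _ _ _ _ ga sg L be ep la x v sg1 L0 m0 la04 v1.
  rewrite -DE; apply => k.
  by apply: pop => //; [exact: iid_measurable_coord|case: ga].
have [F [mF PF bF]] := union_bound badP.
exists F; split => //.
  apply: le_trans PF _; rewrite lee_fin.
  have s1 : (size N)%:R <= expR (n%:R * B).
    apply: (@le_trans _ _ (B ^+ n)); first by rewrite -natrX ler_nat.
    rewrite expRM_natl lerXn2r ?nnegrE ?expR_ge0//.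
    by apply: le_trans (expR_ge1Dx B); rewrite lerDr.
  apply: (@le_trans _ _ (expR (n%:R * B) * expR (- rho * m%:R))).
    by rewrite ler_wpM2r ?expR_ge0.
  rewrite -expRD ler_expR.
  have : 2 * (B + 1) * n%:R <= rho * m%:R.
    by rewrite -ler_pdivrMl// mulrA (mulrC _^-1).
  have : 0 <= (n%:R : R) by [].
  lra.
move=> w Fw u u1 du; have [v vN uv] := Nd u (conj u1 du).
exists v; first by have [] := NS v vN.
by rewrite leNgt; apply/negP => b; apply: Fw; exact: (bF v vN).
Qed.

(** * Uniformity over the sphere *)

Lemma hinge0 (R : realType) (s y : R) : hinge 0 s y = `|y|.
Proof. by rewrite /hinge mul0r subr0; apply/max_idPr. Qed.

Lemma hinge_lipschitz (R : realType) (L s y z : R) :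
  hinge L s y <= hinge L s z + `|y - z|.
Proof.
rewrite ge_max addr_ge0 ?hinge_ge0//=.
have h : `|z| - L * `|s| <= hinge L s z by rewrite le_max lexx orbT.
have : `|y| <= `|y - z| + `|z| by rewrite -{1}(subrK z y) ler_normD.
lra.
Qed.

Lemma sqr_hinge_perturb (R : realType) (L s y z : R) :
  hinge L s y ^+ 2 <= 2 * hinge L s z ^+ 2 + 2 * (y - z) ^+ 2.
Proof.
rewrite -(real_normK (num_real (y - z))).
have := hinge_lipschitz L s y z; have := hinge_ge0 L s y; have := hinge_ge0 L s z.
have := normr_ge0 (y - z); move: (hinge L s y) (hinge L s z) `|y - z| => p q r r0 q0 p0 h.
have : p ^+ 2 <= (q + r) ^+ 2 by rewrite ler_sqr ?nnegrE ?addr_ge0.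
have := sqr_ge0 (q - r); lra.
Qed.

Section mean_sqr.
Variables (R : realType) (n m : nat) (a : 'I_m -> 'rV[R]_n).
Implicit Types u v : 'rV[R]_n.

Lemma mean_sqr_ge0 u : 0 <= mean_sqr a u.
Proof. by apply: avg_ge0 => k; exact: sqr_ge0. Qed.

Lemma mean_sqrZ c u : mean_sqr a (c *: u) = c ^+ 2 * mean_sqr a u.
Proof. by rewrite /mean_sqr -avgZ; apply: eq_avg => k; rewrite dotpZr exprMn. Qed.

Lemma mean_sqr_homogeneous u :
  u != 0 -> mean_sqr a u = norm2 u ^+ 2 * mean_sqr a ((norm2 u)^-1 *: u).
Proof.
move=> u0; rewrite mean_sqrZ mulrA -exprMn divff ?norm2_eq0//.
by rewrite expr1n mul1r.
Qed.

Lemma mean_sqr_upperP K : 0 <= K ->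
  (forall u, norm2 u = 1 -> mean_sqr a u <= K) ->
  forall u, mean_sqr a u <= K * norm2 u ^+ 2.
Proof.
move=> K0 h u; have [->|u0] := eqVneq u 0.
  by rewrite -[0](scale0r 0) mean_sqrZ expr0n mul0r mulr_ge0// sqr_ge0.
rewrite mean_sqr_homogeneous// mulrC ler_wpM2r ?sqr_ge0//.
by apply: h; exact: norm2_normalize.
Qed.

Lemma mean_sqr_lowerP K :
  (forall u, norm2 u = 1 -> K <= mean_sqr a u) ->
  forall u, K * norm2 u ^+ 2 <= mean_sqr a u.
Proof.
move=> h u; have [->|u0] := eqVneq u 0.
  have -> : norm2 (0 : 'rV[R]_n) = 0 by apply/eqP; rewrite norm2_eq0.
  by rewrite expr0n mulr0 mean_sqr_ge0.
rewrite mean_sqr_homogeneous// mulrC ler_wpM2l ?sqr_ge0//.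
by apply: h; exact: norm2_normalize.
Qed.

(** A bound depending on the samples, which makes the supremum over the sphere
finite in [mean_sqr_net]. *)
Lemma mean_sqr_bounded u : norm2 u = 1 -> mean_sqr a u <= avg (fun k => dotp (a k) (a k)).
Proof.
move=> u1; apply: avg_le => k.
have uu : dotp u u = 1 by rewrite -sqr_norm2 u1 expr1n.
have := dotp_ge0 (a k - dotp (a k) u *: u).
rewrite !(dotpBl, dotpBr, dotpZl, dotpZr) uu (dotpC u); lra.
Qed.

(** Bootstrap: with [v] in the net at distance at most 1/2 from [u],
[mean_sqr a u <= 2 mean_sqr a v + 2 mean_sqr a (u - v)], and the last term is
at most half the supremum over the sphere, which can be absorbed. *)
Lemma mean_sqr_net (b : R) : 0 <= b ->
  (forall u, norm2 u = 1 -> exists2 v, norm2 v = 1 /\ norm2 (u - v) ^+ 2 <= 4^-1 &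
    mean_sqr a v <= b) ->
  forall u, norm2 u = 1 -> mean_sqr a u <= 4 * b.
Proof.
move=> b0 net u u1.
pose A := [set mean_sqr a v | v in [set v | norm2 v = 1]].
have supA : has_sup A.
  split; first by exists (mean_sqr a u); exists u.
  by exists (avg (fun k => dotp (a k) (a k))) => _ [v v1 <-]; exact: mean_sqr_bounded.
have le_sup v : norm2 v = 1 -> mean_sqr a v <= sup A.
  by move=> v1; apply: sup_upper_bound => //; exists v.
have sup0 : 0 <= sup A by exact: le_trans (mean_sqr_ge0 u) (le_sup u u1).
suff : sup A <= 2 * b + 2^-1 * sup A by have := le_sup u u1; lra.
apply: sup_le_ub; first by case: supA.
move=> _ [v v1 <-]; have [z [z1 vz] zb] := net v v1.
have : mean_sqr a v <= 2 * mean_sqr a z + 2 * mean_sqr a (v - z).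
  rewrite /mean_sqr -!avgZ -avgD; apply: avg_le => k; rewrite dotpBr.
  have := sqr_ge0 (dotp (a k) v - 2 * dotp (a k) z); lra.
have : mean_sqr a (v - z) <= sup A * norm2 (v - z) ^+ 2 by apply: mean_sqr_upperP.
have : sup A * norm2 (v - z) ^+ 2 <= sup A * 4^-1 by rewrite ler_wpM2l.
lra.
Qed.

End mean_sqr.

Lemma nat_above (R : realType) (z : R) : exists2 q : nat, (0 < q)%N & z <= q%:R.
Proof. by exists (Num.truncn z).+1 => //; rewrite ltW// truncnS_gt. Qed.

(** Instance [L = 0], [q = 4] of [whp_net]: the hinge is then [|y|]. *)
Lemma whp_upper (R : realType) : exists2 K : R, 0 < K &
  whp (fun n m a x => forall u, @mean_sqr R n m a u <= K * norm2 u ^+ 2).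
Proof.
have one : `|1 : R| <= 1 by rewrite normr1.
exists 28 => //.
apply: whpW (@whp_net R 4 1 0 6 1 (fun _ _ _ => True) isT one (lexx 0) ltr01 _); last first.
  move=> d T P n X x u mX gX x1 u1 _.
  have [sE mE] := mean_expR_sqr mX gX u1.
  apply: (@le_trans _ _ (8 / 3 * 2)); last by lra.
  rewrite -mE -meanZ//; apply: mean_le.
  - have := has_mean_sqr mX gX u1; congr has_mean; apply/funext => w.
    by rewrite hinge0 real_normK ?num_real// mul1r.
  - exact: has_meanZ.
  move=> w; rewrite hinge0 real_normK ?num_real// mul1r.
  have := expR_ge1Dx (3 / 8 * dotp (X w) u ^+ 2); lra.
move=> n m a x x1 net.
apply: mean_sqr_upperP => // u u1.
have -> : 28 = 4 * 7 :> R by ring.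
apply: mean_sqr_net u1 => // v v1.
have [z zv h] := net v v1 I; exists z => //.
have <- : 6 + 1 = 7 :> R by ring.
apply: le_trans h; apply: avg_le => k.
by rewrite hinge0 real_normK ?num_real// mul1r.
Qed.

Section hinge_uniform.
Variables (R : realType) (dir : forall n, 'rV[R]_n -> 'rV[R]_n -> Prop).

(** From the net to the whole sphere: the hinge is Lipschitz, and by [whp_upper]
the energy of [u - v] is of order [1 / q], hence negligible for a fine net. *)
Lemma whp_hinge_upper (L be : R) : 0 <= L -> 0 < be ->
  (forall d (T : measurableType d) (P : probability T R) n (X : T -> 'rV[R]_n)
    (x u : 'rV[R]_n),
    (forall i, measurable_fun setT (fun w => X w 0 i)) -> standard_gaussian P X ->
    norm2 x = 1 -> norm2 u = 1 -> dir x u ->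
    mean P (fun w => hinge L (dotp (X w) x) (dotp (X w) u) ^+ 2) <= be) ->
  whp (fun n m a x => forall u, norm2 u = 1 -> dir x u ->
    avg (fun k => hinge L (dotp (a k) x) (dotp (a k) u) ^+ 2) <= 5 * be).
Proof.
move=> L0 be0 pop; have [K K0 hK] := whp_upper R.
have [q q0 qK] := nat_above (2 * K / be).
have one : `|1 : R| <= 1 by rewrite normr1.
have hnet := @whp_net R q 1 L be be dir q0 one L0 be0.
have /whp_and /(_ hK) : whp (fun n m a x => forall u, norm2 u = 1 -> dir x u ->
    exists2 v, norm2 v = 1 /\ norm2 (u - v) ^+ 2 <= q%:R^-1 &
      avg (fun k => 1 * hinge L (dotp (a k) x) (dotp (a k) v) ^+ 2) <= be + be).
  by apply: hnet => d T P n X x u mX gX x1 u1 du; under eq_fun do rewrite mul1r; exact: pop.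
apply: whpW => n m a x x1 [net up] u u1 du.
have [v [v1 uv] h] := net u u1 du.
have q0R : 0 < (q%:R : R) by rewrite ltr0n.
have small : mean_sqr a (u - v) <= be / 2.
  apply: le_trans (up _) _; apply: (@le_trans _ _ (K * q%:R^-1)).
    by rewrite ler_wpM2l// ltW.
  rewrite ler_pdivrMr//; have : 2 * K <= q%:R * be by rewrite -ler_pdivrMr.
  lra.
have : avg (fun k => hinge L (dotp (a k) x) (dotp (a k) u) ^+ 2) <=
    2 * avg (fun k => 1 * hinge L (dotp (a k) x) (dotp (a k) v) ^+ 2) + 2 * mean_sqr a (u - v).
  rewrite /mean_sqr -!avgZ -avgD; apply: avg_le => k; rewrite mul1r dotpBr.
  exact: sqr_hinge_perturb.
lra.
Qed.

Lemma whp_hinge_lower (L be : R) : 0 <= L -> 0 < be ->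
  (forall d (T : measurableType d) (P : probability T R) n (X : T -> 'rV[R]_n)
    (x u : 'rV[R]_n),
    (forall i, measurable_fun setT (fun w => X w 0 i)) -> standard_gaussian P X ->
    norm2 x = 1 -> norm2 u = 1 -> dir x u ->
    be <= mean P (fun w => hinge L (dotp (X w) x) (dotp (X w) u) ^+ 2)) ->
  whp (fun n m a x => forall u, norm2 u = 1 -> dir x u ->
    be <= 8 * avg (fun k => hinge L (dotp (a k) x) (dotp (a k) u) ^+ 2)).
Proof.
move=> L0 be0 pop; have [K K0 hK] := whp_upper R.
have [q q0 qK] := nat_above (8 * K / be).
have one : `|-1 : R| <= 1 by rewrite normrN1.
have be20 : 0 < be / 2 by rewrite divr_gt0.
have hnet := @whp_net R q (-1) L (- be) (be / 2) dir q0 one L0 be20.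
have /whp_and /(_ hK) : whp (fun n m a x => forall u, norm2 u = 1 -> dir x u ->
    exists2 v, norm2 v = 1 /\ norm2 (u - v) ^+ 2 <= q%:R^-1 &
      avg (fun k => -1 * hinge L (dotp (a k) x) (dotp (a k) v) ^+ 2) <= - be + be / 2).
  apply: hnet => d T P n X x u mX gX x1 u1 du.
  rewrite meanZ ?mulN1r ?lerN2; first exact: pop.
  exact: has_mean_sqr_hinge.
apply: whpW => n m a x x1 [net up] u u1 du.
have [v [v1 uv]] := net u u1 du; rewrite avgZ => h.
have q0R : 0 < (q%:R : R) by rewrite ltr0n.
have small : mean_sqr a (u - v) <= be / 8.
  apply: le_trans (up _) _; apply: (@le_trans _ _ (K * q%:R^-1)).
    by rewrite ler_wpM2l// ltW.
  rewrite ler_pdivrMr//; have : 8 * K <= q%:R * be by rewrite -ler_pdivrMr.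
  lra.
have : avg (fun k => hinge L (dotp (a k) x) (dotp (a k) v) ^+ 2) <=
    2 * avg (fun k => hinge L (dotp (a k) x) (dotp (a k) u) ^+ 2) + 2 * mean_sqr a (u - v).
  rewrite /mean_sqr -!avgZ -avgD; apply: avg_le => k; rewrite dotpBr.
  by rewrite -[in X in _ + 2 * X]sqrrN opprB; exact: sqr_hinge_perturb.
lra.
Qed.

End hinge_uniform.

(** * Random samples are benign *)

(** The probability is 0; the small ball estimate bounds it by every positive number. *)
Lemma prob_linear_form_eq0_le d (T : measurableType d) (R : realType)
    (P : probability T R) n (X : T -> 'rV[R]_n) (x : 'rV[R]_n) (de : R) :
  (forall i, measurable_fun setT (fun w => X w 0 i)) -> standard_gaussian P X ->
  norm2 x = 1 -> 0 <= de ->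
  measurable [set w | dotp (X w) x = 0] /\
  (P [set w | dotp (X w) x = 0%R] <= (2 * de)%:E)%E.
Proof.
move=> mX gX x1 de0.
have mZ : measurable [set w | dotp (X w) x = 0].
  rewrite (_ : [set w | _] = (fun w => dotp (X w) x) @^-1` [set 0])//.
  by rewrite -[Y in measurable Y]setTI; exact: measurable_dotp.
split => //.
have PE : P [set w | dotp (X w) x = 0] = (fine (P [set w | dotp (X w) x = 0]))%:E.
  by rewrite fineK//; exact: fin_num_measure.
rewrite PE lee_fin -mean_indic//.
apply: le_trans (mean_small_ball mX gX x1 de0); apply: mean_le.
- apply: (has_mean_le (g := fun=> 1)); last exact: has_mean_cst.
    exact: measurable_indic.
  by move=> w; rewrite indicE normr_nat lern1 leq_b1.
- exact: has_mean_near_zero.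
move=> w; rewrite indicE; have [|_] := boolP (w \in _); last exact: near_zero_ge0.
by rewrite inE /= => ->; rewrite near_zero1// normr0.
Qed.

Lemma whp_neq0 (R : realType) :
  whp (fun n m (a : 'I_m -> 'rV[R]_n) x => forall k, dotp (a k) x != 0).
Proof.
exists 1, 1; split => // n m x d T P a x1 ga nm.
have n0 := dim_gt0 x1.
have m0 : 0 < (m%:R : R).
  by apply: (lt_le_trans ltr01); exact: (samples_ge n0 nm ler01).
pose b := expR (- (1 * m%:R)) / m%:R : R.
have b0 : 0 <= b / 2 by rewrite divr_ge0// divr_ge0// expR_ge0.
have [|F [mF PF ZF]] := @union_bound _ T R P _ (enum 'I_m)
    (fun k => [set w | dotp (a k w) x = 0]) b.
  move=> k _; have [mZ PZ] := @prob_linear_form_eq0_le _ T R P n (fun w => a k w) x (b / 2)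
     (iid_measurable_coord a k) (ga.2 k) x1 b0.
  by split => //; apply: le_trans PZ _; rewrite lee_fin mulrC divfK.
exists F; split => //.
  by apply: le_trans PF _; rewrite size_enum_ord /b mulrCA divff ?mulr1// gt_eqF.
move=> w Fw k; apply/negP => /eqP s0; apply: Fw; apply: (ZF k) => //.
by rewrite mem_enum.
Qed.

Lemma whp_well_spread (R : realType) : exists K kap L : R,
  [/\ 0 < K, 0 < kap, 0 < L &
  whp (fun n m (a : 'I_m -> 'rV[R]_n) x => well_spread a x K kap L)].
Proof.
have [K K0 hK] := whp_upper R.
pose kap : R := 32^-1 / 8.
have kap0 : 0 < kap by rewrite divr_gt0// invr_gt0.
have hkap : whp (fun n m (a : 'I_m -> 'rV[R]_n) x =>
    forall u, kap * norm2 u ^+ 2 <= mean_sqr a u).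
  have i32 : 0 < 32^-1 :> R by rewrite invr_gt0.
  apply: whpW (@whp_hinge_lower R (fun _ _ _ => True) 0 32^-1 (lexx 0) i32 _); last first.
    move=> d T P n X x u mX gX x1 u1 _.
    apply: le_trans (mean_sqr_ge mX gX u1) _; rewrite le_eqVlt; apply/orP; left; apply/eqP.
    by congr mean; apply/funext => w; rewrite hinge0 real_normK ?num_real.
  move=> n m a x x1 h; apply: mean_sqr_lowerP => u u1.
  rewrite /kap ler_pdivrMr// mulrC; apply: le_trans (h u u1 I) _.
  rewrite ler_pM2l//; apply: avg_le => k.
  by rewrite hinge0 real_normK ?num_real.
have eta0 : 0 < kap / 50 by rewrite divr_gt0.
have [L L0 hL] := hinge_mean_small eta0.
exists K, kap, L; split => //.
have htail := @whp_hinge_upper R (fun _ _ _ => True) L (kap / 50) (ltW L0) eta0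
  (fun d T P n X x u mX gX x1 u1 _ => hL d T P n X x u mX gX x1 u1).
apply: whpW (whp_and (whp_neq0 R) (whp_and hK (whp_and hkap htail))).
move=> n m a x x1 [s0 [up [lo tl]]]; split => // v v1.
by have := tl v v1 I; lra.
Qed.

(** Where the hinge is positive, [|y| > L |s|] and so [y^4 / s^2 >= L^2 y^2],
which is at least [L^2] times the squared hinge; [hinge_mean_large] makes this
lower bound as large as desired. *)
Lemma whp_orthogonal (R : realType) (M : R) : 0 < M ->
  whp (fun n m (a : 'I_m -> 'rV[R]_n) x => forall t, dotp x t = 0 ->
    M * norm2 t ^+ 4 <= avg (fun k => dotp (a k) t ^+ 4 / dotp (a k) x ^+ 2)).
Proof.
move=> M0; have [L [be [L0 be0 LM pop]]] := hinge_mean_large (8 * M).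
have low := @whp_hinge_lower R (fun n x u => dotp x u = 0) L be (ltW L0) be0 pop.
apply: whpW (whp_and (whp_neq0 R) low) => n m a x x1 [s0 h] t xt.
have [->|t0] := eqVneq t 0.
  have -> : norm2 (0 : 'rV[R]_n) = 0 by apply/eqP; rewrite norm2_eq0.
  rewrite expr0n mulr0; apply: avg_ge0 => k.
  by rewrite divr_ge0 ?sqr_ge0// exprn_even_ge0.
have [v [v1 xv tE]] : exists v, [/\ norm2 v = 1, dotp x v = 0 & t = norm2 t *: v].
  exists ((norm2 t)^-1 *: t); split; first exact: norm2_normalize.
    by rewrite dotpZr xt mulr0.
  by rewrite scalerA divff ?norm2_eq0// scale1r.
have {}h := h v v1 xv.
apply: (@le_trans _ _ (norm2 t ^+ 4 * (L ^+ 2 *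
    avg (fun k => hinge L (dotp (a k) x) (dotp (a k) v) ^+ 2)))).
  rewrite mulrC ler_wpM2l ?exprn_even_ge0//.
  have := ler_wpM2l (sqr_ge0 L) h; lra.
rewrite -!avgZ; apply: avg_le => k.
rewrite [in leRHS]tE dotpZr exprMn -[leRHS]mulrA ler_wpM2l ?exprn_even_ge0//.
set s := dotp _ x; set y := dotp _ v; have sk : s != 0 := s0 k.
have s2 : 0 < s ^+ 2 by rewrite exprn_even_gt0.
rewrite ler_pdivlMr//.
have [hy|hy] := leP `|y| (L * `|s|).
  have -> : hinge L s y = 0.
    by apply/eqP; rewrite eq_le hinge_ge0 ge_max lexx subr_le0 hy.
  by rewrite expr0n/= mulr0 mul0r exprn_even_ge0.
have h1 := sqr_hinge_le s y (ltW L0).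
have h2 : (L * `|s|) ^+ 2 <= `|y| ^+ 2.
  by rewrite ler_sqr ?nnegrE ?mulr_ge0 ?(ltW L0)// ltW.
rewrite exprMn !real_normK ?num_real// in h2.
have -> : y ^+ 4 = y ^+ 2 * y ^+ 2 by ring.
rewrite mulrAC; apply: ler_pM => //; last exact: sqr_ge0.
by apply: mulr_ge0; exact: sqr_ge0.
Qed.

Lemma loss_criticalN (R : realType) (n m : nat) (a : 'I_m -> 'rV[R]_n)
    (x u : 'rV[R]_n) : loss_critical a x u -> loss_critical a x (- u).
Proof.
move=> [c1 c2]; split.
  transitivity (avg (fun k => dotp (a k) u ^+ 4 / dotp (a k) x ^+ 2)).
    by apply: eq_avg => k; rewrite dotpNr; congr (_ / _); ring.
  by rewrite c1; apply: eq_avg => k; rewrite dotpNr sqrrN.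
transitivity (- avg (fun k => dotp (a k) u ^+ 3 / dotp (a k) x)).
  rewrite -avgN; apply: eq_avg => k; rewrite dotpNr -mulNr; congr (_ / _); ring.
by rewrite c2 -avgN; apply: eq_avg => k; rewrite dotpNr mulNr.
Qed.

(** What the geometry of the loss requires of the samples. *)
Definition benign (R : realType) (n m : nat) (a : 'I_m -> 'rV[R]_n)
    (x : 'rV[R]_n) : Prop :=
  [/\ forall k, dotp (a k) x != 0,
      exists2 kap : R, 0 < kap & forall u, kap * norm2 u ^+ 2 <= mean_sqr a u &
      forall u, loss_critical a x u -> 3^-1 * mean_sqr a x <= mean_sqr a u ->
        u = x \/ u = - x].

Lemma whp_benign (R : realType) :
  whp (fun n m (a : 'I_m -> 'rV[R]_n) x => benign a x).
Proof.
have [K [kap [L [K0 kap0 L0 hws]]]] := whp_well_spread R.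
have [M M0 crit] := critical_eq_signal K0 kap0 L0.
apply: whpW (whp_and hws (whp_orthogonal M0)) => n m a x x1 [ws ortho].
have [s0 _ lo _] := ws; split => //; first by exists kap.
move=> u cu big; have [ux|ux] := leP 0 (dotp u x).
  by left; exact: crit ws ortho cu big ux.
right; rewrite -[LHS]opprK; congr (- _).
apply: crit ws ortho (loss_criticalN cu) _ _ => //.
- by rewrite (_ : mean_sqr a (- u) = mean_sqr a u)// -scaleN1r mean_sqrZ sqrrN expr1n mul1r.
- by rewrite -scaleN1r dotpZl mulN1r oppr_ge0 ltW.
Qed.

(** * Polynomial expansion along lines *)

Section derive_expansion.
Variables (R : realType) (n : nat).
Implicit Types (f : 'rV[R]_n -> R) (u v : 'rV[R]_n).

(** The loss is a quartic polynomial on each line, so its directional derivatives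
are read off the coefficients. *)
Lemma derive_expansion f u v (c1 c2 c3 c4 : R) :
  (forall h : R, f (h *: v + u) =
     f u + h * c1 + h ^+ 2 * c2 + h ^+ 3 * c3 + h ^+ 4 * c4) ->
  'D_v f u = c1.
Proof.
move=> E; rewrite /derive; apply: cvg_lim => //.
apply: (@cvg_trans _ ((c1 + h * (c2 + h * (c3 + h * c4))) @[h --> (0 : R)^'])).
  apply: near_eq_cvg; near=> h.
  have h0 : h != 0 by near: h; exact: nbhs_dnbhs_neq.
  rewrite /= E /GRing.scale /=; field.
  by [].
apply: cvg_within_filter.
have : (c1 + h * (c2 + h * (c3 + h * c4))) @[h --> (0 : R)] --> c1 + 0 * (c2 + 0 * (c3 + 0 * c4)).
  apply: cvgD; first exact: cvg_cst.
  apply: cvgM; first exact: cvg_id.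
  apply: cvgD; first exact: cvg_cst.
  apply: cvgM; first exact: cvg_id.
  apply: cvgD; first exact: cvg_cst.
  by apply: cvgM; [exact: cvg_id|exact: cvg_cst].
by rewrite mul0r addr0.
Unshelve. all: by end_near. Qed.

Lemma near_line (u v : 'rV[R]_n) (A : 'rV[R]_n -> Prop) :
  (\forall w \near u, A w) -> \forall h \near (0 : R), A (h *: v + u).
Proof.
move=> nA; have : (h *: v + u) @[h --> (0 : R)] --> 0 *: v + u.
  apply: cvgD; last exact: cvg_cst.
  by apply: cvgZr_tmp; exact: cvg_id.
by rewrite scale0r add0r; apply.
Qed.

(** The first and second order necessary conditions at a minimum. *)
Lemma quartic_near_ge0 (c1 c2 c3 c4 : R) :
  (\forall h \near (0 : R), 0 <= h * c1 + h ^+ 2 * c2 + h ^+ 3 * c3 + h ^+ 4 * c4) ->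
  c1 = 0 /\ 0 <= c2.
Proof.
move=> /nbhs_ballP[e /= e0 he].
have {}he h : `|h| < e -> 0 <= h * c1 + h ^+ 2 * c2 + h ^+ 3 * c3 + h ^+ 4 * c4.
  by move=> hh; apply: he; rewrite /ball /= sub0r normrN.
pose B := `|c2| + `|c3| + `|c4| + 1.
have B0 : 0 < B by rewrite ltr_wpDl// !addr_ge0.
have c10 : c1 = 0.
  apply/eqP/negPn/negP => cn0.
  have c1p : 0 < `|c1| by rewrite normr_gt0.
  pose t := Num.min 1 (Num.min (e / 2) (`|c1| / (2 * B))).
  have t0 : 0 < t by rewrite !lt_min ltr01 !divr_gt0// mulr_gt0.
  have t1 : t <= 1 by rewrite ge_min lexx.
  have te : t < e.
    apply: (@le_lt_trans _ _ (e / 2)); last by lra.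
    by rewrite !ge_min lexx orbT.
  have tB : t * (2 * B) <= `|c1|.
    by rewrite -ler_pdivlMr ?mulr_gt0// !ge_min lexx !orbT.
  (* A step h of size t with the sign opposite to that of c1. *)
  have [h hn h1] : exists2 h : R, `|h| = t & h * c1 = - (t * `|c1|).
    exists (- t * Num.sg c1); last by rewrite -mulrA -normrEsg mulNr.
    by rewrite normrM normrN normr_sg cn0 mulr1 gtr0_norm.
  have h2 : h ^+ 2 = t ^+ 2 by rewrite -(real_normK (num_real h)) hn.
  have := he h; rewrite hn => /(_ te).
  have -> : h ^+ 3 = h * t ^+ 2 by rewrite -h2; ring.
  have -> : h ^+ 4 = t ^+ 2 * t ^+ 2 by rewrite -h2; ring.
  rewrite h1 h2.
  have b2 : t ^+ 2 * c2 <= t ^+ 2 * `|c2| by rewrite ler_wpM2l ?sqr_ge0// ler_norm.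
  have b3 : h * t ^+ 2 * c3 <= t ^+ 2 * `|c3|.
    apply: le_trans (ler_norm _) _; rewrite normrM normrM hn (ger0_norm (sqr_ge0 t)).
    by rewrite ler_wpM2r// ler_piMl// sqr_ge0.
  have b4 : t ^+ 2 * t ^+ 2 * c4 <= t ^+ 2 * `|c4|.
    apply: le_trans (ler_norm _) _; rewrite normrM normrM (ger0_norm (sqr_ge0 t)).
    by rewrite ler_wpM2r// ler_piMl ?sqr_ge0// expr_le1// ltW.
  have b5 : t ^+ 2 * B <= t * `|c1| / 2.
    have := ler_wpM2l (ltW t0) tB; rewrite expr2; lra.
  have t2 : 0 < t ^+ 2 by rewrite exprn_gt0.
  have tc : 0 < t * `|c1| by rewrite mulr_gt0.
  rewrite /B !mulrDr in b5; lra.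
split => //; rewrite c10 in he.
rewrite leNgt; apply/negP => c2n.
pose D := `|c3| + `|c4| + 1.
have D0 : 0 < D by rewrite ltr_wpDl// addr_ge0.
pose t := Num.min 1 (Num.min (e / 2) (- c2 / (2 * D))).
have t0 : 0 < t by rewrite !lt_min ltr01 !divr_gt0 ?oppr_gt0// mulr_gt0.
have t1 : t <= 1 by rewrite ge_min lexx.
have te : t < e.
  apply: (@le_lt_trans _ _ (e / 2)); last by lra.
  by rewrite !ge_min lexx orbT.
have tD : t * (2 * D) <= - c2.
  by rewrite -ler_pdivlMr ?mulr_gt0// !ge_min lexx !orbT.
have := he t; rewrite (gtr0_norm t0) => /(_ te).
have t2 : 0 < t ^+ 2 by rewrite exprn_gt0.
have -> : t * 0 + t ^+ 2 * c2 + t ^+ 3 * c3 + t ^+ 4 * c4 =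
  t ^+ 2 * (c2 + t * c3 + t ^+ 2 * c4) by ring.
rewrite pmulr_rge0//.
have b3 : t * c3 <= t * `|c3| by rewrite ler_pM2l// ler_norm.
have b4 : t ^+ 2 * c4 <= t * `|c4|.
  apply: le_trans (ler_norm _) _; rewrite normrM (ger0_norm (ltW t2)).
  by rewrite ler_wpM2r// expr2 ler_piMl// ltW.
have : t * D = t * `|c3| + t * `|c4| + t by rewrite /D !mulrDr mulr1.
lra.
Qed.

Lemma dotp_continuous (c : 'rV[R]_n) : continuous (fun u => dotp c u).
Proof.
apply: (continuous_big (op := +%R)); first exact: add_continuous.
move=> i _ u; apply: (@cvgM _ _ (nbhs u) _ (fun=> c 0 i)); first exact: cvg_cst.
exact: coord_continuous.
Qed.

End derive_expansion.

(** * First and second order analysis of the loss *)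

(** A quarter of the derivative of the loss at [u] along [v]. *)
Definition loss_slope (R : realType) (n m : nat) (a : 'I_m -> 'rV[R]_n)
    (x u v : 'rV[R]_n) : R :=
  avg (fun k =>
    (dotp (a k) u ^+ 3 / dotp (a k) x ^+ 2 - dotp (a k) u) * dotp (a k) v).

(** A quarter of the second derivative of the loss at [u] along [v]. *)
Definition loss_bend (R : realType) (n m : nat) (a : 'I_m -> 'rV[R]_n)
    (x u v : 'rV[R]_n) : R :=
  avg (fun k =>
    (3 * (dotp (a k) u ^+ 2 / dotp (a k) x ^+ 2) - 1) * dotp (a k) v ^+ 2).

Section loss.
Variables (R : realType) (n m : nat) (a : 'I_m -> 'rV[R]_n) (x : 'rV[R]_n).
Hypothesis s0 : forall k, dotp (a k) x != 0.
Implicit Types u v : 'rV[R]_n.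

Local Notation slope := (loss_slope a x).
Local Notation bend := (loss_bend a x).

Lemma loss_expansion u v (h : R) :
  loss a x (h *: v + u) = loss a x u + h * (4 * slope u v) + h ^+ 2 * (2 * bend u v)
   + h ^+ 3 * (4 * avg (fun k => dotp (a k) u * dotp (a k) v ^+ 3 / dotp (a k) x ^+ 2))
   + h ^+ 4 * avg (fun k => dotp (a k) v ^+ 4 / dotp (a k) x ^+ 2).
Proof.
rewrite /loss_slope /loss_bend -!avgZ -[loss a x u]/(avg _) -!avgD.
apply: eq_avg => k; rewrite dotpDr dotpZr.
by have := s0 k; move: (dotp (a k) x) (dotp (a k) u) (dotp (a k) v) => s y z sk; field.
Qed.

Lemma partial_loss i u : partial i (loss a x) u =
  4 * avg (fun k => (dotp (a k) u ^+ 3 / dotp (a k) x ^+ 2 - dotp (a k) u) * a k 0 i).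
Proof.
rewrite /partial (derive_expansion (loss_expansion u (delta_mx 0 i))).
congr (_ * _); apply: eq_avg => k; congr (_ * _).
rewrite /dotp (bigD1 i)//= big1 ?addr0 => [|j ji]; first by rewrite mxE !eqxx mulr1.
by rewrite mxE (negbTE ji) andbF mulr0.
Qed.

Lemma dotp_delta k i : dotp (a k) (delta_mx 0 i) = a k 0 i.
Proof.
rewrite /dotp (bigD1 i)//= big1 ?addr0 => [|j ji]; first by rewrite mxE !eqxx mulr1.
by rewrite mxE (negbTE ji) andbF mulr0.
Qed.

Lemma hessian_loss i j u : hessian (loss a x) u i j =
  4 * avg (fun k => (3 * (dotp (a k) u ^+ 2 / dotp (a k) x ^+ 2) - 1) * (a k 0 i * a k 0 j)).
Proof.
rewrite mxE (_ : partial j (loss a x) = fun u => 4 * avg (fun k =>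
  (dotp (a k) u ^+ 3 / dotp (a k) x ^+ 2 - dotp (a k) u) * a k 0 j)); last first.
  by apply/funext => w; exact: partial_loss.
rewrite /partial; apply: (@derive_expansion _ _ _ _ _ _
  (4 * avg (fun k => 3 * (dotp (a k) u / dotp (a k) x ^+ 2 * a k 0 i ^+ 2 * a k 0 j)))
  (4 * avg (fun k => a k 0 i ^+ 3 / dotp (a k) x ^+ 2 * a k 0 j)) 0) => h.
rewrite -!avgZ mulr0 addr0 -!avgD.
apply: eq_avg => k; rewrite dotpDr dotpZr dotp_delta.
by have := s0 k; move: (dotp (a k) x) (dotp (a k) u) (a k 0 i) (a k 0 j) => s y z t sk; field.
Qed.

Lemma curvature_loss u xi : curvature (loss a x) u xi = 4 * bend u xi.
Proof.
rewrite /curvature /loss_bend.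
transitivity (\sum_(i < n) \sum_(j < n) 4 * avg (fun k =>
    (3 * (dotp (a k) u ^+ 2 / dotp (a k) x ^+ 2) - 1) * ((a k 0 i * xi 0 i) * (a k 0 j * xi 0 j)))).
  apply: eq_bigr => i _; apply: eq_bigr => j _.
  rewrite hessian_loss mulrCA; congr (4 * _); rewrite -avgZ; apply: eq_avg => k; ring.
under eq_bigr do rewrite -mulr_sumr.
rewrite -mulr_sumr; congr (_ * _); rewrite /avg.
under eq_bigr do rewrite -mulr_sumr.
rewrite -mulr_sumr; congr (_ * _).
under eq_bigr do rewrite exchange_big /=.
rewrite exchange_big /=; apply: eq_bigr => k _.
under eq_bigr do rewrite -mulr_sumr.
rewrite -mulr_sumr; congr (_ * _).
under eq_bigr do rewrite -mulr_sumr.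
by rewrite -mulr_suml expr2.
Qed.

Lemma slope_critical u : slope u u = 0 -> slope u x = 0 -> loss_critical a x u.
Proof.
move=> h1 h2; split.
  apply/eqP; rewrite -subr_eq0 -avgB -h1; apply/eqP; apply: eq_avg => k.
  by have := s0 k; move: (dotp (a k) x) (dotp (a k) u) => s y sk; field.
apply/eqP; rewrite -subr_eq0 -avgB -h2; apply/eqP; apply: eq_avg => k.
by have := s0 k; move: (dotp (a k) x) (dotp (a k) u) => s y sk; field.
Qed.

Lemma critical_slope u v : critical_point (loss a x) u -> slope u v = 0.
Proof.
move=> cu.
have : \sum_(i < n) v 0 i * partial i (loss a x) u = 0.
  by apply: big1 => i _; rewrite cu mulr0.
have -> : \sum_(i < n) v 0 i * partial i (loss a x) u = 4 * slope u v.
  transitivity (\sum_(i < n) 4 * avg (fun k =>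
     (dotp (a k) u ^+ 3 / dotp (a k) x ^+ 2 - dotp (a k) u) * (a k 0 i * v 0 i))).
    apply: eq_bigr => i _; rewrite partial_loss mulrCA; congr (4 * _); rewrite -avgZ.
    by apply: eq_avg => k; ring.
  rewrite -mulr_sumr; congr (_ * _); rewrite /avg -mulr_sumr; congr (_ * _).
  by rewrite exchange_big; apply: eq_bigr => k _; rewrite -mulr_sumr.
by move=> /eqP; rewrite mulf_eq0 pnatr_eq0 /= => /eqP.
Qed.

(** Along the signal the factor [s^2] cancels the denominator. *)
Lemma bend_signal u : bend u x = 3 * mean_sqr a u - mean_sqr a x.
Proof.
rewrite /loss_bend /mean_sqr -avgZ -avgB; apply: eq_avg => k.
by have := s0 k; move: (dotp (a k) x) (dotp (a k) u) => s y sk; field.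
Qed.

Lemma local_minimizer_slope u v : local_minimizer (loss a x) u ->
  slope u v = 0 /\ 0 <= bend u v.
Proof.
move=> mu.
have := @quartic_near_ge0 R (4 * slope u v) (2 * bend u v)
  (4 * avg (fun k => dotp (a k) u * dotp (a k) v ^+ 3 / dotp (a k) x ^+ 2))
  (avg (fun k => dotp (a k) v ^+ 4 / dotp (a k) x ^+ 2)).
case.
  apply: filterS (near_line v mu) => h.
  by rewrite loss_expansion -!addrA lerDl !addrA.
move=> c1 c2; split; last by lra.
by move/eqP: c1; rewrite mulf_eq0 pnatr_eq0 /= => /eqP.
Qed.

Lemma local_maximizer_bend u v : local_maximizer (loss a x) u -> bend u v <= 0.
Proof.
move=> mu.
have := @quartic_near_ge0 R (- (4 * slope u v)) (- (2 * bend u v))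
  (- (4 * avg (fun k => dotp (a k) u * dotp (a k) v ^+ 3 / dotp (a k) x ^+ 2)))
  (- avg (fun k => dotp (a k) v ^+ 4 / dotp (a k) x ^+ 2)).
case; last by move=> _ c2; lra.
apply: filterS (near_line v mu) => h.
rewrite loss_expansion !mulrN -!opprD oppr_ge0; lra.
Qed.

Lemma mean_sqr_continuous : continuous (mean_sqr a).
Proof.
move=> u; apply: (@cvgM _ _ (nbhs u) _ (fun=> m%:R^-1)); first exact: cvg_cst.
move: u; apply: (continuous_big (op := +%R)); first exact: add_continuous.
move=> k _ u.
have := @dotp_continuous R n (a k) u => ck.
exact: (@cvgM _ _ (nbhs u) _ (dotp (a k)) (dotp (a k))).
Qed.

End loss.

(** * Strong convexity at the signal *)

(** With [y = s (1 + p)], [w = s (1 + q)] and [c = 1 + t p + (1 - t) q], the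
convexity gap is exactly [t (1 - t) s^2 (p - q)^2] times a polynomial whose
main part [6 c^2 - 2] is close to 4 for small [p] and [q]. *)
Lemma sqr_defect_strongly_convex (R : realType) (s y w t : R) : s != 0 ->
  10 * `|y - s| < `|s| -> 10 * `|w - s| < `|s| -> 0 <= t <= 1 ->
  ((t * y + (1 - t) * w) ^+ 2 - s ^+ 2) ^+ 2 / s ^+ 2 <=
  t * ((y ^+ 2 - s ^+ 2) ^+ 2 / s ^+ 2) + (1 - t) * ((w ^+ 2 - s ^+ 2) ^+ 2 / s ^+ 2)
  - t * (1 - t) * (y - w) ^+ 2.
Proof.
move=> s0 hy hw /andP[t0 t1].
pose al := y / s - 1; pose be := w / s - 1.
have yE : y = s * (1 + al) by rewrite /al; field.
have wE : w = s * (1 + be) by rewrite /be; field.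
have sp : 0 < `|s| by rewrite normr_gt0.
have ha : `|al| <= 10^-1.
  have : 10 * `|y - s| = `|s| * (10 * `|al|).
    by rewrite (_ : y - s = s * al) ?normrM; [ring|rewrite yE; ring].
  move=> E; rewrite E -[ltRHS]mulr1 ltr_pM2l// in hy; lra.
have hb : `|be| <= 10^-1.
  have : 10 * `|w - s| = `|s| * (10 * `|be|).
    by rewrite (_ : w - s = s * be) ?normrM; [ring|rewrite wE; ring].
  move=> E; rewrite E -[ltRHS]mulr1 ltr_pM2l// in hw; lra.
move: (al) (be) ha hb yE wE => {hy hw}p q; rewrite !ler_norml => /andP[p1 p2] /andP[q1 q2] -> ->.
pose c := 1 + t * p + (1 - t) * q; pose e := (1 - 2 * t) * (p - q).
have r0 : 0 <= 1 - t by lra.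
have c9 : 9 / 10 <= c.
  by have := ler_wpM2l t0 p1; have := ler_wpM2l r0 q1; rewrite /c; lra.
have e2 : - (2 / 10) <= e.
  have h1 : `|1 - 2 * t| <= 1 by rewrite ler_norml; apply/andP; split; lra.
  have h2 : `|p - q| <= 2 / 10 by rewrite ler_norml; apply/andP; split; lra.
  have : `|e| <= 1 * (2 / 10) by rewrite normrM; apply: ler_pM.
  by rewrite ler_norml mul1r => /andP[].
rewrite -subr_ge0.
have -> : t * (((s * (1 + p)) ^+ 2 - s ^+ 2) ^+ 2 / s ^+ 2) +
    (1 - t) * (((s * (1 + q)) ^+ 2 - s ^+ 2) ^+ 2 / s ^+ 2) -
    t * (1 - t) * (s * (1 + p) - s * (1 + q)) ^+ 2 -
    ((t * (s * (1 + p)) + (1 - t) * (s * (1 + q))) ^+ 2 - s ^+ 2) ^+ 2 / s ^+ 2 =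
  t * (1 - t) * (s * (p - q)) ^+ 2 *
    (c * (6 * c + 4 * e) + (1 - 3 * t + 3 * t ^+ 2) * (p - q) ^+ 2 - 3).
  by rewrite /c /e; field.
apply: mulr_ge0.
  by rewrite mulr_ge0 ?sqr_ge0// mulr_ge0.
have h1 : 0 <= (1 - 3 * t + 3 * t ^+ 2) * (p - q) ^+ 2.
  by rewrite mulr_ge0 ?sqr_ge0//; have := sqr_ge0 (2 * t - 1); lra.
have h2 : 9 / 10 * (46 / 10) <= c * (6 * c + 4 * e) by apply: ler_pM => //; lra.
lra.
Qed.

Lemma lossN (R : realType) (n m : nat) (a : 'I_m -> 'rV[R]_n) (x u : 'rV[R]_n) :
  loss a x (- u) = loss a x u.
Proof. by congr (_ * _); apply: eq_bigr => k _; rewrite dotpNr sqrrN. Qed.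

(** The neighbourhood is an intersection of slabs, hence convex.  The scalar
estimate yields the modulus [mean_sqr a (u - v)], which dominates a multiple of
the squared distance.  As [z] is [x] or [-x] in the application, only the
squares [(a_k . z)^2] are compared with [(a_k . x)^2]. *)
Lemma loss_strongly_convex_near (R : realType) (n m : nat) (a : 'I_m -> 'rV[R]_n)
    (x z : 'rV[R]_n) (kap : R) :
  (forall k, dotp (a k) x != 0) ->
  (forall k, dotp (a k) z ^+ 2 = dotp (a k) x ^+ 2) ->
  0 < kap -> (forall u, kap * norm2 u ^+ 2 <= mean_sqr a u) ->
  strongly_convex_near (loss a x) z.
Proof.
move=> s0 zx kap0 lower.
have z0 k : dotp (a k) z != 0.
  by rewrite -sqrf_eq0 zx sqrf_eq0.
(* A margin of 1/10 keeps the second derivative of each summand in y_k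
   bounded away from 0. *)
pose D : set 'rV[R]_n := [set u | forall k, 10 * `|dotp (a k) u - dotp (a k) z| < `|dotp (a k) z|].
have Dconv u v (t : R) : D u -> D v -> 0 <= t <= 1 -> D (t *: u + (1 - t) *: v).
  move=> Du Dv /andP[t0 t1] k; rewrite dotpDr !dotpZr.
  have r0 : 0 <= 1 - t by lra.
  have := Du k; have := Dv k.
  move: (dotp (a k) u) (dotp (a k) v) (dotp (a k) z) => y w s hw hy.
  have -> : t * y + (1 - t) * w - s = t * (y - s) + (1 - t) * (w - s) by ring.
  have := ler_normD (t * (y - s)) ((1 - t) * (w - s)).
  rewrite !normrM (ger0_norm t0) (ger0_norm r0) => h.
  have [->|tn0] := eqVneq t 0; first by rewrite !mul0r add0r subr0 mul1r.
  have tp : 0 < t by rewrite lt_neqAle eq_sym tn0.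
  have h1 : t * (10 * `|y - s|) < t * `|s| by rewrite ltr_pM2l.
  have h2 : (1 - t) * (10 * `|w - s|) <= (1 - t) * `|s| by rewrite ler_wpM2l// ltW.
  lra.
exists D; split.
- apply: (@filter_forall _ _ _ (nbhs z) (nbhs_filter z)) => k.
  have e0 : 0 < `|dotp (a k) z| / 10 by rewrite divr_gt0// normr_gt0.
  have /cvgrPdist_lt/(_ _ e0) := @dotp_continuous R n (a k) z.
  by apply: filterS => u; rewrite distrC => h; lra.
- move=> u v t; rewrite !inE => Du Dv.
  have t01 : 0 <= t%:num <= 1 by apply/andP; split.
  exact: Dconv Du Dv t01.
exists (2 * kap); first by rewrite mulr_gt0.
move=> u v Du Dv t t01.
have pw : loss a x (t *: u + (1 - t) *: v) <=
    t * loss a x u + (1 - t) * loss a x v - t * (1 - t) * mean_sqr a (u - v).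
  rewrite /mean_sqr -[loss a x u]/(avg _) -[loss a x v]/(avg _) -!avgZ -avgD -avgB.
  apply: avg_le => k; rewrite /= [dotp (a k) (_ + (1 - t) *: v)]dotpDr !dotpZr dotpBr -zx.
  exact: sqr_defect_strongly_convex (z0 k) (Du k) (Dv k) t01.
apply: le_trans pw _; rewrite lerD2l lerN2.
have -> : 2 * kap / 2 * t * (1 - t) * norm2 (u - v) ^+ 2 =
  t * (1 - t) * (kap * norm2 (u - v) ^+ 2) by field.
apply: ler_wpM2l => //; move/andP: t01 => [t0 t1].
by rewrite mulr_ge0// subr_ge0.
Qed.

(** * From benign samples to the landscape of the loss *)

Lemma loss_criticalZ (R : realType) (n m : nat) (a : 'I_m -> 'rV[R]_n)
    (x u : 'rV[R]_n) (c : R) : c != 0 -> (forall k, dotp (a k) x != 0) ->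
  loss_critical a x u -> loss_critical a (c *: x) (c *: u).
Proof.
move=> c0 s0 [h1 h2]; split.
  rewrite mean_sqrZ -h1 -avgZ; apply: eq_avg => k; rewrite !dotpZr.
  by have := s0 k; move: (dotp (a k) x) (dotp (a k) u) => s y sk; field; rewrite sk.
transitivity (c ^+ 2 * avg (fun k => dotp (a k) u ^+ 3 / dotp (a k) x)).
  rewrite -avgZ; apply: eq_avg => k; rewrite !dotpZr.
  by have := s0 k; move: (dotp (a k) x) (dotp (a k) u) => s y sk; field; rewrite sk.
by rewrite h2 -avgZ; apply: eq_avg => k; rewrite !dotpZr; ring.
Qed.

(** Everything in [benign] is homogeneous, so a multiple of [x] may be normalized. *)
Lemma benignZ (R : realType) (n m : nat) (a : 'I_m -> 'rV[R]_n)
    (x : 'rV[R]_n) (c : R) : c != 0 -> benign a (c *: x) -> benign a x.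
Proof.
move=> c0 [s0 lower land].
have s0' k : dotp (a k) x != 0.
  by have := s0 k; rewrite dotpZr mulf_eq0 negb_or => /andP[].
split => // u cu big.
have [||ux|ux] := land (c *: u).
- exact: loss_criticalZ.
- by rewrite !mean_sqrZ mulrCA ler_wpM2l ?sqr_ge0.
- by left; apply: scalerI ux.
- by right; apply: (scalerI c0); rewrite ux scalerN.
Qed.

Section benign.
Variables (R : realType) (n m : nat) (a : 'I_m -> 'rV[R]_n) (x : 'rV[R]_n).
Hypothesis x0 : x != 0.
Hypothesis bx : benign a x.
Implicit Types u v : 'rV[R]_n.

Let s0 k : dotp (a k) x != 0. Proof. by case: bx. Qed.

Lemma benign_mean_sqr_gt0 u : u != 0 -> 0 < mean_sqr a u.
Proof.
have [_ [kap kap0 lower] _] := bx; move=> u0; apply: lt_le_trans (lower u).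
by rewrite mulr_gt0// exprn_gt0// norm2_gt0.
Qed.

Lemma loss_ge0 u : 0 <= loss a x u.
Proof.
by apply: avg_ge0 => k; apply: divr_ge0; apply: sqr_ge0.
Qed.

Lemma loss_signal : loss a x x = 0.
Proof.
rewrite /loss big1 ?mulr0// => k _.
by rewrite subrr expr0n mul0r.
Qed.

Lemma signal_global_minimizer u : u = x \/ u = - x -> global_minimizer (loss a x) u.
Proof. by case=> -> v; rewrite ?lossN loss_signal loss_ge0. Qed.

(** The second derivative along [x] is nonnegative at a local minimizer, which by
[bend_signal] is the lower bound on [mean_sqr a u] required in [benign]. *)
Lemma benign_local_minimizer u :
  local_minimizer (loss a x) u -> u = x \/ u = - x.
Proof.
move=> mu; have [_ _] := bx; apply.
  have [hu _] := local_minimizer_slope s0 u mu.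
  by have [hx _] := local_minimizer_slope s0 x mu; exact: slope_critical.
have [_] := local_minimizer_slope s0 x mu.
by rewrite bend_signal// => h; lra.
Qed.

Lemma global_local_minimizer (f : 'rV[R]_n -> R) u :
  global_minimizer f u -> local_minimizer f u.
Proof. by move=> gu; exact: (@filterE _ (nbhs u) (nbhs_filter u) _ gu). Qed.

(** If [|y| <= |s|] then [(y^2 - s^2)^2 <= s^4], and this holds for all samples in a
neighbourhood of 0. *)
Lemma loss_local_maximizer0 : local_maximizer (loss a x) 0.
Proof.
have : \forall v \near (0 : 'rV[R]_n), forall k, `|dotp (a k) v| < `|dotp (a k) x|.
  apply: (@filter_forall _ _ _ (nbhs (0 : 'rV[R]_n)) (nbhs_filter _)) => k.
  have e0 : 0 < `|dotp (a k) x| by rewrite normr_gt0.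
  have /cvgrPdist_lt/(_ _ e0) := @dotp_continuous R n (a k) 0.
  by apply: filterS => v; rewrite dotp0r sub0r normrN.
apply: filterS => v hv; apply: avg_le => k.
rewrite ler_wpM2r ?invr_ge0 ?sqr_ge0// dotp0r expr0n /= sub0r sqrrN.
have : dotp (a k) v ^+ 2 <= dotp (a k) x ^+ 2.
  by rewrite -(real_normK (num_real (dotp (a k) v))) -(real_normK (num_real (dotp (a k) x)))
     ler_sqr ?nnegrE// ltW.
have := sqr_ge0 (dotp (a k) v).
by move: (dotp (a k) v ^+ 2) (dotp (a k) x ^+ 2) => p q p0 pq; nra.
Qed.

Lemma loss_hessian0 : hessian_negative_definite (loss a x) 0.
Proof.
move=> xi xi0; rewrite curvature_loss//.
have -> : loss_bend a x 0 xi = - mean_sqr a xi.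
  rewrite /loss_bend /mean_sqr -avgN; apply: eq_avg => k.
  by rewrite dotp0r expr0n mul0r mulr0 sub0r mulN1r.
by have := benign_mean_sqr_gt0 xi0; lra.
Qed.

(** At a critical point other than 0 the loss is strictly convex in the radial
direction, which excludes local maxima. *)
Lemma bend_critical u :
  loss_critical a x u -> loss_bend a x u u = 2 * mean_sqr a u.
Proof.
move=> [h1 _]; transitivity (3 * mean_sqr a u - mean_sqr a u); last by ring.
rewrite -{1}h1 /loss_bend /mean_sqr -avgZ -avgB; apply: eq_avg => k.
by have := s0 k; move: (dotp (a k) x) (dotp (a k) u) => s y sk; field.
Qed.

Lemma bend_signal_near u : 3 * mean_sqr a u < mean_sqr a x ->
  \forall v \near u, loss_bend a x v x < 0.
Proof.
move=> small.
have small' : mean_sqr a u < 3^-1 * mean_sqr a x by lra.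
have := @mean_sqr_continuous R n m a u.
move=> /cvgr_lt/(_ _ small'); apply: filterS => v vs.
by rewrite bend_signal//; move: vs; lra.
Qed.

Lemma benign_strict_saddle u : critical_point (loss a x) u ->
  u != 0 -> u != x -> u != - x -> strict_saddle (loss a x) u.
Proof.
move=> cu u0 ux uNx.
have lc : loss_critical a x u by apply: slope_critical => //; exact: critical_slope.
have small : 3 * mean_sqr a u < mean_sqr a x.
  rewrite ltNge; apply/negP => big.
  have [_ _ land] := bx.
  have [|e|e] := land _ lc; first by lra.
  - by rewrite e eqxx in ux.
  - by rewrite e eqxx in uNx.
split; first split => //.
- move=> /benign_local_minimizer [e|e].
  + by rewrite e eqxx in ux.
  + by rewrite e eqxx in uNx.
- move=> /(local_maximizer_bend s0 u); rewrite bend_critical//.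
  by have := benign_mean_sqr_gt0 u0; lra.
apply: filterS (bend_signal_near small) => v neg.
exists ((norm2 x)^-1 *: x); first exact: norm2_normalize.
rewrite curvature_loss//.
have -> : loss_bend a x v ((norm2 x)^-1 *: x) = (norm2 x)^-1 ^+ 2 * loss_bend a x v x.
  rewrite /loss_bend -avgZ; apply: eq_avg => k.
  by rewrite dotpZr exprMn; ring.
have c0 : 0 < (norm2 x)^-1 ^+ 2 by rewrite exprn_gt0// invr_gt0 norm2_gt0.
rewrite pmulr_rlt0// pmulr_rlt0//.
Qed.

Lemma benign_geometry :
  let f := loss a x in
  [/\ loss_well_defined a x,
      no_spurious_local_minimizers f,
      (forall u, global_minimizer f u <-> u = x \/ u = - x),
      strongly_convex_near f x /\ strongly_convex_near f (- x) &
      (local_maximizer f 0 /\ hessian_negative_definite f 0) /\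
      (forall u, critical_point f u -> u != 0 -> u != x -> u != - x ->
        strict_saddle f u)].
Proof.
move=> f; have [_ [kap kap0 lower] _] := bx; split => //.
- by move=> u /benign_local_minimizer; exact: signal_global_minimizer.
- move=> u; split; last exact: signal_global_minimizer.
  by move=> /global_local_minimizer/benign_local_minimizer.
- split; apply: loss_strongly_convex_near kap0 lower => // k.
  by rewrite dotpNr sqrrN.
- split; last exact: benign_strict_saddle.
  by split; [exact: loss_local_maximizer0|exact: loss_hessian0].
Qed.

End benign.

Theorem theorem2p1 (R : realType) :
  exists c C : R, [/\ 0 < c, 0 < C &
  forall (n m : nat) (x : 'rV[R]_n)
    (d : measure_display) (T : measurableType d) (P : probability T R)
    (a : 'I_m -> {RV P >-> borel_rV R n}),
  x != 0 -> iid_standard_gaussian a -> C * n%:R <= m%:R ->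
  exists E : set T,
    [/\ measurable E,
        ((1 - expR (- (c * m%:R)))%:E <= P E)%E &
    forall w : T, E w ->
      let f : 'rV[R]_n -> R := loss (fun k => a k w) x in
      [/\ loss_well_defined (fun k => a k w) x,
          no_spurious_local_minimizers f,
          (forall u, global_minimizer f u <-> u = x \/ u = - x),
          strongly_convex_near f x /\ strongly_convex_near f (- x) &
          (local_maximizer f 0 /\ hessian_negative_definite f 0) /\
          (forall u, critical_point f u -> u != 0 -> u != x -> u != - x ->
            strict_saddle f u)]]].
Proof.
have [c [C [c0 C0 h]]] := whp_benign R.
exists c, C; split => // n m x d T P a x0 iid nm.
have [F [mF PF good]] := h _ _ _ _ _ _ _ (norm2_normalize x0) iid nm.
exists (~` F); split.
- exact: measurableC.
- rewrite probability_setC// EFinB; exact: leeB.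
move=> w nFw; apply: benign_geometry => //.
apply: (@benignZ _ _ _ _ _ (norm2 x)^-1); last exact: good.
by rewrite invr_eq0 norm2_eq0.
Qed.
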